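(* Let $\Lambda$ be a finite-dimensional algebra over a field, and let $\mathcal{K}_\Lambda=\mathcal{K}^{[-1,0]}(\operatorname{proj}\Lambda)$. There exist well defined maps $$\beta:\operatorname{cotor}\mathcal{K}_\Lambda\to\operatorname{thick}\mathcal{K}_\Lambda,\qquad \iota:\operatorname{thick}\mathcal{K}_\Lambda\to\operatorname{cotor}\mathcal{K}_\Lambda$$ between the set $\operatorname{cotor}\mathcal{K}_\Lambda$ of cotorsion pairs in $\mathcal{K}_\Lambda$ and the set $\operatorname{thick}\mathcal{K}_\Lambda$ of thick subcategories of $\mathcal{K}_\Lambda$ such that, when restricted to the set of complete cotorsion pairs in $\mathcal{K}_\Lambda$ and the set of thick subcategories of $\mathcal{K}_\Lambda$ with enough injectives, $\beta$ and $\iota$ are inverse to each other.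
   Context: $\operatorname{mod}\Lambda$ is the category of finitely generated $\Lambda$-modules and $\mathcal{K}_\Lambda=\mathcal{K}^{[-1,0]}(\operatorname{proj}\Lambda)$ is the full subcategory of $\mathcal{K}^b(\operatorname{proj}\Lambda)\subset\mathcal{D}^b(\operatorname{mod}\Lambda)$ of complexes of finitely generated projective modules concentrated in degrees $-1$ and $0$, $X=(X^{-1}\to X^0)$, up to homotopy. It is extension-closed, hence extriangulated, with $\mathbb{E}(X,Y)=\operatorname{Hom}_{\mathcal{D}^b(\operatorname{mod}\Lambda)}(X,Y[1])$. A sequence $X\xrightarrow{f}Y\xrightarrow{g}Z$ in $\mathcal{K}_\Lambda$ is a conflation, written $X\rightarrowtail Y\twoheadrightarrow Z$, if there is $h:Z\to X[1]$ such that $(f,g,h)$ is a triangle in $\mathcal{D}^b(\operatorname{mod}\Lambda)$. All subcategories are full and closed under isomorphisms. A subcategory $\mathcal{T}\subset\mathcal{K}_\Lambda$ is thick if it is closed under direct summands and, for every conflation $X\rightarrowtail Y\twoheadrightarrow Z$, if two of the terms lie in $\mathcal{T}$ then so does the third. An object $I$ of a thick subcategory $\mathcal{T}$ is injective in $\mathcal{T}$ if $\mathbb{E}(X,I)=0$ for all $X\in\mathcal{T}$; $\mathcal{T}$ has enough injectives if each $X\in\mathcal{T}$ admits a conflation $X\rightarrowtail I\twoheadrightarrow X''$ with $I$ injective in $\mathcal{T}$ and $X''\in\mathcal{T}$. A cotorsion pair in $\mathcal{K}_\Lambda$ is a pair $(\mathcal{X},\mathcal{Y})$ of full additive subcategories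 such that $\mathcal{Y}=\{Y\in\mathcal{K}_\Lambda\mid\mathbb{E}(X,Y)=0\ \forall X\in\mathcal{X}\}$ and $\mathcal{X}=\{X\in\mathcal{K}_\Lambda\mid\mathbb{E}(X,Y)=0\ \forall Y\in\mathcal{Y}\}$. It is complete if every $Z\in\mathcal{K}_\Lambda$ fits into conflations $Y\rightarrowtail X\twoheadrightarrow Z$ and $Z\rightarrowtail Y'\twoheadrightarrow X'$ with $X,X'\in\mathcal{X}$ and $Y,Y'\in\mathcal{Y}$. *)

(* Defs.v *)
From HB Require Import structures.
From mathcomp Require Import all_boot all_order all_algebra all_field.

Set Implicit Arguments.
Unset Strict Implicit.
Unset Printing Implicit Defensive.

Import GRing.Theory.
Local Open Scope ring_scope.

Local Obligation Tactic := idtac.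

Definition lin_of (R : pzRingType) (U V : lmodType R) (f : U -> V)
    (lin_f : linear f) : {linear U -> V} :=
  HB.pack f (GRing.isLinear.Build R U V *:%R f lin_f).

Section Modules.
Variable R : pzRingType.

Definition finitely_generated (M : lmodType R) : Prop :=
  exists (n : nat) (e : 'I_n -> M),
    forall x : M, exists c : 'I_n -> R, x = \sum_(i < n) c i *: e i.

Definition projective (P : lmodType R) : Prop :=
  forall (M N : lmodType R) (p : {linear M -> N}) (f : {linear P -> N}),
    (forall y : N, exists x : M, p x = y) ->
    exists g : {linear P -> M}, forall x, p (g x) = f x.

Definition zero_module (M : lmodType R) : Prop := forall x : M, x = 0.

Lemma zero_module_fg M : zero_module M -> finitely_generated M.
Proof.
move=> M0; exists 0%N, (fun=> 0) => x.
by exists (fun=> 0); rewrite big_ord0 (M0 x).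
Qed.

Lemma zero_module_proj M : zero_module M -> projective M.
Proof.
move=> M0 A B p f _; exists (\0 : {linear M -> A}) => x.
by rewrite (M0 x) !linear0.
Qed.

Lemma zero_module_rV0 : zero_module ('rV[R]_0).
Proof. by move=> x; rewrite thinmx0. Qed.

Lemma zero_module_pair (M N : lmodType R) :
  zero_module M -> zero_module N -> zero_module (M * N)%type.
Proof. by move=> M0 N0 [x y]; rewrite (M0 x) (N0 y). Qed.

Lemma fg_pair (M N : lmodType R) :
  finitely_generated M -> finitely_generated N ->
  finitely_generated (M * N)%type.
Proof.
move=> [m [e eM]] [n [e' eN]].
exists (m + n)%N, (fun i => match split i with
   | inl j => (e j, 0) | inr j => (0, e' j) end) => -[x y].
have [c ->] := eM x; have [c' ->] := eN y.
exists (fun i => match split i with inl j => c j | inr j => c' j end).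
rewrite big_split_ord /=.
rewrite (eq_bigr (fun i => (c i *: e i, 0))); last first.
  by move=> i _; rewrite -[lshift n i]/(unsplit (inl i)) unsplitK;
     congr pair; rewrite /= scaler0.
rewrite [X in _ = _ + X](eq_bigr (fun i => (0, c' i *: e' i))); last first.
  by move=> i _; rewrite -[rshift m i]/(unsplit (inr i)) unsplitK;
     congr pair; rewrite /= scaler0.
have sum1 (I : finType) (F : I -> M * N) :
    \sum_i F i = (\sum_i (F i).1, \sum_i (F i).2).
  apply: (big_ind3 (fun z a b => z = (a, b))) => [//|_ a b _ c0 d -> -> //|i _].
  by case: (F i).
rewrite !sum1 /=; congr pair => /=.
  by rewrite [X in _ = _ + X]big1 ?addr0 // => i _; rewrite scaler0.
by rewrite [X in _ = X + _]big1 ?add0r // => i _; rewrite scaler0.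
Qed.

Lemma proj_pair (P Q : lmodType R) :
  projective P -> projective Q -> projective (P * Q)%type.
Proof.
move=> prP prQ M N p f psurj.
have linl : linear (fun x : P => f (x, 0)).
  by move=> a x y; rewrite -linearP; congr (f _); congr pair;
      rewrite /= scaler0 addr0.
have linr : linear (fun x : Q => f (0, x)).
  by move=> a x y; rewrite -linearP; congr (f _); congr pair;
      rewrite /= scaler0 addr0.
have [g gE] := prP _ _ p (lin_of linl) psurj.
have [h hE] := prQ _ _ p (lin_of linr) psurj.
have ling : linear (fun z : P * Q => g z.1 + h z.2).
  by move=> a x y /=; rewrite !linearP scalerDr addrACA.
exists (lin_of ling) => -[x y] /=; rewrite linearD gE hE /= -linearD.
by congr (f _); congr pair; rewrite /= ?addr0 ?add0r.
Qed.

End Modules.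

Section Complexes.
Variable R : pzRingType.

(* Bounded complexes of finitely generated left modules, cohomological
   grading: the objects of K^b(mod R) and of D^b(mod R). *)
Record cplx := Cplx {
  term :> int -> lmodType R;
  diff : forall i : int, {linear term i -> term (i + 1)};
  diffK : forall i (x : term i), diff (i + 1) (diff i x) = 0;
  term_fg : forall i, finitely_generated (term i);
  term_bounded : exists n : nat, forall i : int,
    (n < `|i|)%N -> zero_module (term i)
}.

Record chain_map (A B : cplx) := ChainMap {
  cmap :> forall i, {linear A i -> B i};
  cmapC : forall i (x : A i), cmap (i + 1) (diff A i x) = diff B i (cmap i x)
}.

Program Definition chain_id (A : cplx) : chain_map A A :=
  {| cmap := fun i => idfun |}.
Next Obligation. by []. Qed.

Program Definition chain_zero (A B : cplx) : chain_map A B :=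
  {| cmap := fun i => \0 |}.
Next Obligation. by move=> A B i x; rewrite linear0. Qed.

Program Definition chain_comp (A B C : cplx)
    (g : chain_map B C) (f : chain_map A B) : chain_map A C :=
  {| cmap := fun i => g i \o f i |}.
Next Obligation. by move=> A B C g f i x /=; rewrite !cmapC. Qed.

(* [s i] is the component A^(i+1) -> B^i of the homotopy; as i ranges over
   all integers, i + 1 ranges over all degrees. *)
Definition homotopic (A B : cplx) (f g : chain_map A B) : Prop :=
  exists s : forall i : int, {linear A (i + 1) -> B i},
    forall i (x : A (i + 1)),
      f (i + 1) x - g (i + 1) x
      = diff B i (s i x) + s (i + 1) (diff A (i + 1) x).

(* [f] induces injective and surjective maps on all cohomology modules; the
   cohomology is taken in degree i + 1, which ranges over all degrees. *)
Definition quasi_iso (A B : cplx) (f : chain_map A B) : Prop :=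
  forall i : int,
    (forall x : A (i + 1), diff A (i + 1) x = 0 ->
       (exists y : B i, f (i + 1) x = diff B i y) ->
       exists w : A i, x = diff A i w)
    /\
    (forall y : B (i + 1), diff B (i + 1) y = 0 ->
       exists (x : A (i + 1)) (w : B i),
         diff A (i + 1) x = 0 /\ y = f (i + 1) x + diff B i w).

Program Definition czero : cplx :=
  {| term := fun=> 'rV[R]_0; diff := fun=> \0 |}.
Next Obligation. by []. Qed.
Next Obligation. by move=> i; apply/zero_module_fg/zero_module_rV0. Qed.
Next Obligation. by exists 0%N => i _; apply: zero_module_rV0. Qed.

Lemma csum_diff_linear (A B : cplx) (i : int) :
  linear (fun z : A i * B i => (diff A i z.1, diff B i z.2)).
Proof. by move=> a x y; congr pair; rewrite /= linearP. Qed.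

Program Definition csum (A B : cplx) : cplx :=
  {| term := fun i => (A i * B i)%type;
     diff := fun i => lin_of (csum_diff_linear (i := i)) |}.
Next Obligation. by move=> A B i [x y] /=; rewrite !diffK. Qed.
Next Obligation. by move=> A B i; apply: fg_pair; apply: term_fg. Qed.
Next Obligation.
move=> A B; have [m mA] := term_bounded A; have [n nB] := term_bounded B.
exists (m + n)%N => i lt_i; apply: zero_module_pair.
  by apply: mA; apply: leq_ltn_trans lt_i; apply: leq_addr.
by apply: nB; apply: leq_ltn_trans lt_i; apply: leq_addl.
Qed.

Lemma bounded_succ (A : cplx) : exists n : nat, forall i : int,
  (n < `|i|)%N -> zero_module (A (i + 1)).
Proof.
have [n nA] := term_bounded A; exists n.+1 => i lt_i; apply: nA.
case: i lt_i => [i|i] lt_i; last first.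
  by rewrite NegzE -[i.+1]addn1 PoszD opprD addrNK abszN.
by rewrite -[1]/(Posz 1) -PoszD absz_nat addn1; apply/ltnW/leqW.
Qed.

Program Definition cshift (A : cplx) : cplx :=
  {| term := fun i => A (i + 1);
     diff := fun i => \- (diff A (i + 1)) |}.
Next Obligation. by move=> A i x /=; rewrite linearN opprK diffK. Qed.
Next Obligation. by move=> A i; apply: term_fg. Qed.
Next Obligation. exact: bounded_succ. Qed.

Program Definition chain_shift (A B : cplx) (f : chain_map A B) :
    chain_map (cshift A) (cshift B) :=
  {| cmap := fun i => f (i + 1) |}.
Next Obligation. by move=> A B f i x /=; rewrite linearN cmapC. Qed.

Lemma quasi_iso_shift (A B : cplx) (f : chain_map A B) :
  quasi_iso f -> quasi_iso (chain_shift f).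
Proof.
move=> qf i; have [inj sur] := qf (i + 1); split=> /= [x|y] /eqP.
  rewrite oppr_eq0 => /eqP dx [y fx].
  have [|w ->] := inj x dx; first by exists (- y); rewrite linearN.
  by exists (- w); rewrite linearN opprK.
rewrite oppr_eq0 => /eqP /sur[x [w [dx ->]]].
by exists x, (- w); rewrite dx oppr0 linearN opprK.
Qed.

Section Cone.
Variables (A B : cplx) (f : chain_map A B).

Lemma cone_diff_linear (i : int) :
  linear (fun z : A (i + 1) * B i =>
    (- diff A (i + 1) z.1, f (i + 1) z.1 + diff B i z.2)).
Proof.
move=> a x y; congr pair; rewrite /=; first by rewrite linearP opprD scalerN.
by rewrite !linearP scalerDr addrACA.
Qed.

Program Definition cone : cplx :=
  {| term := fun i => (A (i + 1)%R * B i)%type;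
     diff := fun i => lin_of (cone_diff_linear (i := i)) |}.
Next Obligation.
move=> i [x y] /=; rewrite linearN diffK !oppr0.
by rewrite linearN linearD cmapC diffK addr0 addNr.
Qed.
Next Obligation. by move=> i; apply: fg_pair; apply: term_fg. Qed.
Next Obligation.
have [m mA] := bounded_succ A; have [n nB] := term_bounded B.
exists (m + n)%N => i lt_i; apply: zero_module_pair.
  by apply: mA; apply: leq_ltn_trans lt_i; apply: leq_addr.
by apply: nB; apply: leq_ltn_trans lt_i; apply: leq_addl.
Qed.

Lemma cone_in_linear (i : int) :
  linear (fun y : B i => ((0, y) : A (i + 1) * B i)).
Proof. by move=> a x y; congr pair; rewrite /= scaler0 addr0. Qed.

Program Definition cone_in : chain_map B cone :=
  {| cmap := fun i => lin_of (cone_in_linear (i := i)) |}.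
Next Obligation. by move=> i x /=; rewrite !linear0 add0r. Qed.

Lemma cone_out_linear (i : int) :
  linear (fun z : A (i + 1) * B i => z.1).
Proof. by []. Qed.

Program Definition cone_out : chain_map cone (cshift A) :=
  {| cmap := fun i => lin_of (cone_out_linear (i := i)) |}.
Next Obligation. by []. Qed.

End Cone.

(* D^b(mod R) is the Gabriel-Zisman localization of K^b(mod R) at the
   quasi-isomorphisms: a morphism is a formal composite of chain maps and
   formal inverses of quasi-isomorphisms, and [deq] is equality of morphisms,
   the congruence generated by the relations of the localization. *)
Inductive dmor : cplx -> cplx -> Type :=
| dmap A B (f : chain_map A B) : dmor A B
| dinv A B (s : chain_map A B) (qs : quasi_iso s) : dmor B A
| dcomp A B C (v : dmor B C) (u : dmor A B) : dmor A C.

Definition did (A : cplx) : dmor A A := dmap (chain_id A).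

Inductive deq : forall A B, dmor A B -> dmor A B -> Prop :=
| deq_refl A B (u : dmor A B) : deq u u
| deq_sym A B (u v : dmor A B) : deq u v -> deq v u
| deq_trans A B (u v w : dmor A B) : deq u v -> deq v w -> deq u w
| deq_congr A B C (v v' : dmor B C) (u u' : dmor A B) :
    deq v v' -> deq u u' -> deq (dcomp v u) (dcomp v' u')
| deq_assoc A B C D (w : dmor C D) (v : dmor B C) (u : dmor A B) :
    deq (dcomp w (dcomp v u)) (dcomp (dcomp w v) u)
| deq_idl A B (u : dmor A B) : deq (dcomp (did B) u) u
| deq_idr A B (u : dmor A B) : deq (dcomp u (did A)) u
| deq_comp A B C (g : chain_map B C) (f : chain_map A B) :
    deq (dcomp (dmap g) (dmap f)) (dmap (chain_comp g f))
| deq_homotopic A B (f g : chain_map A B) :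
    homotopic f g -> deq (dmap f) (dmap g)
| deq_invl A B (s : chain_map A B) (qs : quasi_iso s) :
    deq (dcomp (dinv qs) (dmap s)) (did A)
| deq_invr A B (s : chain_map A B) (qs : quasi_iso s) :
    deq (dcomp (dmap s) (dinv qs)) (did B).

Fixpoint dshift A B (u : dmor A B) : dmor (cshift A) (cshift B) :=
  match u with
  | dmap _ _ f => dmap (chain_shift f)
  | dinv _ _ _ qs => dinv (quasi_iso_shift qs)
  | dcomp _ _ _ v u => dcomp (dshift v) (dshift u)
  end.

Definition diso A B (u : dmor A B) : Prop :=
  exists v : dmor B A, deq (dcomp v u) (did A) /\ deq (dcomp u v) (did B).

Definition triangle X Y Z
    (f : dmor X Y) (g : dmor Y Z) (h : dmor Z (cshift X)) : Prop :=
  exists (A B : cplx) (p : chain_map A B)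
         (a : dmor X A) (b : dmor Y B) (c : dmor Z (cone p)),
    [/\ diso a, diso b & diso c] /\
    [/\ deq (dcomp b f) (dcomp (dmap p) a),
        deq (dcomp c g) (dcomp (dmap (cone_in p)) b)
      & deq (dcomp (dshift a) h) (dcomp (dmap (cone_out p)) c)].

(* The objects of K^[-1,0](proj R); its morphisms are the chain maps up to
   [homotopic]. *)
Record K2 := MkK2 {
  K2_cplx :> cplx;
  K2_proj : forall i, projective (K2_cplx i);
  K2_conc : forall i : int, i != -1 -> i != 0 -> zero_module (K2_cplx i)
}.

Program Definition K2_zero : K2 := {| K2_cplx := czero |}.
Next Obligation. by move=> i; apply/zero_module_proj/zero_module_rV0. Qed.
Next Obligation. by move=> i _ _; apply: zero_module_rV0. Qed.

Program Definition K2_sum (X Y : K2) : K2 := {| K2_cplx := csum X Y |}.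
Next Obligation. by move=> X Y i; apply: proj_pair; apply: K2_proj. Qed.
Next Obligation.
by move=> X Y i i1 i0; apply: zero_module_pair; apply: K2_conc.
Qed.

Definition K2_iso (X Y : K2) : Prop :=
  exists (f : chain_map X Y) (g : chain_map Y X),
    homotopic (chain_comp g f) (chain_id X) /\
    homotopic (chain_comp f g) (chain_id Y).

Definition summand (X Y : K2) : Prop :=
  exists X' : K2, K2_iso (K2_sum X X') Y.

(* E(X, Y) = Hom_{D^b(mod R)}(X, Y[1]) vanishes. *)
Definition E_zero (X Y : K2) : Prop :=
  forall u : dmor X (cshift Y), deq u (dmap (chain_zero X (cshift Y))).

Definition conflation (X Y Z : K2)
    (f : chain_map X Y) (g : chain_map Y Z) : Prop :=
  exists h : dmor Z (cshift X), triangle (dmap f) (dmap g) h.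

Definition has_conflation (X Y Z : K2) : Prop :=
  exists (f : chain_map X Y) (g : chain_map Y Z), conflation f g.

(* A full subcategory is given by the class of its objects. *)
Definition additive_subcat (T : K2 -> Prop) : Prop :=
  [/\ T K2_zero,
      forall X Y, T X -> T Y -> T (K2_sum X Y)
    & forall X Y, K2_iso X Y -> T X -> T Y].

(* Requiring additivity excludes the empty class; for nonempty classes it
   already follows from the other clauses. *)
Definition is_thick (T : K2 -> Prop) : Prop :=
  [/\ additive_subcat T,
      forall X Y, summand X Y -> T Y -> T X
    & forall X Y Z, has_conflation X Y Z ->
        [/\ T X -> T Y -> T Z, T X -> T Z -> T Y & T Y -> T Z -> T X]].

Definition injective_in (T : K2 -> Prop) (I : K2) : Prop :=
  T I /\ forall X, T X -> E_zero X I.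

Definition has_enough_injectives (T : K2 -> Prop) : Prop :=
  forall X, T X -> exists I X'',
    [/\ injective_in T I, T X'' & has_conflation X I X''].

Definition is_cotorsion_pair (c : (K2 -> Prop) * (K2 -> Prop)) : Prop :=
  [/\ additive_subcat c.1, additive_subcat c.2,
      forall Y, c.2 Y <-> (forall X, c.1 X -> E_zero X Y)
    & forall X, c.1 X <-> (forall Y, c.2 Y -> E_zero X Y)].

Definition is_complete (c : (K2 -> Prop) * (K2 -> Prop)) : Prop :=
  forall Z : K2,
    (exists Y X, [/\ c.2 Y, c.1 X & has_conflation Y X Z]) /\
    (exists Y' X', [/\ c.2 Y', c.1 X' & has_conflation Z Y' X']).

Definition cotor : Type :=
  {c : (K2 -> Prop) * (K2 -> Prop) | is_cotorsion_pair c}.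
Definition thick : Type := {T : K2 -> Prop | is_thick T}.

End Complexes.

(* Main.v *)
Require Import Defs.
From HB Require Import structures.
From mathcomp Require Import all_boot all_order all_algebra all_field.
From mathcomp.classical Require Import boolp.

(** A cotorsion pair [(calX, calY)] is sent to the class of those [X] in [calX]
such that every conflation [X -> X' -> Z] with [X'] in [calX] has [Z] in [calX]
([core]); a thick subcategory [T] is sent to the cotorsion pair it generates,
whose right class consists of the [Y] with [E(T, Y) = 0] ([cotorsion_of]).

A morphism in the derived category out of a two-term complex of projectives is
a homotopy class of chain maps. Hence [E(Z, X)] is the cokernel of the map
[(s, t) |-> d s + t d] into the maps from degree -1 of [Z] to degree 0 of [X]
([E_zeroP]), and a conflation is, up to isomorphism, a termwise split extension
given by such a map ([conflationP]). In particular [E] is right exact in both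
variables, so a left class is closed under extensions and subobjects, a right
class under extensions and quotients. With pushouts and the extension of
classes along inflations this makes the core thick ([core_thick]).

Let [(calX, calY)] be complete. Among the conflations [Z -> Y -> X] with [Y] in
[calY] and [X] in [calX] take one with [X] of least dimension. If [X -> X'] is an
inflation into [calX], the class of the conflation extends to [X'] and factors
back through [X], since [E(X', Y) = 0]; this gives an endomorphism of [X] that
fixes the class. By a Fitting decomposition it is invertible, as otherwise a
summand of [X] could be dropped. So the inflation splits and [X] lies in the
core ([minimal_class], [complete_core]). For [Z] in the core this conflation is
an injective coresolution. If [Z] is right orthogonal to the core it splits, so
[Z] lies in [calY].

Let [T] be thick with enough injectives. The injectives of [T] form a rigid class
with the same right orthogonal as [T]. Completeness of the generated pair
requires a member [L] of this class such that all extensions of the class by a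
given object come from [L]. For a sum [M] of finitely many members let [B] be the
universal extension, so that [E(M, B) = 0]. Divide the degree 0 part of [B] by
the boundaries and by the images of all maps from the class; over the quotient
module [Q] rigidity makes [Hom(W0, Q) -> Hom(W1, Q)] injective for every member
[W], with cokernel [E(W, B)] ([ext_zero_numerical]). Thus [E(W, B) = 0] means that
two dimensions agree, and this is a linear condition on the class of [W] in the
Grothendieck group of projectives, which has finite rank as there are finitely
many simple modules ([hdiff_class]). If the classes of the summands of [M] span
those of all members, then [E(W, B) = 0] for every [W] ([rigid_approximation]).

Finally [T] is recovered from the pair. By Salce's construction a member of
the left class is a summand of an extension [E] of an injective [L] of [T] by a
projective stalk [P]. If [X -> E] is an inflation with cokernel [C], the composite
[X -> L] is an inflation as well, because its cone is the cone of [P -> C]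
([conf_cross]). Comparing the two cokernels gives both inclusions between [T] and
the core of the left class ([sub_core], [core_sub]). *)

Set Implicit Arguments.
Unset Strict Implicit.
Unset Printing Implicit Defensive.

Import GRing.Theory.
Local Open Scope ring_scope.
Local Obligation Tactic := idtac.

(** * Abelian group identities *)

Inductive zexp := ZVar of nat | ZZero | ZAdd of zexp & zexp | ZOpp of zexp.

Fixpoint zeval (V : zmodType) (env : seq V) e : V :=
  match e with
  | ZVar i => nth 0 env i
  | ZZero => 0
  | ZAdd a b => zeval env a + zeval env b
  | ZOpp a => - zeval env a
  end.

Fixpoint zcount (i : nat) e : int :=
  match e with
  | ZVar j => if i == j then 1 else 0
  | ZZero => 0
  | ZAdd a b => zcount i a + zcount i b
  | ZOpp a => - zcount i a
  end.

Fixpoint zbound n e : bool :=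
  match e with
  | ZVar j => (j < n)%N
  | ZZero => true
  | ZAdd a b => zbound n a && zbound n b
  | ZOpp a => zbound n a
  end.

Lemma zevalE (V : zmodType) (env : seq V) e : zbound (size env) e ->
  zeval env e = \sum_(i < size env) env`_i *~ zcount i e.
Proof.
elim: e => [j|_|a IHa b IHb /andP[/IHa aE /IHb bE]|a IHa /IHa aE] /=.
- move=> lt_j; rewrite (bigD1 (Ordinal lt_j)) //= eqxx mulr1z.
  rewrite big1 ?addr0 // => i; rewrite -val_eqE /= => /negPf ->.
  by rewrite mulr0z.
- by rewrite big1 // => i _; rewrite mulr0z.
- by rewrite aE bE -big_split /=; apply: eq_bigr => i _; rewrite mulrzDr.
- by rewrite aE -sumrN; apply: eq_bigr => i _; rewrite mulrNz.
Qed.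

(** The soundness of the tactic [abel] below: signed numbers of occurrences are
the coordinates of a free abelian group, and comparing them is a computation. *)
Lemma zeval_eq (V : zmodType) (env : seq V) a b :
  [&& zbound (size env) a, zbound (size env) b &
      all (fun i => zcount i a == zcount i b) (iota 0 (size env))] ->
  zeval env a = zeval env b.
Proof.
case/and3P=> ba bb /allP eqab; rewrite !zevalE //.
apply: eq_bigr => i _; congr (_ *~ _); apply/eqP/eqab.
by rewrite mem_iota /=.
Qed.

(* Two displays of one term may carry different but convertible structures;
   values of linear maps are compared through the map and its argument. *)
Ltac zsame x y :=
  first [ constr_eq x y
  | lazymatch x with
    | @GRing.Linear.sort _ _ _ _ ?f ?a =>
        lazymatch y with
        | @GRing.Linear.sort _ _ _ _ ?g ?b => unify f g; zsame a b
        end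
    | (?a *: ?u)%R =>
        lazymatch y with (?b *: ?v)%R => unify a b; zsame u v end
    | _ =>
        lazymatch y with
        | @GRing.Linear.sort _ _ _ _ _ _ => fail
        | (_ *: _)%R => fail
        | _ => unify x y
        end
    end ].
Ltac zindex x env :=
  lazymatch env with
  | cons ?y ?s => match constr:(Set) with
      | _ => let _ := match constr:(Set) with _ => zsame x y end in constr:(0%N)
      | _ => let i := zindex x s in constr:(S i)
      end
  end.
Ltac zatoms V t env :=
  lazymatch t with
  | (?a + ?b)%R => let e := zatoms V a env in zatoms V b e
  | (- ?a)%R => zatoms V a env
  | 0%R => env
  | _ => match env with
    | _ => let i := zindex t env in env
    | _ => constr:(@cons V t env)
    end
  end.
Ltac zreify t env :=
  lazymatch t with
  | (?a + ?b)%R => let x := zreify a env in let y := zreify b env in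
                   constr:(ZAdd x y)
  | (- ?a)%R => let x := zreify a env in constr:(ZOpp x)
  | 0%R => constr:(ZZero)
  | _ => let i := zindex t env in constr:(ZVar i)
  end.
Ltac abel :=
  lazymatch goal with |- @eq ?T ?l ?r =>
    let e0 := zatoms T l (@nil T) in
    let e := zatoms T r e0 in
    let a := zreify l e in let b := zreify r e in
    apply: (@zeval_eq _ e a b); vm_compute; reflexivity
  end.

(* Restated so that rewriting leaves the map in the form [f x], whichever of
   the inherited structures of [f] the general lemma would display. *)
Section LinearRules.
Variables (R : pzRingType) (U V : lmodType R) (f : {linear U -> V}).
Lemma linD x y : f (x + y) = f x + f y. Proof. exact: linearD. Qed.
Lemma linN x : f (- x) = - f x. Proof. exact: linearN. Qed.
Lemma linB x y : f (x - y) = f x - f y. Proof. exact: linearB. Qed.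
Lemma lin0 : f 0 = 0. Proof. exact: linear0. Qed.
Lemma linZ a x : f (a *: x) = a *: f x. Proof. exact: linearZ_LR. Qed.
End LinearRules.

Ltac push_linear :=
  rewrite ?(opprK, opprD, oppr0);
  repeat match goal with
  | |- context [@GRing.Linear.sort _ _ _ _ ?f (?x + ?y)%R] => rewrite (linD f x y)
  | |- context [@GRing.Linear.sort _ _ _ _ ?f (- ?x)%R] => rewrite (linN f x)
  | |- context [@GRing.Linear.sort _ _ _ _ ?f 0%R] => rewrite (lin0 f)
  | |- context [@GRing.Linear.sort _ _ _ _ ?f (?a *: ?x)%R] => rewrite (linZ f a x)
  | |- context [(?a *: (?x + ?y))%R] => rewrite (scalerDr a x y)
  | |- context [(?a *: 0)%R] => rewrite (scaler0 _ a)
  | |- context [(?a *: - ?x)%R] => rewrite (scalerN a x)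
  end.

Ltac label := push_linear; abel.

Ltac split_pair :=
  lazymatch goal with |- (_, _) = _ => apply: injective_projections => /= end.

Ltac lin_tac :=
  let a := fresh "a" in let u := fresh "u" in let v := fresh "v" in
  move=> a u v /=; repeat split_pair; push_linear => /=; label.

Notation "[ 'lin' f ]" := (@lin_of _ _ _ f ltac:(lin_tac)) (only parsing).

(** Uses a hypothesis [x = y] modulo the abelian group laws: what remains to be
proved is an identity, or a use of the next hypothesis. *)
Lemma eq_of_eq (V : zmodType) (x y l r : V) : x = y -> l - r = x - y -> l = r.
Proof. by move=> -> /eqP; rewrite subrr subr_eq0 => /eqP. Qed.

(** * Finitely generated projective modules *)

Section Projectives.
Variable R : pzRingType.

Lemma projective_coordinates (P : lmodType R) :
  finitely_generated P -> projective P ->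
  exists (n : nat) (e : 'I_n -> P) (c : {linear P -> 'rV[R]_n}),
    forall x, x = \sum_(i < n) c x 0 i *: e i.
Proof.
move=> [n [e eP]] prP.
have lin_s : linear (fun v : 'rV[R]_n => \sum_(i < n) v 0 i *: e i).
  move=> a u v; rewrite scaler_sumr -big_split; apply: eq_bigr => i _ /=.
  by rewrite !mxE scalerDl scalerA.
have [|c cP] := prP _ _ (lin_of lin_s) idfun.
  move=> y; have [c ->] := eP y; exists (\row_i c i) => /=.
  by apply: eq_bigr => i _; rewrite mxE.
by exists n, e, c => x; rewrite -[LHS]cP.
Qed.

(** A total relation that is compatible with the linear structure contains
the graph of a linear map as soon as its source is finitely generated
projective: choose values on the generators and extend through the
coordinate functionals.  All liftings below are of this kind, so submodules
and quotients need not be formed as types. *)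
Lemma projective_select (P M : lmodType R) (rel : P -> M -> Prop) :
  finitely_generated P -> projective P ->
  rel 0 0 ->
  (forall a x y m n, rel x m -> rel y n -> rel (a *: x + y) (a *: m + n)) ->
  (forall x, exists m, rel x m) ->
  exists g : {linear P -> M}, forall x, rel x (g x).
Proof.
move=> fgP prP rel0 relD relT.
have [n [e [c eP]]] := projective_coordinates fgP prP.
pose m i := sval (cid (relT (e i))).
have lin_g : linear (fun x => \sum_(i < n) c x 0 i *: m i).
  move=> a x y; rewrite scaler_sumr -big_split; apply: eq_bigr => i _ /=.
  by rewrite linearP !mxE scalerDl scalerA.
exists (lin_of lin_g) => x; rewrite [X in rel X]eP /=.
elim/big_ind2: _ => // [x1 m1 x2 m2 r1 r2|i _].
  by rewrite -[x1]scale1r -[m1]scale1r; apply: relD.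
rewrite -[X in rel X]addr0 -[X in rel _ X]addr0; apply: relD => //.
by rewrite /m; case: cid.
Qed.

End Projectives.

(** This produces inverses of bijective linear maps and projections of direct
sums from the element-wise statement of their existence and uniqueness. *)
Lemma linear_choice (R : pzRingType) (V W : lmodType R) (rel : V -> W -> Prop) :
  (forall x, exists y, rel x y) -> (forall x y y', rel x y -> rel x y' -> y = y') ->
  (forall a x x' y y', rel x y -> rel x' y' -> rel (a *: x + x') (a *: y + y')) ->
  exists f : {linear V -> W}, forall x, rel x (f x).
Proof.
move=> relT relU relD; pose f x := sval (cid (relT x)).
have fP x : rel x (f x) by rewrite /f; case: cid.
have lin_f : linear f.
  by move=> a x y; apply: relU (fP _) _; apply: relD.
by exists (lin_of lin_f).
Qed.

(** * Functors on the derived category *)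

Section LocalFunctor.
Variables (R : pzRingType) (F : cplx R -> Type).
Variables (eqF : forall A, F A -> F A -> Prop).
Variable act : forall A B, chain_map A B -> F A -> F B.
Hypothesis eqF_refl : forall A (x : F A), eqF x x.
Hypothesis eqF_sym : forall A (x y : F A), eqF x y -> eqF y x.
Hypothesis eqF_trans : forall A (x y z : F A), eqF x y -> eqF y z -> eqF x z.
Hypothesis act_eq : forall A B (f : chain_map A B) x y,
  eqF x y -> eqF (act f x) (act f y).
Hypothesis act_id : forall A (x : F A), eqF (act (chain_id A) x) x.
Hypothesis act_comp : forall A B C (g : chain_map B C) (f : chain_map A B) x,
  eqF (act (chain_comp g f) x) (act g (act f x)).
Hypothesis act_homotopic : forall A B (f g : chain_map A B) x,
  homotopic f g -> eqF (act f x) (act g x).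
Hypothesis act_inj : forall A B (s : chain_map A B) x y,
  quasi_iso s -> eqF (act s x) (act s y) -> eqF x y.
Hypothesis act_surj : forall A B (s : chain_map A B) y,
  quasi_iso s -> exists x, eqF (act s x) y.

(** A functor that inverts quasi-isomorphisms extends to the derived category;
formal inverses act by converse relations, so that no inverse has to be
chosen. *)
Fixpoint drel A B (u : dmor A B) : F A -> F B -> Prop :=
  match u in dmor A B return F A -> F B -> Prop with
  | dmap _ _ f => fun x y => eqF (act f x) y
  | dinv _ _ s _ => fun x y => eqF (act s y) x
  | dcomp _ _ _ v u => fun x z => exists2 y, drel u x y & drel v y z
  end.

Lemma drel_eqr A B (u : dmor A B) x y y' :
  eqF y y' -> drel u x y -> drel u x y'.
Proof.
elim: u x y y' => {A B} [A B f|A B s qs|A B C v IHv u IHu] x y y' /= eqy.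
- by move=> /eqF_trans; apply.
- by apply: eqF_trans; apply: act_eq; apply: eqF_sym.
- by case=> z xz zy; exists z => //; apply: IHv zy.
Qed.

Lemma drel_eql A B (u : dmor A B) x x' y :
  eqF x x' -> drel u x y -> drel u x' y.
Proof.
elim: u x x' y => {A B} [A B f|A B s qs|A B C v IHv u IHu] x x' y /= eqx.
- by apply: eqF_trans; apply: act_eq; apply: eqF_sym.
- by move=> /eqF_trans; apply.
- by case=> z xz zy; exists z => //; apply: IHu xz.
Qed.

Lemma drel_deq A B (u v : dmor A B) :
  deq u v -> forall x y, drel u x y <-> drel v x y.
Proof.
elim=> {A B u v}.
- by [].
- by move=> A B u v _ IH x y; rewrite IH.
- by move=> A B u v w _ IH1 _ IH2 x y; rewrite IH1.
- move=> A B C v v' u u' _ IHv _ IHu x y /=.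
  by split=> -[z /IHu xz /IHv zy]; exists z.
- move=> A B C D w v u x y /=; split=> [[z [t xt tz] zy]|[t xt [z tz zy]]].
    by exists t => //; exists z.
  by exists z => //; exists t.
- move=> A B u x y /=; split=> [[z xz /(eqF_trans (eqF_sym (act_id z))) zy]|xy].
    exact: drel_eqr xz.
  by exists y => //; apply: act_id.
- move=> A B u x y /=; split=> [[z xz zy]|xy].
    by apply: drel_eql zy; apply: eqF_trans (eqF_sym xz) _; apply: act_id.
  by exists x => //; apply: act_id.
- move=> A B C g f x y /=; split=> [[z fz gz]|gfy].
    apply: eqF_trans (act_comp _ _ _) _; apply: eqF_trans gz.
    exact: act_eq.
  exists (act f x) => //; apply: eqF_trans gfy.
  by apply: eqF_sym; apply: act_comp.
- move=> A B f g fg x y /=; have fgx := act_homotopic x fg.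
  by split; apply: eqF_trans => //; apply: eqF_sym.
- move=> A B s qs x y /=; split=> [[z sx sy]|idx].
    apply: eqF_trans (act_id _) _; apply: (act_inj qs).
    by apply: eqF_trans sx _; apply: eqF_sym.
  exists (act s x) => //; apply: act_eq; apply: eqF_sym.
  by apply: eqF_trans idx; apply: eqF_sym; apply: act_id.
- move=> A B s qs x y /=; split=> [[z sz sy]|idx].
    apply: eqF_trans (act_id _) _; apply: eqF_trans sy; exact: eqF_sym.
  have [z sz] := act_surj x qs; exists z => //; apply: eqF_trans sz _.
  by apply: eqF_trans idx; apply: eqF_sym; apply: act_id.
Qed.

Lemma act_deq A B (f g : chain_map A B) :
  deq (dmap f) (dmap g) -> forall x, eqF (act f x) (act g x).
Proof. by move=> /drel_deq fg x; apply/fg => /=. Qed.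

Lemma act_diso A B (f : chain_map A B) : diso (dmap f) ->
  (forall x y, eqF (act f x) (act f y) -> eqF x y) /\
  (forall y, exists x, eqF (act f x) y).
Proof.
case=> v [/drel_deq vf /drel_deq fv]; split=> [x y fxy|y].
  have /vf[z /= fxz zx] : drel (did A) x x by apply: act_id.
  have /vf : drel (dcomp v (dmap f)) y x.
    by exists z => //=; apply: eqF_trans fxz; apply: eqF_sym.
  move=> /= yx; apply: eqF_trans (eqF_sym yx) _; exact: act_id.
have /fv[z /= _ fz] : drel (did B) y y by apply: act_id.
by exists z.
Qed.

End LocalFunctor.

(** * Morphisms out of two-term complexes *)

Section Homotopy.
Variable R : pzRingType.

Lemma homotopic_refl (A B : cplx R) (f : chain_map A B) : homotopic f f.
Proof. by exists (fun=> \0) => i x /=; rewrite subrr linear0 addr0. Qed.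

Lemma homotopic_sym (A B : cplx R) (f g : chain_map A B) :
  homotopic f g -> homotopic g f.
Proof.
case=> s sE; exists (fun i => \- (s i)) => i x /=.
apply: (eq_of_eq (esym (sE i x))). label.
Qed.

Lemma homotopic_trans (A B : cplx R) (f g h : chain_map A B) :
  homotopic f g -> homotopic g h -> homotopic f h.
Proof.
case=> s sE [t tE]; exists (fun i => s i \+ t i) => i x /=.
by apply: (eq_of_eq (sE i x)); apply: (eq_of_eq (tE i x)); label.
Qed.

Lemma homotopic_eq (A B : cplx R) (f g : chain_map A B) :
  (forall i x, f i x = g i x) -> homotopic f g.
Proof.
by move=> fg; exists (fun=> \0) => i x /=; rewrite fg subrr linear0 addr0.
Qed.

Lemma homotopic_comp (A B C : cplx R) (g g' : chain_map B C)
    (f f' : chain_map A B) :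
  homotopic g g' -> homotopic f f' ->
  homotopic (chain_comp g f) (chain_comp g' f').
Proof.
case=> t tE [s sE]; exists (fun i => (g i \o s i) \+ (t i \o f' (i + 1))) => i x /=.
have := congr1 (g (i + 1)) (sE i x); rewrite linD linD cmapC linN => gs.
apply: (eq_of_eq gs); rewrite cmapC; apply: (eq_of_eq (tE i (f' _ x))).
by label.
Qed.

End Homotopy.

Section Cohomology.
Variables (R : pzRingType) (i : int).

Definition cocycle (A : cplx R) := {x : A (i + 1) | diff A (i + 1) x = 0}.

Definition cohomologous (A : cplx R) (x y : cocycle A) : Prop :=
  exists w, sval x - sval y = diff A i w.

Lemma cocycle_mapP (A B : cplx R) (f : chain_map A B) (x : cocycle A) :
  diff B (i + 1) (f (i + 1) (sval x)) = 0.
Proof. by rewrite -cmapC (svalP x) linear0. Qed.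

Definition cocycle_map (A B : cplx R) (f : chain_map A B) (x : cocycle A) :
  cocycle B := exist _ _ (cocycle_mapP f x).

End Cohomology.

(** Cohomology is a functor on the derived category, so a chain map that becomes
invertible there induces isomorphisms on cohomology. *)
Lemma diso_quasi_iso (R : pzRingType) (A B : cplx R) (f : chain_map A B) :
  diso (dmap f) -> quasi_iso f.
Proof.
move=> isof i.
have [] := @act_diso R (@cocycle R i) (@cohomologous R i) (@cocycle_map R i)
  _ _ _ _ _ _ _ _ _ _ _ f isof.
- by move=> C x; exists 0; rewrite subrr linear0.
- by move=> C x y [w xy]; exists (- w); rewrite linearN -xy opprB.
- move=> C x y z [w xy] [v yz]; exists (w + v).
  by rewrite linearD -xy -yz addrA subrK.
- move=> C D g x y [w xy]; exists (g i w).
  by rewrite /= -cmapC -xy linearB.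
- by move=> C x; exists 0; rewrite subrr linear0.
- by move=> C D E g h x; exists 0; rewrite subrr linear0.
- move=> C D g h [x dx] [s sE]; exists (s i x) => /=.
  by rewrite sE dx linear0 addr0.
- move=> C D s [x dx] [y dy] qs [w /= sxy].
  have [||v xyE] := (qs i).1 (x - y); last by exists v.
    by rewrite linearB dx dy subrr.
  by exists w; rewrite linearB.
- move=> C D s [y dy] qs; have [x [w [dx yE]]] := (qs i).2 y dy.
  exists (exist _ x dx); exists (- w) => /=.
  by rewrite yE; label.
move=> inj sur; split=> [x dx [y fx]|y dy].
  have z0 : diff A (i + 1) 0 = 0 by rewrite linear0.
  have [|w] := inj (exist _ x dx) (exist _ 0 z0); last first.
    by rewrite /= subr0 => ->; exists w.
  by exists y; rewrite /= linear0 subr0.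
have [[x dx] [w /= fxy]] := sur (exist _ y dy).
exists x, (- w); split=> //.
by apply: (eq_of_eq (esym fxy)); label.
Qed.

Section TwoTerm.
Variable R : pzRingType.
Implicit Types (A B : cplx R) (P Q : K2 R).

(** The differentials around degrees -1 and 0, typed so that the indices are
   the constructors of the integers rather than sums. *)
Definition d2 A : {linear A (Negz 1) -> A (Negz 0)} := diff A (Negz 1).
Definition d1 A : {linear A (Negz 0) -> A (Posz 0)} := diff A (Negz 0).
Definition d0 A : {linear A (Posz 0) -> A (Posz 1)} := diff A (Posz 0).

Lemma K2_pos P n (x : P (Posz n.+1)) : x = 0.
Proof. exact: K2_conc. Qed.

Lemma K2_neg P n (x : P (Negz n.+1)) : x = 0.
Proof. exact: K2_conc. Qed.

Definition cmap1 A B (f : chain_map A B) : {linear A (Negz 0) -> B (Negz 0)} :=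
  f (Negz 0).
Definition cmap0 A B (f : chain_map A B) : {linear A (Posz 0) -> B (Posz 0)} :=
  f (Posz 0).

Lemma cmapC1 A B (f : chain_map A B) x :
  cmap0 f (d1 A x) = d1 B (cmap1 f x).
Proof. exact (@cmapC R A B f (Negz 0) x). Qed.

Lemma cmapC0 P B (f : chain_map P B) x : d0 B (cmap0 f x) = 0.
Proof.
have e : d0 P x = 0 := K2_pos (d0 P x).
exact: etrans (esym (@cmapC R P B f (Posz 0) x)) (etrans (congr1 _ e) (lin0 _)).
Qed.

Definition chain_terms P A (a1 : {linear P (Negz 0) -> A (Negz 0)})
    (a0 : {linear P (Posz 0) -> A (Posz 0)}) i : {linear P i -> A i} :=
  match i with Posz 0 => a0 | Negz 0 => a1 | _ => \0 end.

Lemma chain_termsC P A (a1 : {linear P (Negz 0) -> A (Negz 0)})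
    (a0 : {linear P (Posz 0) -> A (Posz 0)}) :
  (forall x, a0 (d1 P x) = d1 A (a1 x)) -> (forall x, d0 A (a0 x) = 0) ->
  forall i x,
  chain_terms a1 a0 (i + 1) (diff P i x) = diff A i (chain_terms a1 a0 i x).
Proof.
move=> a1C a0C [[|n]|[|n]] x; rewrite /=.
- by rewrite (a0C x).
- by rewrite linear0.
- exact: a1C.
- have -> : x = 0 by exact: K2_neg.
  by rewrite !linear0.
Qed.

Definition chain2 P A a1 a0 c1 c0 : chain_map P A :=
  ChainMap (@chain_termsC P A a1 a0 c1 c0).

Lemma homotopic2 P A (f g : chain_map P A)
    (s1 : {linear P (Negz 0) -> A (Negz 1)})
    (s0 : {linear P (Posz 0) -> A (Negz 0)}) :
  (forall x, cmap1 f x - cmap1 g x = d2 A (s1 x) + s0 (d1 P x)) ->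
  (forall x, cmap0 f x - cmap0 g x = d1 A (s0 x)) ->
  homotopic f g.
Proof.
move=> s1E s0E.
exists (fun i => match i return {linear P (i + 1) -> A i} with
  | Negz 0 => s0 | Negz 1 => s1 | _ => \0 end) => -[n|[|[|n]]] x.
- have -> : x = 0 by case: n x => [|n] x; apply: (K2_conc (k:=P)).
  by label.
- by apply: etrans (s0E x) _; rewrite /= addr0.
- exact: s1E.
- have -> : x = 0 by exact: K2_neg.
  by label.
Qed.

Lemma homotopic2P P A (f g : chain_map P A) : homotopic f g ->
  exists (s1 : {linear P (Negz 0) -> A (Negz 1)})
         (s0 : {linear P (Posz 0) -> A (Negz 0)}),
  (forall x, cmap1 f x - cmap1 g x = d2 A (s1 x) + s0 (d1 P x)) /\
  (forall x, cmap0 f x - cmap0 g x = d1 A (s0 x)).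
Proof.
case=> s sE; exists (s (Negz 1)), (s (Negz 0)); split=> x.
  exact (sE (Negz 1) x).
have e : d0 P x = 0 := K2_pos (d0 P x).
by apply: etrans (sE (Negz 0) x) _; rewrite -[diff P _ x]/(d0 P x) e; label.
Qed.

(** The mapping cone of a quasi-isomorphism is acyclic. *)
Lemma quasi_iso_acyclic A B (s : chain_map A B) i
    (x : A (i + 1 + 1)) (y : B (i + 1)) :
  quasi_iso s -> diff A (i + 1 + 1) x = 0 ->
  s (i + 1 + 1) x = diff B (i + 1) y ->
  exists w v, x = diff A (i + 1) w /\ y = s (i + 1) w + diff B i v.
Proof.
move=> qs dx sx; have [|w0 xE] := (qs (i + 1)).1 x dx; first by exists y.
have [|w1 [v [dw1 yE]]] := (qs i).2 (y - s (i + 1) w0).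
  by rewrite linearB -sx xE cmapC subrr.
exists (w0 + w1), v; split; first by rewrite linearD dw1 addr0.
by apply: (eq_of_eq yE); label.
Qed.

Lemma K2_fg P i : finitely_generated (P i). Proof. exact: term_fg. Qed.

(** Quasi-isomorphisms become bijective under homotopy classes of maps from a
two-term complex of projectives: the lift is built in degree 0, and then in
degree -1 against the lift already chosen. *)
Lemma K2_lift P A B (s : chain_map A B) (b : chain_map P B) :
  quasi_iso s -> exists a : chain_map P A, homotopic (chain_comp s a) b.
Proof.
move=> qs.
have [|a x y [m1 m2] [n1 n2] /= [dm bm] [dn bn]|x|g gE] :=
  @projective_select R _ _ (fun x (m : A (Posz 0) * B (Negz 0)) =>
     d0 A m.1 = 0 /\ cmap0 b x = cmap0 s m.1 + d1 B m.2)
   (K2_fg P (Posz 0)) (@K2_proj R P (Posz 0)).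
- by split=> /=; rewrite ?linear0 ?addr0.
- split; first by rewrite linD linZ dm dn scaler0 addr0.
  apply: (eq_of_eq bn); apply: (eq_of_eq (congr1 (fun z => a *: z) bm)).
  by label.
- have [a [w [da bE]]] := (qs (Negz 0)).2 (cmap0 b x) (cmapC0 b x).
  by exists (a, w).
have {}gE x : d0 A (g x).1 = 0 /\ cmap0 b x = cmap0 s (g x).1 + d1 B (g x).2.
  exact: gE.
have [|a x y [m1 m2] [n1 n2] /= [dm bm] [dn bn]|x|h hE] :=
  @projective_select R _ _ (fun x (m : A (Negz 0) * B (Negz 1)) =>
     d1 A m.1 = (g (d1 P x)).1 /\
     cmap1 b x - (g (d1 P x)).2 = cmap1 s m.1 + d2 B m.2)
   (K2_fg P (Negz 0)) (@K2_proj R P (Negz 0)).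
- by split=> /=; rewrite ?linear0 /= ?subr0 ?addr0.
- rewrite !linearP /= dm dn; split=> //.
  apply: (eq_of_eq bn); apply: (eq_of_eq (congr1 (fun z => a *: z) bm)).
  by label.
- have [] := gE (d1 P x); rewrite cmapC1 => dg bg.
  have [|w [v [wE vE]]] := @quasi_iso_acyclic _ _ s (Negz 1) (g (d1 P x)).1
    (cmap1 b x - (g (d1 P x)).2) qs dg; last by exists (w, v).
  by apply: (eq_of_eq (esym bg)); rewrite -/(d1 B); label.
pose a1 : {linear P (Negz 0) -> A (Negz 0)} := fst \o h.
pose a0 : {linear P (Posz 0) -> A (Posz 0)} := fst \o g.
have c1 x : a0 (d1 P x) = d1 A (a1 x) by case: (hE x).
have c0 x : d0 A (a0 x) = 0 by case: (gE x).
exists (chain2 c1 c0).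
pose s1 : {linear P (Negz 0) -> B (Negz 1)} := \- (snd \o h).
pose s0 : {linear P (Posz 0) -> B (Negz 0)} := \- (snd \o g).
apply: (homotopic2 (s1 := s1) (s0 := s0)).
  move=> x /=; have [_ e] := hE x.
  by apply: (eq_of_eq (esym e)); rewrite /cmap1 /=; label.
move=> x /=; have [_ e] := gE x.
by apply: (eq_of_eq (esym e)); rewrite /cmap0 /=; label.
Qed.

Lemma K2_lift_inj P A B (s : chain_map A B) (a a' : chain_map P A) :
  quasi_iso s -> homotopic (chain_comp s a) (chain_comp s a') -> homotopic a a'.
Proof.
move=> qs /homotopic2P[h1 [h0 [h1E h0E]]].
have {}h1E x : cmap1 s (cmap1 a x) - cmap1 s (cmap1 a' x)
    = d2 B (h1 x) + h0 (d1 P x) by exact: h1E.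
have {}h0E x : cmap0 s (cmap0 a x) - cmap0 s (cmap0 a' x) = d1 B (h0 x).
  exact: h0E.
have [|c x y [m1 m2] [n1 n2] /= [em1 em2] [en1 en2]|x|t tE] :=
  @projective_select R _ _ (fun x (m : A (Negz 0) * B (Negz 1)) =>
     cmap0 a x - cmap0 a' x = d1 A m.1 /\ h0 x = cmap1 s m.1 + d2 B m.2)
   (K2_fg P (Posz 0)) (@K2_proj R P (Posz 0)).
- by split=> /=; label.
- split.
    apply: (eq_of_eq en1); apply: (eq_of_eq (congr1 (fun z => c *: z) em1)).
    by label.
  apply: (eq_of_eq en2); apply: (eq_of_eq (congr1 (fun z => c *: z) em2)).
  by label.
- have [||w [v [wE vE]]] := @quasi_iso_acyclic _ _ s (Negz 1)
    (cmap0 a x - cmap0 a' x) (h0 x) qs; last by exists (w, v).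
    by apply: etrans (linB (d0 A) _ _) _; rewrite !cmapC0 subrr.
  by apply: etrans (linB (cmap0 s) _ _) _; apply: h0E.
have [|c x y m n em en|x|r rE] :=
  @projective_select R _ _ (fun x (m : A (Negz 1)) =>
     cmap1 a x - cmap1 a' x - (t (d1 P x)).1 = d2 A m)
   (K2_fg P (Negz 0)) (@K2_proj R P (Negz 0)).
- by rewrite !lin0 /=; label.
- apply: (eq_of_eq en); apply: (eq_of_eq (congr1 (fun z => c *: z) em)).
  by rewrite !linD !linZ /=; label.
- have [e1 e2] := tE (d1 P x).
  have [||w [v [wE vE]]] := @quasi_iso_acyclic _ _ s (Negz 2)
    (cmap1 a x - cmap1 a' x - (t (d1 P x)).1)
    (h1 x + (t (d1 P x)).2) qs; last by exists w.
    apply: etrans (linB (d1 A) _ _) _; rewrite linB -!cmapC1.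
    by apply: (eq_of_eq e1); label.
  apply: etrans (linB (cmap1 s) _ _) _; rewrite linB h1E e2.
  by rewrite -[diff B _ _]/(d2 B _); label.
pose r0 : {linear P (Posz 0) -> A (Negz 0)} := fst \o t.
apply: (homotopic2 (s1 := r) (s0 := r0)) => x /=.
  by apply: (eq_of_eq (rE x)); label.
by case: (tE x).
Qed.

End TwoTerm.

(** * Presentations *)

Section Presentations.
Variable R : pzRingType.

(** A two-term complex stripped of its zero terms. *)
Record pres := Pres {
  deg1 : lmodType R;
  deg0 : lmodType R;
  pd : {linear deg1 -> deg0};
  deg1_fg : finitely_generated deg1;
  deg0_fg : finitely_generated deg0;
  deg1_proj : projective deg1;
  deg0_proj : projective deg0
}.
Implicit Types X Y Z : pres.

(** Isomorphism on both cohomology modules; between projectives it amounts to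
homotopy equivalence, and it is checked by element chases. *)
Definition qis X Y : Prop :=
  exists (f1 : {linear deg1 X -> deg1 Y}) (f0 : {linear deg0 X -> deg0 Y}),
  [/\ forall x, f0 (pd X x) = pd Y (f1 x),
      forall x, pd X x = 0 -> f1 x = 0 -> x = 0,
      forall x y, f0 x = pd Y y -> exists2 w, x = pd X w & y = f1 w
    & forall y, exists x w, y = f0 x + pd Y w].

Definition heq X Y : Prop :=
  exists (f1 : {linear deg1 X -> deg1 Y}) (f0 : {linear deg0 X -> deg0 Y})
         (g1 : {linear deg1 Y -> deg1 X}) (g0 : {linear deg0 Y -> deg0 X})
         (h : {linear deg0 X -> deg1 X}) (k : {linear deg0 Y -> deg1 Y}),
  [/\ forall x, f0 (pd X x) = pd Y (f1 x),
      forall y, g0 (pd Y y) = pd X (g1 y),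
      (forall x, x - g1 (f1 x) = h (pd X x)) /\
      (forall x, x - g0 (f0 x) = pd X (h x))
    & (forall y, y - f1 (g1 y) = k (pd Y y)) /\
      (forall y, y - f0 (g0 y) = pd Y (k y))].

Lemma heq_sym X Y : heq X Y -> heq Y X.
Proof.
case=> f1 [f0 [g1 [g0 [h [k [fC gC gf fg]]]]]].
by exists g1, g0, f1, f0, k, h; split.
Qed.

Lemma heq_qis X Y : heq X Y -> qis X Y.
Proof.
case=> f1 [f0 [g1 [g0 [h [k [fC gC [gf1 gf0] [fg1 fg0]]]]]]].
exists f1, f0; split=> //.
- by move=> x dx fx; apply: (eq_of_eq (gf1 x)); rewrite dx fx; label.
- move=> x y fx; pose w := g1 y + h x.
  have dw : x = pd X w.
    by apply: (eq_of_eq (gf0 x)); rewrite /w fx gC; label.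
  have dr : pd Y (y - f1 w) = 0 by rewrite linB -fC -dw fx subrr.
  exists (w + g1 (y - f1 w)); first by rewrite (linD (pd X)) -gC dr lin0 addr0.
  by apply: (eq_of_eq (fg1 (y - f1 w))); rewrite dr; label.
- by move=> y; exists (g0 y), (k y); apply: (eq_of_eq (fg0 y)); label.
Qed.

(** The inverse is selected in degree 0; in degree 1 it is then unique, and
uniqueness makes it linear. *)
Lemma qis_heq X Y : qis X Y -> heq X Y.
Proof.
case=> f1 [f0 [fC inj mid sur]].
have [|a x y [m1 m2] [n1 n2] /= em en|y|g gE] := @projective_select R _ _
  (fun y (m : deg0 X * deg1 Y) => y = f0 m.1 + pd Y m.2)
  (@deg0_fg Y) (@deg0_proj Y).
- by rewrite /=; label.
- apply: (eq_of_eq en); apply: (eq_of_eq (congr1 (fun z => a *: z) em)).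
  by label.
- by have [x [w e]] := sur y; exists (x, w).
pose g0 : {linear deg0 Y -> deg0 X} := fst \o g.
pose k : {linear deg0 Y -> deg1 Y} := snd \o g.
have {}gE y : y = f0 (g0 y) + pd Y (k y) by exact: gE.
clearbody g0 k.
have [|a x y m n [em1 em2] [en1 en2]|y|g1 g1E] := @projective_select R _ _
  (fun y m => pd X m = g0 (pd Y y) /\ f1 m = y - k (pd Y y))
  (@deg1_fg Y) (@deg1_proj Y).
- by split; label.
- by split; push_linear; rewrite ?em1 ?em2 ?en1 ?en2; label.
- have [|w -> ->] := mid (g0 (pd Y y)) (y - k (pd Y y)); last by exists w.
  by apply: (eq_of_eq (esym (gE (pd Y y)))); label.
have [|a x y m n [em1 em2] [en1 en2]|x|h hE] := @projective_select R _ _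
  (fun x m => pd X m = x - g0 (f0 x) /\ f1 m = k (f0 x))
  (@deg0_fg X) (@deg0_proj X).
- by split; label.
- by split; push_linear; rewrite ?em1 ?em2 ?en1 ?en2; label.
- have [|w -> ->] := mid (x - g0 (f0 x)) (k (f0 x)); last by exists w.
  by apply: (eq_of_eq (gE (f0 x))); label.
exists f1, f0, g1, g0, h, k; split=> //.
- by move=> y; case: (g1E y).
- split=> x; last by case: (hE x).
  have [h1 h2] := hE (pd X x); have [i1 i2] := g1E (f1 x).
  apply/eqP; rewrite -subr_eq0; apply/eqP; apply: inj.
    by rewrite !linB h1 i1 fC; label.
  by rewrite !linB h2 i2 fC; label.
- split=> y; last by apply: (eq_of_eq (gE y)); label.
  by have [_ ->] := g1E y; label.
Qed.

Lemma qis_sym X Y : qis X Y -> qis Y X.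
Proof. by move/qis_heq/heq_sym/heq_qis. Qed.

Lemma qis_refl X : qis X X.
Proof.
exists idfun, idfun; split=> //= [x y e|y]; first by exists y.
by exists y, 0; label.
Qed.

Lemma qis_trans X Y Z : qis X Y -> qis Y Z -> qis X Z.
Proof.
case=> f1 [f0 [fC finj fmid fsur]] [g1 [g0 [gC ginj gmid gsur]]].
exists (g1 \o f1), (g0 \o f0); split=> /=.
- by move=> x; rewrite fC gC.
- by move=> x dx gfx; apply: finj => //; apply: ginj => //; rewrite -fC dx lin0.
- move=> x z gfx; have [y fx ->] := gmid _ _ gfx.
  by have [w -> ->] := fmid _ _ fx; exists w.
- move=> z; have [y [w ->]] := gsur z; have [x [v ->]] := fsur y.
  by exists x, (g1 v + w); rewrite !linD gC addrA.
Qed.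

Lemma qis_strict X Y (f1 : {linear deg1 X -> deg1 Y})
    (f0 : {linear deg0 X -> deg0 Y}) g1 g0 :
  (forall x, f0 (pd X x) = pd Y (f1 x)) ->
  cancel f1 g1 -> cancel g1 f1 -> cancel f0 g0 -> cancel g0 f0 -> qis X Y.
Proof.
move=> fC fg1 gf1 fg0 gf0; exists f1, f0; split=> //.
- by move=> x _ fx; rewrite -(fg1 x) fx -(lin0 f1) fg1.
- move=> x y fx; exists (g1 y); last by rewrite gf1.
  by apply: (can_inj fg0); rewrite fx fC gf1.
- by move=> y; exists (g0 y), 0; rewrite gf0 lin0 addr0.
Qed.

Definition pzero : pres :=
  Pres (\0 : {linear 'rV[R]_0 -> 'rV[R]_0})
    (zero_module_fg (@zero_module_rV0 R)) (zero_module_fg (@zero_module_rV0 R))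
    (zero_module_proj (@zero_module_rV0 R)) (zero_module_proj (@zero_module_rV0 R)).

Definition ext_diff X Z (u : {linear deg1 Z -> deg0 X}) :
    {linear (deg1 X * deg1 Z)%type -> (deg0 X * deg0 Z)%type} :=
  [lin fun x => (pd X x.1 + u x.2, pd Z x.2)].

(** The extension of [Z] by [X] classified by the map [u] from degree -1 of [Z]
to degree 0 of [X]: every conflation is isomorphic to one of these. *)
Definition ext X Z (u : {linear deg1 Z -> deg0 X}) : pres :=
  Pres (ext_diff u)
    (fg_pair (@deg1_fg X) (@deg1_fg Z)) (fg_pair (@deg0_fg X) (@deg0_fg Z))
    (proj_pair (@deg1_proj X) (@deg1_proj Z))
    (proj_pair (@deg0_proj X) (@deg0_proj Z)).

Definition psum X Z : pres := @ext X Z \0.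

Definition conf X Y Z : Prop :=
  exists u : {linear deg1 Z -> deg0 X}, qis (ext u) Y.

Definition null X Z (u : deg1 Z -> deg0 X) : Prop :=
  exists (s : {linear deg1 Z -> deg1 X}) (t : {linear deg0 Z -> deg0 X}),
  forall z, u z = pd X (s z) + t (pd Z z).

Definition ext_zero Z X : Prop :=
  forall u : {linear deg1 Z -> deg0 X}, null u.

End Presentations.

(** * Presentations and two-term complexes *)

Section Translation.
Variable R : pzRingType.
Implicit Types (P X Y Z : K2 R) (A B C : cplx R).

Definition ofK X : pres R :=
  Pres (d1 X) (K2_fg X (Negz 0)) (K2_fg X (Posz 0))
    (@K2_proj R X (Negz 0)) (@K2_proj R X (Posz 0)).

Section ToK.
Variable X : pres R.

Definition toK_term (i : int) : lmodType R :=
  match i with Posz 0 => deg0 X | Negz 0 => deg1 X | _ => 'rV[R]_0 end.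

Definition toK_diff (i : int) : {linear toK_term i -> toK_term (i + 1)} :=
  match i return {linear toK_term i -> toK_term (i + 1)} with
  | Negz 0 => pd X | _ => \0
  end.

Program Definition toK : K2 R :=
  {| K2_cplx := {| term := toK_term; diff := toK_diff |} |}.
Next Obligation. by case=> [n|[|n]] x; [exact: lin0|exact: erefl|exact: lin0]. Qed.
Next Obligation.
case=> [[|n]|[|n]]; [exact: deg0_fg| |exact: deg1_fg|];
  exact: (zero_module_fg (@zero_module_rV0 R)).
Qed.
Next Obligation.
by exists 1%N => -[[|[|n]]|[|n]] // _; apply: zero_module_rV0.
Qed.
Next Obligation.
case=> [[|n]|[|n]]; [exact: deg0_proj| |exact: deg1_proj|];
  exact: (zero_module_proj (@zero_module_rV0 R)).
Qed.
Next Obligation. by move=> [[|n]|[|n]] //= _ _; apply: zero_module_rV0. Qed.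

End ToK.

Lemma ofK_toK (X : pres R) : qis (ofK (toK X)) X.
Proof.
exists (idfun : {linear deg1 X -> deg1 X}), (idfun : {linear deg0 X -> deg0 X}).
by split=> //= [x y e|y]; [exists y|exists y, 0; label].
Qed.

Lemma K2_isoP X Y : K2_iso X Y <-> qis (ofK X) (ofK Y).
Proof.
split=> [[f [g [gf fg]]]|/qis_heq].
  have [s1 [s0 [gf1 gf0]]] := homotopic2P gf.
  have [t1 [t0 [fg1 fg0]]] := homotopic2P fg.
  apply: heq_qis; exists (cmap1 f), (cmap0 f), (cmap1 g), (cmap0 g).
  exists [lin fun x => - s0 x], [lin fun x => - t0 x].
  split; [exact: cmapC1|exact: cmapC1|split=> x /=|split=> x /=].
  - by apply: (eq_of_eq (esym (gf1 x))); rewrite (K2_neg (s1 x)) /cmap1 /=; label.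
  - by apply: (eq_of_eq (esym (gf0 x))); rewrite /cmap0 /=; label.
  - by apply: (eq_of_eq (esym (fg1 x))); rewrite (K2_neg (t1 x)) /cmap1 /=; label.
  - by apply: (eq_of_eq (esym (fg0 x))); rewrite /cmap0 /=; label.
case=> f1 [f0 [g1 [g0 [h [k [fC gC [gf1 gf0] [fg1 fg0]]]]]]].
have f0C x : d0 Y (f0 x) = 0 by exact: K2_pos.
have g0C x : d0 X (g0 x) = 0 by exact: K2_pos.
exists (@chain2 R X Y f1 f0 fC f0C), (@chain2 R Y X g1 g0 gC g0C); split.
- pose s0 : {linear X (Posz 0) -> X (Negz 0)} := \- h.
  apply: (homotopic2 (s1 := \0) (s0 := s0)) => x.
    by apply: (eq_of_eq (esym (gf1 x))); rewrite /cmap1 /=; label.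
  by apply: (eq_of_eq (esym (gf0 x))); rewrite /cmap0 /=; label.
- pose s0 : {linear Y (Posz 0) -> Y (Negz 0)} := \- k.
  apply: (homotopic2 (s1 := \0) (s0 := s0)) => x.
    by apply: (eq_of_eq (esym (fg1 x))); rewrite /cmap1 /=; label.
  by apply: (eq_of_eq (esym (fg0 x))); rewrite /cmap0 /=; label.
Qed.

Lemma ofK_sum X Y : qis (ofK (K2_sum X Y)) (psum (ofK X) (ofK Y)).
Proof.
exists (idfun : {linear (X (Negz 0) * Y (Negz 0))%type -> _}),
  (idfun : {linear (X (Posz 0) * Y (Posz 0))%type -> _}).
split=> [x|x dx|x y e|y] //=; first by rewrite addr0.
  by exists y => //; apply: etrans e _; congr pair; apply: addr0.
exists y, 0; rewrite -[LHS]addr0; congr (_ + _); apply: esym.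
exact: (lin0 (pd (psum (ofK X) (ofK Y)))).
Qed.

Lemma ofK_zero : qis (ofK (K2_zero R)) (pzero R).
Proof.
exists (idfun : {linear 'rV[R]_0 -> 'rV[R]_0}), (idfun : {linear 'rV[R]_0 -> 'rV[R]_0}).
by split=> //= [x y e|y]; [exists y|exists y, 0; rewrite addr0].
Qed.

(** * Morphisms and vanishing in the derived category *)

(** Homotopy classes of chain maps out of a two-term complex of projectives form
a functor that inverts quasi-isomorphisms; apply it to the identity. *)
Lemma deq_K2 P B (f g : chain_map P B) :
  deq (dmap f) (dmap g) -> homotopic f g.
Proof.
move=> fg; have /= := @act_deq R (chain_map P) (@homotopic R P)
  (fun A B s a => chain_comp s a) _ _ _ _ _ _ _ _ _ _ _ f g fg (chain_id P).
move=> /(_ (@homotopic_refl R P) (@homotopic_sym R P) (@homotopic_trans R P)).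
have idr A (h : chain_map P A) : homotopic (chain_comp h (chain_id P)) h.
  exact: homotopic_eq.
move=> H; apply: homotopic_trans (homotopic_sym (idr _ f)) _.
apply: homotopic_trans _ (idr _ g); apply: H.
- by move=> A C s a b ab; apply: homotopic_comp (homotopic_refl _) ab.
- by move=> A a; apply: homotopic_eq.
- by move=> A C D s t a; apply: homotopic_eq.
- by move=> A C s t a st; apply: homotopic_comp st (homotopic_refl _).
- by move=> A C s a b qs; apply: K2_lift_inj.
- by move=> A C s b qs; apply: K2_lift.
Qed.

(** Every morphism of the derived category out of a two-term complex of
projectives is represented by a chain map: formal inverses are lifted along. *)
Lemma dmor_comp_K2 A B (u : dmor A B) P (a : chain_map P A) :
  exists b : chain_map P B, deq (dcomp u (dmap a)) (dmap b).
Proof.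
elim: u a => {A B} [A B f|A B s qs|A B C v IHv u IHu] a.
- by exists (chain_comp f a); apply: deq_comp.
- have [b sb] := K2_lift a qs; exists b.
  apply: deq_trans (deq_congr (deq_refl _) (deq_homotopic (homotopic_sym sb))) _.
  apply: deq_trans (deq_congr (deq_refl _) (deq_sym (deq_comp s b))) _.
  apply: deq_trans (deq_assoc _ _ _) _.
  by apply: deq_trans (deq_congr (deq_invl qs) (deq_refl _)) (deq_idl _).
- have [b ub] := IHu a; have [c vc] := IHv b; exists c.
  apply: deq_trans (deq_sym (deq_assoc _ _ _)) _.
  by apply: deq_trans (deq_congr (deq_refl _) ub) vc.
Qed.

Lemma dmor_K2 P B (u : dmor P B) : exists b : chain_map P B, deq u (dmap b).
Proof.
have [b ub] := dmor_comp_K2 u (chain_id P); exists b.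
exact: deq_trans (deq_sym (deq_idr u)) ub.
Qed.

(** A chain map from [X] to the shift of [Y] has a single component, from degree
-1 of [X] to degree 0 of [Y], and its null-homotopies have two. *)
Lemma E_zeroP X Y : E_zero X Y <-> ext_zero (ofK X) (ofK Y).
Proof.
split=> [E0 u|E0 u].
  pose a1 : {linear X (Negz 0) -> cshift Y (Negz 0)} := u.
  pose a0 : {linear X (Posz 0) -> cshift Y (Posz 0)} := \0.
  have a1C x : a0 (d1 X x) = d1 (cshift Y) (a1 x).
    by apply: esym; apply: (K2_pos (_ : Y (Posz 1))).
  have a0C x : d0 (cshift Y) (a0 x) = 0 by rewrite lin0.
  have [s1 [s0 [e1 _]]] := homotopic2P (deq_K2 (E0 (dmap (chain2 a1C a0C)))).
  pose t1 : {linear X (Negz 0) -> Y (Negz 0)} := \- s1.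
  exists t1, s0 => z; apply: etrans (_ : cmap1 (chain2 a1C a0C) z = _).
    by [].
  by apply: (eq_of_eq (e1 z)) => /=; rewrite /cmap1 /=; label.
have [f uf] := dmor_K2 u; apply: deq_trans uf _; apply: deq_homotopic.
have [s [t e]] := E0 (cmap1 f).
pose s1 : {linear X (Negz 0) -> cshift Y (Negz 1)} := \- s.
apply: (homotopic2 (s1 := s1) (s0 := t)) => x.
  apply: (eq_of_eq (e x)); rewrite [cmap1 _ x in X in X = _]/=; rewrite /cmap1 /=. label.
apply: etrans (_ : 0 = _); first by rewrite (K2_pos (cmap0 f x : Y (Posz 1))) /cmap0 /=; label.
by apply: esym; apply: (K2_pos (_ : Y (Posz 1))).
Qed.

End Translation.

(** * Conflations *)

Section Shift.
Variable R : pzRingType.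

Lemma homotopic_shift (A B : cplx R) (f g : chain_map A B) :
  homotopic f g -> homotopic (chain_shift f) (chain_shift g).
Proof.
case=> s sE; exists (fun i => \- (s (i + 1))) => i x /=.
by apply: (eq_of_eq (sE (i + 1) x)); label.
Qed.

Lemma deq_shift (A B : cplx R) (u v : dmor A B) :
  deq u v -> deq (dshift u) (dshift v).
Proof.
elim=> {A B u v} /=.
- by move=> A B u; apply: deq_refl.
- by move=> A B u v _; apply: deq_sym.
- by move=> A B u v w _ uv _; apply: deq_trans.
- by move=> A B C v v' u u' _ vv _; apply: deq_congr.
- by move=> A B C D w v u; apply: deq_assoc.
- move=> A B u; apply: deq_trans (deq_congr (deq_homotopic _) (deq_refl _)) (deq_idl _).
  exact: homotopic_eq.
- move=> A B u; apply: deq_trans (deq_congr (deq_refl _) (deq_homotopic _)) (deq_idr _).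
  exact: homotopic_eq.
- move=> A B C g f; apply: deq_trans (deq_comp _ _) _.
  by apply: deq_homotopic; apply: homotopic_eq.
- by move=> A B f g fg; apply: deq_homotopic; apply: homotopic_shift.
- move=> A B s qs; apply: deq_trans (deq_invl _) (deq_homotopic _).
  exact: homotopic_eq.
- move=> A B s qs; apply: deq_trans (deq_invr _) (deq_homotopic _).
  exact: homotopic_eq.
Qed.

Lemma diso_deq (A B : cplx R) (u v : dmor A B) : deq u v -> diso u -> diso v.
Proof.
move=> uv [w [wu uw]]; exists w; split.
  exact: deq_trans (deq_congr (deq_refl w) (deq_sym uv)) wu.
exact: deq_trans (deq_congr (deq_sym uv) (deq_refl w)) uw.
Qed.

End Shift.

Section Cocone.
Variables (R : pzRingType) (X Z : K2 R) (h : chain_map Z (cshift X)).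

Lemma cocone_diff_linear i :
  linear (fun x : X i * Z i => (diff X i x.1 - h i x.2, diff Z i x.2)).
Proof. by lin_tac. Qed.

(** The cone of [h] shifted back by one degree, written out termwise so that it is
visibly concentrated in two degrees. *)
Program Definition cocone : K2 R :=
  {| K2_cplx :=
     {| term := fun i => (X i * Z i)%type;
        diff := fun i => lin_of (@cocone_diff_linear i) |} |}.
Next Obligation.
move=> i x; apply: injective_projections => /=; last exact: diffK.
by rewrite cmapC linB diffK /=; label.
Qed.
Next Obligation. by move=> i; apply: fg_pair; apply: term_fg. Qed.
Next Obligation.
have [m mA] := term_bounded X; have [n nB] := term_bounded Z.
exists (m + n)%N => i lt_i; apply: zero_module_pair.
  by apply: mA; apply: leq_ltn_trans lt_i; apply: leq_addr.
by apply: nB; apply: leq_ltn_trans lt_i; apply: leq_addl.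
Qed.
Next Obligation. by move=> i; apply: proj_pair; apply: K2_proj. Qed.
Next Obligation.
by move=> i i1 i0; apply: zero_module_pair; apply: K2_conc.
Qed.

Program Definition cocone_in : chain_map X cocone :=
  {| cmap := fun i => lin_of (f := fun x : X i => (x, 0) : X i * Z i) _ |}.
Next Obligation. by move=> i; lin_tac. Qed.
Next Obligation. by move=> i x; apply: injective_projections => /=; label. Qed.

Program Definition cocone_out : chain_map cocone Z :=
  {| cmap := fun i => snd |}.
Next Obligation. by []. Qed.

(** The map from [Z] to the cone of the inclusion, a homotopy inverse of the
projection of that cone onto [Z]. *)
Program Definition to_cone_in : chain_map Z (cone cocone_in) :=
  {| cmap := fun i => lin_of
       (f := fun z : Z i => (h i z, (0, z)) : X (i + 1)%R * (X i * Z i)) _ |}.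
Next Obligation. by move=> i; lin_tac. Qed.
Next Obligation.
move=> i z /=; congr pair; first by rewrite cmapC.
by congr pair => /=; label.
Qed.

Program Definition from_cone_in : chain_map (cone cocone_in) Z :=
  {| cmap := fun i => lin_of
       (f := fun z : X (i + 1)%R * (X i * Z i) => z.2.2) _ |}.
Next Obligation. by move=> i; lin_tac. Qed.
Next Obligation. by move=> i x /=; label. Qed.

Lemma to_cone_in_diso : diso (dmap to_cone_in).
Proof.
exists (dmap from_cone_in); split.
  apply: deq_trans (deq_comp _ _) _.
  by apply: deq_homotopic; apply: homotopic_eq.
apply: deq_trans (deq_comp _ _) _; apply: deq_homotopic.
have lin_s (i : int) :
    linear (fun x : X (i + 1 + 1)%R * (X (i + 1)%R * Z (i + 1)%R) =>
              (- x.2.1, (0, 0)) : X (i + 1)%R * (X i * Z i)) by lin_tac.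
exists (fun i => lin_of (lin_s i)) => i x; apply: injective_projections => /=; first by label.
by apply: injective_projections => /=; label.
Qed.

(** The strict triangle is the cone of the inclusion of [X] into the cocone. *)
Lemma cocone_conflation Y : K2_iso cocone Y -> has_conflation X Y Z.
Proof.
case=> f [g [gf fg]].
exists (chain_comp f cocone_in), (chain_comp cocone_out g), (dmap h).
exists X, cocone, cocone_in, (did X), (dmap g), (dmap to_cone_in).
split; split.
- by exists (did X); split; apply: deq_idl.
- exists (dmap f); split.
    exact: deq_trans (deq_comp _ _) (deq_homotopic fg).
  exact: deq_trans (deq_comp _ _) (deq_homotopic gf).
- exact: to_cone_in_diso.
- apply: deq_trans (deq_comp _ _) _; apply: deq_sym; apply: deq_trans (deq_idr _) _.
  apply: deq_homotopic; apply: homotopic_sym.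
  have := homotopic_comp gf (homotopic_refl cocone_in).
  apply: homotopic_trans; apply: homotopic_trans (homotopic_eq _) (homotopic_refl _).
  by [].
- apply: deq_trans (deq_comp _ _) _; apply: deq_sym.
  apply: deq_trans (deq_comp _ _) _; apply: deq_homotopic.
  have lin_s (i : int) :
    linear (fun x : X (i + 1)%R * Z (i + 1)%R =>
              (x.1, (0, 0)) : X (i + 1)%R * (X i * Z i)) by lin_tac.
  have H : homotopic (cone_in cocone_in) (chain_comp to_cone_in cocone_out).
    exists (fun i => lin_of (lin_s i)) => i x; apply: injective_projections => /=; first by label.
    by apply: injective_projections => /=; label.
  have := homotopic_comp H (homotopic_refl g).
  by move/homotopic_trans; apply; apply: homotopic_eq.
- apply: deq_trans (deq_comp _ _) _; apply: deq_sym.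
  apply: deq_trans (deq_comp _ _) _; apply: deq_homotopic; exact: homotopic_eq.
Qed.

End Cocone.

Section FiveLemma.
Variables (R : pzRingType) (X Z : K2 R) (h : chain_map Z (cshift X)).
Variables (A B : cplx R) (p : chain_map A B).
Variables (a : chain_map X A) (c : chain_map Z (cone p)).
Variable s : forall i : int, {linear Z (i + 1) -> A (i + 1)}.
Hypothesis sE : forall i (z : Z (i + 1)),
  (c (i + 1) z).1 = a (i + 1 + 1) (h (i + 1) z)
    - diff A (i + 1) (s i z) + s (i + 1) (diff Z (i + 1) z).

Lemma cone_map1 i (z : Z i) : (c (i + 1) (diff Z i z)).1 = - diff A (i + 1) (c i z).1.
Proof. by rewrite cmapC. Qed.
Lemma cone_map2 i (z : Z i) : (c (i + 1) (diff Z i z)).2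
   = p (i + 1) (c i z).1 + diff B i (c i z).2.
Proof. by rewrite cmapC. Qed.

(** The homotopy [s] corrects the component of [c] in [B], which alone does not
commute with the differentials. *)
Lemma cocone_map : exists t : chain_map (cocone h) B,
  forall i x z, t (i + 1) (x, z)
    = p (i + 1) (a (i + 1) x) + (c (i + 1) z).2 - p (i + 1) (s i z).
Proof.
pose E := cocone h.
have lin_t (i : int) : linear (fun x : X (i + 1)%R * Z (i + 1)%R =>
  p (i + 1) (a (i + 1) x.1) + (c (i + 1) x.2).2 - p (i + 1) (s i x.2)).
  by move=> k u v /=; push_linear => /=; label.
pose t1 : {linear E (Negz 0) -> B (Negz 0)} := lin_of (lin_t (Negz 1)).
pose t0 : {linear E (Posz 0) -> B (Posz 0)} := lin_of (lin_t (Negz 0)).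
have comm i (x : X (i + 1)) (z : Z (i + 1)) :
    p (i + 1 + 1) (a (i + 1 + 1) (diff X (i + 1) x - h (i + 1) z))
    + (c (i + 1 + 1) (diff Z (i + 1) z)).2
    - p (i + 1 + 1) (s (i + 1) (diff Z (i + 1) z))
  = diff B (i + 1) (p (i + 1) (a (i + 1) x) + (c (i + 1) z).2
                    - p (i + 1) (s i z)).
  have pa := cmapC p (a (i + 1) x); have ps := cmapC p (s i z).
  by rewrite cone_map2 sE; push_linear; rewrite (cmapC a x) pa ps; label.
have tC x : t0 (d1 E x) = d1 B (t1 x) by exact: (comm (Negz 1) x.1 x.2).
have t0C x : d0 B (t0 x) = 0.
  apply: etrans (esym (comm (Negz 0) x.1 x.2)) _.
  have -> : diff X (Negz 0 + 1) x.1 = 0 by exact: (K2_pos (_ : X (Posz 1))).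
  have -> : h (Negz 0 + 1) x.2 = 0 by exact: (K2_pos (_ : X (Posz 1))).
  have -> : diff Z (Negz 0 + 1) x.2 = 0 by exact: (K2_pos (_ : Z (Posz 1))).
  by rewrite !lin0 /=; label.
exists (chain2 tC t0C) => -[n|[|[|n]]] x z //.
  have -> : x = 0 by case: n x {z} => [|n] x; apply: (K2_conc (k:=X)).
  have -> : z = 0 by case: n z {x} => [|n] x; apply: (K2_conc (k:=Z)).
  by rewrite !lin0 /=; label.
have -> : x = 0 by exact: K2_neg.
have -> : z = 0 by exact: K2_neg.
by rewrite !lin0 /=; label.
Qed.

(** The five lemma for the map of triangles given by [a], [t] and [c], chased on
elements: a class is moved first through [c] and then corrected through [a]. *)
Lemma cocone_map_quasi_iso (t : chain_map (cocone h) B) :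
  (forall i x z, t (i + 1) (x, z)
    = p (i + 1) (a (i + 1) x) + (c (i + 1) z).2 - p (i + 1) (s i z)) ->
  quasi_iso a -> quasi_iso c -> quasi_iso t.
Proof.
move=> tE qa qc i; split; last first.
  move=> y dy.
  have [|z [[al be] [dz yE]]] := (qc i).2 (0, y).
    by apply: injective_projections => /=; rewrite ?dy; label.
  have /= y1 := congr1 fst yE; have /= y2 := congr1 snd yE.
  have ahz : a (i + 1 + 1) (h (i + 1) z) = diff A (i + 1) (al + s i z).
    apply: (eq_of_eq (esym (sE z))); rewrite dz.
    by apply: (eq_of_eq (esym y1)); label.
  have dhz : diff X (i + 1 + 1) (h (i + 1) z) = 0.
    apply: oppr_inj; rewrite oppr0; apply: etrans (esym (cmapC h z)) _.
    by rewrite dz lin0.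
  have [|x hz] := (qa (i + 1)).1 _ dhz; first by exists (al + s i z).
  have [|x' [w [dx' xE]]] := (qa i).2 (a (i + 1) x - al - s i z).
    rewrite !linB -cmapC -hz ahz; label.
  exists (x - x', z), (be - p i w); split.
    apply: injective_projections => /=; last exact: dz.
    by rewrite linB dx' hz; label.
  rewrite tE; apply: (eq_of_eq y2).
  apply: (eq_of_eq (congr1 (p (i + 1)) (esym xE))).
  by apply: (eq_of_eq (esym (cmapC p w))); label.
rewrite -(subrK 1 i); move: (i - 1) => j {i}.
move=> [x z] dxz [y txz].
have /= dx := congr1 fst dxz; have /= dz := congr1 snd dxz.
have {}dx : diff X (j + 1 + 1) x = h (j + 1 + 1) z.
  by apply: (eq_of_eq dx); label.
rewrite tE in txz.
have cz1 : (c (j + 1 + 1) z).1 = diff A (j + 1 + 1) (a (j + 1 + 1) x - s (j + 1) z).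
  by rewrite sE dz linB -cmapC dx; label.
have [|z' zE] := (qc (j + 1)).1 z dz.
  exists (s (j + 1) z - a (j + 1 + 1) x, y).
  apply: injective_projections => /=; first by rewrite cz1; label.
  by apply: (eq_of_eq txz); label.
have [|z2 [[al be] [dz2 kE]]] := (qc j).2 
   (c (j + 1) z' - (s (j + 1) z - a (j + 1 + 1) x, y)).
  have e1 := cone_map1 z'; have e2 := cone_map2 z'; rewrite -zE in e1 e2.
  apply: injective_projections => /=.
    by apply: (eq_of_eq (esym e1)); rewrite cz1; label.
  apply: (eq_of_eq (esym e2)); apply: (eq_of_eq txz); label.
have /= k1 := congr1 fst kE; have /= k2 := congr1 snd kE.
pose z3 := z' - z2.
have dz3 : diff Z (j + 1) z3 = z by rewrite linB dz2 subr0.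
have cz3 : (c (j + 1) z3).1 = s (j + 1) z - a (j + 1 + 1) x - diff A (j + 1) al.
  by apply: (eq_of_eq k1); rewrite /z3 linB /=; label.
have [||x3 x3E] := (qa (j + 1)).1 (x + h (j + 1) z3).
- rewrite linD dx -dz3.
  by apply: (eq_of_eq (cmapC h z3)) => /=; label.
- exists (s j z3 - al); rewrite linD.
  by apply: (eq_of_eq cz3); rewrite sE dz3; label.
exists (x3, z3); apply: injective_projections => /=; last by rewrite dz3.
by apply: (eq_of_eq x3E); label.
Qed.

End FiveLemma.

Section ConflationClass.
Variable R : pzRingType.
Implicit Types X Y Z : K2 R.

Lemma quasi_iso_K2_iso X Y (B : cplx R) (t : chain_map X B) (b : chain_map Y B) :
  quasi_iso t -> quasi_iso b -> K2_iso X Y.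
Proof.
move=> qt qb; have [f bf] := K2_lift t qb; have [g tg] := K2_lift b qt.
exists f, g; split.
  apply: (K2_lift_inj qt); apply: homotopic_trans (_ : homotopic _ t) _.
    apply: homotopic_trans _ bf.
    apply: homotopic_trans (homotopic_comp tg (homotopic_refl f)).
    exact: homotopic_eq.
  exact: homotopic_eq.
apply: (K2_lift_inj qb); apply: homotopic_trans (_ : homotopic _ b) _.
  apply: homotopic_trans _ tg.
  apply: homotopic_trans (homotopic_comp bf (homotopic_refl g)).
  exact: homotopic_eq.
exact: homotopic_eq.
Qed.

(** The middle term of a conflation is determined by its connecting morphism.
Represent the three isomorphisms onto a strict triangle by chain maps; the
cocone of the connecting map and the middle term are then both
quasi-isomorphic to the middle term of the strict triangle. *)
Lemma conflation_cocone X Y Z :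
  has_conflation X Y Z -> exists h : chain_map Z (cshift X), K2_iso (cocone h) Y.
Proof.
case=> f [g [h [A [B [p [a [b [c [[ia ib ic] [bf cg ah]]]]]]]]]].
have [a' aE] := dmor_K2 a; have [b' bE] := dmor_K2 b.
have [c' cE] := dmor_K2 c; have [h' hE] := dmor_K2 h.
have qa := diso_quasi_iso (diso_deq aE ia).
have qb := diso_quasi_iso (diso_deq bE ib).
have qc := diso_quasi_iso (diso_deq cE ic).
have [s sE] : homotopic (chain_comp (cone_out p) c') (chain_comp (chain_shift a') h').
  apply: deq_K2; apply: deq_trans (deq_sym (deq_comp _ _)) _.
  apply: deq_trans (deq_congr (deq_refl _) (deq_sym cE)) _.
  apply: deq_trans (deq_sym ah) _.
  apply: deq_trans (deq_congr (deq_shift aE) hE) _.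
  exact: deq_comp.
have {}sE i (z : Z (i + 1)) : (c' (i + 1) z).1 = a' (i + 1 + 1) (h' (i + 1) z)
    - diff A (i + 1) (s i z) + s (i + 1) (diff Z (i + 1) z).
  by apply: (eq_of_eq (sE i z)) => /=; label.
have [t tE] := cocone_map sE; have qt := cocone_map_quasi_iso sE tE qa qc.
by exists h'; apply: quasi_iso_K2_iso qt qb.
Qed.

Lemma conflationP X Y Z :
  has_conflation X Y Z <-> conf (ofK X) (ofK Y) (ofK Z).
Proof.
have cocE (h : chain_map Z (cshift X)) (u : {linear Z (Negz 0) -> X (Posz 0)}) :
    (forall z, u z = - cmap1 h z) -> qis (@ext _ (ofK X) (ofK Z) u) (ofK (cocone h)).
  move=> uE; exists (idfun : {linear (X (Negz 0) * Z (Negz 0))%type -> _}),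
    (idfun : {linear (X (Posz 0) * Z (Posz 0))%type -> _}).
  have e x : pd (@ext _ (ofK X) (ofK Z) u) x = pd (ofK (cocone h)) x.
    by rewrite /= uE.
  split=> //; first by move=> x y xE; exists y => //; rewrite e.
  move=> y; exists y, 0; rewrite -[LHS]addr0; congr (_ + _).
  exact: (esym (lin0 (pd (ofK (cocone h))))).
split=> [/conflation_cocone[h /K2_isoP hY]|[u uY]].
  pose u : {linear Z (Negz 0) -> X (Posz 0)} := \- cmap1 h.
  by exists u; apply: qis_trans hY; apply: cocE.
pose h1 : {linear Z (Negz 0) -> cshift X (Negz 0)} := \- u.
pose h0 : {linear Z (Posz 0) -> cshift X (Posz 0)} := \0.
have hC x : h0 (d1 Z x) = d1 (cshift X) (h1 x).
  by apply: esym; apply: (K2_pos (_ : X (Posz 1))).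
have h0C x : d0 (cshift X) (h0 x) = 0 by rewrite lin0.
apply: (cocone_conflation (h := chain2 hC h0C)); apply/K2_isoP.
apply: qis_trans (qis_sym (cocE _ u _)) uY => z; rewrite /cmap1 /=.
by rewrite opprK.
Qed.

End ConflationClass.

(** * Extensions of presentations *)

Section Extensions.
Variable R : pzRingType.
Implicit Types (X Y Z P I A B C E : pres R).
Local Notation "M ** N" := (M * N)%type (at level 40, left associativity).

Definition inl_lin (M N : lmodType R) : {linear M -> M ** N} :=
  [lin fun x : M => (x, 0 : N)].
Definition inr_lin (M N : lmodType R) : {linear N -> M ** N} :=
  [lin fun y : N => (0 : M, y)].

(** The outer terms of an extension may be replaced along quasi-isomorphisms;
these are the two chases of the five lemma. *)
Lemma qis_ext_left X X' Z (u : {linear deg1 Z -> deg0 X}) :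
  qis X X' -> exists v : {linear deg1 Z -> deg0 X'}, qis (ext u) (ext v).
Proof.
case=> f1 [f0 [fC inj mid sur]]; exists (f0 \o u).
pose F1 : {linear deg1 X ** deg1 Z -> deg1 X' ** deg1 Z} :=
  [lin fun x : deg1 X ** deg1 Z => (f1 x.1, x.2)].
pose F0 : {linear deg0 X ** deg0 Z -> deg0 X' ** deg0 Z} :=
  [lin fun x : deg0 X ** deg0 Z => (f0 x.1, x.2)].
exists F1, F0; split=> /=.
- by move=> [x z] /=; rewrite linD fC.
- move=> [x z] /= [e1 e2] [fx z0]; rewrite z0 lin0 addr0 in e1.
  by rewrite (inj x) // z0.
- move=> [x z] [x' z'] /= [e1 e2].
  have [|w xE x'E] := mid (x - u z') x'; first by rewrite linB e1 addrK.
  exists (w, z') => /=; last by rewrite x'E.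
  by rewrite e2 -xE subrK.
- move=> [x z]; have [w [v e]] := sur x.
  by exists (w, z), (v, 0) => /=; rewrite e; apply: injective_projections => /=; label.
Qed.

Lemma qis_ext_right X Z Z' (u : {linear deg1 Z -> deg0 X}) :
  qis Z Z' -> exists v : {linear deg1 Z' -> deg0 X}, qis (ext u) (ext v).
Proof.
move/qis_sym; case=> f1 [f0 [fC inj mid sur]]; exists (u \o f1).
apply: qis_sym.
pose F1 : {linear deg1 X ** deg1 Z' -> deg1 X ** deg1 Z} :=
  [lin fun x : deg1 X ** deg1 Z' => (x.1, f1 x.2)].
pose F0 : {linear deg0 X ** deg0 Z' -> deg0 X ** deg0 Z} :=
  [lin fun x : deg0 X ** deg0 Z' => (x.1, f0 x.2)].
exists F1, F0; split=> /=.
- by move=> [x z] /=; rewrite fC.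
- by move=> [x z] /= [e1 e2] [-> fz]; rewrite (inj z).
- move=> [x z] [x' z'] /= [e1 e2].
  have [w zE z'E] := mid z z' e2.
  by exists (x', w) => /=; rewrite ?zE ?e1 ?z'E.
- move=> [x z]; have [w [v e]] := sur z.
  exists (x - u v, w), (0, v) => /=; rewrite e.
  by apply: injective_projections => /=; label.
Qed.

Lemma conf_qis X X' Y Y' Z Z' :
  conf X Y Z -> qis X X' -> qis Y Y' -> qis Z Z' -> conf X' Y' Z'.
Proof.
case=> u uY XX YY ZZ; have [v uv] := qis_ext_left u XX.
have [w vw] := qis_ext_right v ZZ; exists w.
exact: qis_trans (qis_sym (qis_trans uv vw)) (qis_trans uY YY).
Qed.

Lemma conf_ext X Z (u : {linear deg1 Z -> deg0 X}) : conf X (ext u) Z.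
Proof. by exists u; apply: qis_refl. Qed.

Lemma psum_qis X X' Y : qis X X' -> qis (psum X Y) (psum X' Y).
Proof.
case=> f1 [f0 [fC inj mid sur]].
pose F1 : {linear deg1 X ** deg1 Y -> deg1 X' ** deg1 Y} :=
  [lin fun x : deg1 X ** deg1 Y => (f1 x.1, x.2)].
pose F0 : {linear deg0 X ** deg0 Y -> deg0 X' ** deg0 Y} :=
  [lin fun x : deg0 X ** deg0 Y => (f0 x.1, x.2)].
exists F1, F0; split=> /=.
- by move=> [x z] /=; rewrite linD fC lin0.
- move=> [x z] /= [e1 e2] [fx z0]; rewrite addr0 in e1.
  by rewrite (inj x) // z0.
- move=> [x z] [x' z'] /= [e1 e2]; rewrite addr0 in e1.
  have [w xE x'E] := mid x x' e1.
  by exists (w, z') => /=; rewrite ?xE ?x'E ?addr0 ?e2.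
- move=> [x z]; have [w [v e]] := sur x.
  by exists (w, z), (v, 0) => /=; rewrite e; apply: injective_projections => /=; label.
Qed.

Lemma psumC X Y : qis (psum X Y) (psum Y X).
Proof.
pose F1 : {linear deg1 X ** deg1 Y -> deg1 Y ** deg1 X} :=
  [lin fun x : deg1 X ** deg1 Y => (x.2, x.1)].
pose F0 : {linear deg0 X ** deg0 Y -> deg0 Y ** deg0 X} :=
  [lin fun x : deg0 X ** deg0 Y => (x.2, x.1)].
apply: (@qis_strict _ (psum X Y) (psum Y X) F1 F0
  (fun x => (x.2, x.1)) (fun x => (x.2, x.1))); try by case.
by move=> [x y] /=; congr pair; label.
Qed.

(** The null-homotopy is a change of splitting in each degree. *)
Lemma qis_ext_null X Z (u : {linear deg1 Z -> deg0 X}) :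
  null u -> qis (ext u) (psum X Z).
Proof.
case=> s [t uE].
pose F1 : {linear deg1 X ** deg1 Z -> deg1 X ** deg1 Z} :=
  [lin fun x : deg1 X ** deg1 Z => (x.1 + s x.2, x.2)].
pose F0 : {linear deg0 X ** deg0 Z -> deg0 X ** deg0 Z} :=
  [lin fun x : deg0 X ** deg0 Z => (x.1 - t x.2, x.2)].
apply: (@qis_strict _ (ext u) (psum X Z) F1 F0
  (fun x => (x.1 - s x.2, x.2)) (fun x => (x.1 + t x.2, x.2))).
- by move=> [x z] /=; congr pair; rewrite uE; label.
- by move=> [x z] /=; rewrite addrK.
- by move=> [x z] /=; rewrite subrK.
- by move=> [x z] /=; rewrite subrK.
- by move=> [x z] /=; rewrite addrK.
Qed.

Lemma conf_split X Y Z : conf X Y Z -> ext_zero Z X -> qis (psum X Z) Y.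
Proof.
by case=> u uY /(_ u) /qis_ext_null /qis_sym uS; apply: qis_trans uS uY.
Qed.

Lemma conf_zero_left Y Z : conf (pzero R) Y Z -> qis Y Z.
Proof.
case=> u /qis_sym uY; apply: qis_trans uY _.
exists (snd : {linear 'rV[R]_0 ** deg1 Z -> deg1 Z}),
  (snd : {linear 'rV[R]_0 ** deg0 Z -> deg0 Z}); split=> //=.
- by move=> [x z] _ /= ->; rewrite (zero_module_rV0 x).
- move=> [x z] z' /= ->; exists (0, z') => //=.
  by congr pair; rewrite (zero_module_rV0 x) (zero_module_rV0 (_ + _)).
- by move=> z; exists (0, z), 0; rewrite lin0 addr0.
Qed.

(** * Vanishing of extensions *)

(** The homotopies between the identities and the composites of inverse
quasi-isomorphisms enter the null-homotopies. *)
Lemma ext_zero_qis X X' Y Y' :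
  ext_zero X Y -> qis X X' -> qis Y Y' -> ext_zero X' Y'.
Proof.
move=> E0 XX YY.
have {}E0 : ext_zero X' Y.
  move=> u.
  have [f1 [f0 [g1 [g0 [h [k [fC gC _ [fg1 _]]]]]]]] := qis_heq XX.
  have [s [t e]] := E0 (u \o f1).
  pose t' : {linear deg0 X' -> deg0 Y} := (t \o g0) \+ (u \o k).
  exists (s \o g1), t' => z /=; rewrite gC.
  apply: (eq_of_eq (congr1 u (fg1 z))).
  by apply: (eq_of_eq (e (g1 z))) => /=; label.
move=> u.
have [f1 [f0 [g1 [g0 [h [k [fC gC _ [_ fg0]]]]]]]] := qis_heq YY.
have [s [t e]] := E0 (g0 \o u).
pose s' : {linear deg1 X' -> deg1 Y'} := (f1 \o s) \+ (k \o u).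
exists s', (f0 \o t) => z /=.
apply: (eq_of_eq (fg0 (u z))); apply: (eq_of_eq (congr1 f0 (e z))) => /=.
by push_linear; rewrite fC; label.
Qed.

Lemma ext_zero_mid A X Y Z :
  conf X Y Z -> ext_zero A X -> ext_zero A Z -> ext_zero A Y.
Proof.
case=> v vY AX AZ; apply: (ext_zero_qis _ (qis_refl A) vY) => u.
have [s2 [t2 e2]] := AZ (snd \o u).
pose u1 : {linear deg1 A -> deg0 X} := (fst \o u) \- (v \o s2).
have [s1 [t1 e1]] := AX u1.
pose s : {linear deg1 A -> deg1 (ext v)} := [lin fun x : deg1 A => (s1 x, s2 x)].
pose t : {linear deg0 A -> deg0 (ext v)} := [lin fun x : deg0 A => (t1 x, t2 x)].
exists s, t => z; apply: injective_projections => /=; last exact: (e2 z).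
by apply: (eq_of_eq (e1 z)) => /=; label.
Qed.

(** There are no second extensions: a class lifts from [Z] to the middle term,
with zero component in [X]. *)
Lemma ext_zero_quot A X Y Z : conf X Y Z -> ext_zero A Y -> ext_zero A Z.
Proof.
case=> v /qis_sym vY AY; have {}AY := ext_zero_qis AY (qis_refl A) vY.
move=> u.
pose u' : {linear deg1 A -> deg0 (ext v)} := [lin fun x : deg1 A => (0 : deg0 X, u x)].
have [s [t e]] := AY u'; exists (snd \o s), (snd \o t) => z.
exact: (congr1 snd (e z)).
Qed.

Lemma ext_zero_mid_l A X Y Z :
  conf X Y Z -> ext_zero X A -> ext_zero Z A -> ext_zero Y A.
Proof.
case=> v vY XA ZA; apply: (ext_zero_qis _ vY (qis_refl A)) => u.
pose ux : {linear deg1 X -> deg0 A} := u \o inl_lin (deg1 X) (deg1 Z).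
pose uz : {linear deg1 Z -> deg0 A} := u \o inr_lin (deg1 X) (deg1 Z).
have uE x z : u (x, z) = ux x + uz z.
  by rewrite /= -linD; congr (u _); congr pair; rewrite /= ?addr0 ?add0r.
clearbody ux uz.
have [s1 [t1 e1]] := XA ux; have [s2 [t2 e2]] := ZA (uz \- (t1 \o v)).
pose s : {linear deg1 (ext v) -> deg1 A} := (s1 \o fst) \+ (s2 \o snd).
pose t : {linear deg0 (ext v) -> deg0 A} := (t1 \o fst) \+ (t2 \o snd).
exists s, t => -[x z]; rewrite uE e1; apply: (eq_of_eq (e2 z)) => /=; label.
Qed.

Lemma ext_zero_sub A X Y Z : conf X Y Z -> ext_zero Y A -> ext_zero X A.
Proof.
case=> v /qis_sym vY YA; have {}YA := ext_zero_qis YA vY (qis_refl A).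
move=> u; have [s [t e]] := YA (u \o fst).
pose s' : {linear deg1 X -> deg1 A} := s \o inl_lin (deg1 X) (deg1 Z).
pose t' : {linear deg0 X -> deg0 A} := t \o inl_lin (deg0 X) (deg0 Z).
exists s', t' => x; apply: etrans (e (x, 0)) _ => /=.
by rewrite !lin0 addr0.
Qed.

End Extensions.

(** * Octahedra *)

Section Octahedra.
Variable R : pzRingType.
Implicit Types (X Y Z P I A B C E : pres R).
Local Notation "M ** N" := (M * N)%type (at level 40, left associativity).

(** The octahedron on two composable inflations; the two new conflations are
classified by the components of the given classes. *)
Lemma conf_compose X1 X X2 X' Z :
  conf X1 X X2 -> conf X X' Z -> exists Z1, conf X1 X' Z1 /\ conf X2 Z1 Z.
Proof.
case=> v /qis_sym vX XZ.
have [w wX'] := conf_qis XZ vX (qis_refl X') (qis_refl Z).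
pose w1 : {linear deg1 Z -> deg0 X1} := fst \o w.
pose w2 : {linear deg1 Z -> deg0 X2} := snd \o w.
exists (ext w2); split; last exact: conf_ext.
pose v' : {linear deg1 (ext w2) -> deg0 X1} := (v \o fst) \+ (w1 \o snd).
exists v'; apply: qis_trans wX'.
pose F1 : {linear deg1 X1 ** (deg1 X2 ** deg1 Z) -> deg1 X1 ** deg1 X2 ** deg1 Z} :=
  [lin fun x : deg1 X1 ** (deg1 X2 ** deg1 Z) => ((x.1, x.2.1), x.2.2)].
pose F0 : {linear deg0 X1 ** (deg0 X2 ** deg0 Z) -> deg0 X1 ** deg0 X2 ** deg0 Z} :=
  [lin fun x : deg0 X1 ** (deg0 X2 ** deg0 Z) => ((x.1, x.2.1), x.2.2)].
apply: (@qis_strict _ (ext v') (ext w) F1 F0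
  (fun x => (x.1.1, (x.1.2, x.2))) (fun x => (x.1.1, (x.1.2, x.2)))).
- move=> [x [y z]] /=; repeat split_pair; label.
- by case=> x [].
- by case=> -[].
- by case=> x [].
- by case=> -[].
Qed.

(** As there are no second extensions, the class of a conflation extends along
an inflation into its third term. *)
Lemma conf_extend A B C X' Z :
  conf A B C -> conf C X' Z -> exists B', conf A B' X' /\ conf B B' Z.
Proof.
case=> v vB [w wX'].
pose v' : {linear deg1 (ext w) -> deg0 A} := v \o fst.
exists (ext v'); split.
  exact: conf_qis (conf_ext v') (qis_refl A) (qis_refl _) wX'.
pose w' : {linear deg1 Z -> deg0 (ext v)} := [lin fun z : deg1 Z => (0 : deg0 A, w z)].
apply: (conf_qis (conf_ext w') vB _ (qis_refl Z)).
pose F1 : {linear deg1 A ** deg1 C ** deg1 Z -> deg1 A ** (deg1 C ** deg1 Z)} :=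
  [lin fun x : deg1 A ** deg1 C ** deg1 Z => (x.1.1, (x.1.2, x.2))].
pose F0 : {linear deg0 A ** deg0 C ** deg0 Z -> deg0 A ** (deg0 C ** deg0 Z)} :=
  [lin fun x : deg0 A ** deg0 C ** deg0 Z => (x.1.1, (x.1.2, x.2))].
apply: (@qis_strict _ (ext w') (ext v') F1 F0
  (fun x => ((x.1, x.2.1), x.2.2)) (fun x => ((x.1, x.2.1), x.2.2))).
- move=> [[x y] z] /=; repeat split_pair; label.
- by case=> -[].
- by case=> x [].
- by case=> -[].
- by case=> x [].
Qed.

(** The middle term is the extension of the sum of [C] and [Z] by [A], which may
be filtered in either order. *)
Lemma conf_pushout A B C X' Z :
  conf A B C -> conf A X' Z -> exists E, conf X' E C /\ conf B E Z.
Proof.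
case=> v vB [w wX'].
pose v' : {linear deg1 C -> deg0 (ext w)} := [lin fun z : deg1 C => (v z, 0 : deg0 Z)].
exists (ext v'); split.
  exact: conf_qis (conf_ext v') wX' (qis_refl _) (qis_refl C).
pose w' : {linear deg1 Z -> deg0 (ext v)} := [lin fun z : deg1 Z => (w z, 0 : deg0 C)].
apply: (conf_qis (conf_ext w') vB _ (qis_refl Z)).
pose F1 : {linear deg1 A ** deg1 C ** deg1 Z -> deg1 A ** deg1 Z ** deg1 C} :=
  [lin fun x : deg1 A ** deg1 C ** deg1 Z => ((x.1.1, x.2), x.1.2)].
pose F0 : {linear deg0 A ** deg0 C ** deg0 Z -> deg0 A ** deg0 Z ** deg0 C} :=
  [lin fun x : deg0 A ** deg0 C ** deg0 Z => ((x.1.1, x.2), x.1.2)].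
apply: (@qis_strict _ (ext w') (ext v') F1 F0
  (fun x => ((x.1.1, x.2), x.1.2)) (fun x => ((x.1.1, x.2), x.1.2))).
- move=> [[x y] z] /=; repeat split_pair; label.
- by case=> -[].
- by case=> -[].
- by case=> -[].
- by case=> -[].
Qed.

Lemma conf_psum_l X X' Y Z : conf X X' Z -> conf (psum X Y) (psum X' Y) Z.
Proof.
case=> w wX'.
pose w' : {linear deg1 Z -> deg0 (psum X Y)} := [lin fun z : deg1 Z => (w z, 0 : deg0 Y)].
apply: (conf_qis (conf_ext w') (qis_refl _) _ (qis_refl Z)).
apply: qis_trans (psum_qis Y wX').
pose F1 : {linear deg1 X ** deg1 Y ** deg1 Z -> deg1 X ** deg1 Z ** deg1 Y} :=
  [lin fun x : deg1 X ** deg1 Y ** deg1 Z => ((x.1.1, x.2), x.1.2)].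
pose F0 : {linear deg0 X ** deg0 Y ** deg0 Z -> deg0 X ** deg0 Z ** deg0 Y} :=
  [lin fun x : deg0 X ** deg0 Y ** deg0 Z => ((x.1.1, x.2), x.1.2)].
apply: (@qis_strict _ (ext w') (psum (ext w) Y) F1 F0
  (fun x => ((x.1.1, x.2), x.1.2)) (fun x => ((x.1.1, x.2), x.1.2))).
- move=> [[x y] z] /=; repeat split_pair; label.
- by case=> -[].
- by case=> -[].
- by case=> -[].
- by case=> -[].
Qed.

Lemma conf_psum_r X X' Y Z : conf X X' Z -> conf X (psum X' Y) (psum Z Y).
Proof.
case=> w wX'.
pose w' : {linear deg1 (psum Z Y) -> deg0 X} := w \o fst.
apply: (conf_qis (conf_ext w') (qis_refl _) _ (qis_refl _)).
apply: qis_trans (psum_qis Y wX').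
pose F1 : {linear deg1 X ** (deg1 Z ** deg1 Y) -> deg1 X ** deg1 Z ** deg1 Y} :=
  [lin fun x : deg1 X ** (deg1 Z ** deg1 Y) => ((x.1, x.2.1), x.2.2)].
pose F0 : {linear deg0 X ** (deg0 Z ** deg0 Y) -> deg0 X ** deg0 Z ** deg0 Y} :=
  [lin fun x : deg0 X ** (deg0 Z ** deg0 Y) => ((x.1, x.2.1), x.2.2)].
apply: (@qis_strict _ (ext w') (psum (ext w) Y) F1 F0
  (fun x => (x.1.1, (x.1.2, x.2))) (fun x => (x.1.1, (x.1.2, x.2)))).
- move=> [x [y z]] /=; repeat split_pair; label.
- by case=> x [].
- by case=> -[].
- by case=> x [].
- by case=> -[].
Qed.

(** * Projective stalks *)

Definition stalk (M : lmodType R) (fgM : finitely_generated M)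
    (prM : projective M) : pres R :=
  Pres (\0 : {linear 'rV[R]_0 -> M})
    (zero_module_fg (@zero_module_rV0 R)) fgM
    (zero_module_proj (@zero_module_rV0 R)) prM.

Definition is_stalk P := zero_module (deg1 P).

Lemma stalk_ext_zero P Y : is_stalk P -> ext_zero P Y.
Proof.
by move=> P0 u; exists \0, \0 => z; rewrite (P0 z) !lin0 addr0.
Qed.

(** Every presentation is the cone of its differential between stalks. *)
Lemma conf_stalks Z :
  exists P1 P0, [/\ is_stalk P1, is_stalk P0 & conf P1 P0 Z].
Proof.
pose P1 := stalk (@deg1_fg _ Z) (@deg1_proj _ Z).
pose P0 := stalk (@deg0_fg _ Z) (@deg0_proj _ Z).
exists P1, P0; split; try exact: zero_module_rV0.
pose u : {linear deg1 Z -> deg0 P1} := idfun.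
exists u.
pose F1 : {linear 'rV[R]_0 ** deg1 Z -> 'rV[R]_0} := \0.
pose F0 : {linear deg1 Z ** deg0 Z -> deg0 Z} :=
  [lin fun x : deg1 Z ** deg0 Z => x.2 - pd Z x.1].
exists F1, F0; split.
- by move=> [x z] /=; label.
- move=> [x z] /= [e _] _; have -> : z = 0 := etrans (esym (add0r z)) e.
  by rewrite (zero_module_rV0 x).
- move=> [x z] /= y e; exists (0, x) => /=; last by rewrite (zero_module_rV0 y).
  congr pair; first by rewrite add0r.
  by apply: (eq_of_eq e); label.
- by move=> z; exists (0, z), 0 => /=; label.
Qed.

(** The cone of the composite [X -> E -> I] is again two-term, because the
kernel [P] of [E -> I] sits in degree 0 only: it is the cone of the composite
[P -> E -> C]. *)
Lemma conf_cross P E I X C : is_stalk P ->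
  conf P E I -> conf X E C -> exists C', conf X I C' /\ conf P C C'.
Proof.
move=> P0 [eps epsE] [del delE].
have [f1 [f0 [fC inj mid sur]]] := qis_trans epsE (qis_sym delE).
have [p pE] : exists p : {linear deg0 P -> deg0 (ext del)}, forall q, p q = f0 (q, 0).
  by exists (f0 \o inl_lin (deg0 P) (deg0 I)).
pose dC' : {linear deg1 C ** deg0 P -> deg0 C} :=
  (pd C \o fst) \+ (snd \o p \o snd).
pose C' : pres R := Pres dC'
  (fg_pair (@deg1_fg _ C) (@deg0_fg _ P)) (@deg0_fg _ C)
  (proj_pair (@deg1_proj _ C) (@deg0_proj _ P)) (@deg0_proj _ C).
exists C'; split.
  pose w : {linear deg1 C' -> deg0 X} := (del \o fst) \+ (fst \o p \o snd).
  exists w; apply: qis_sym.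
  have [i1 i1E] : exists i1 : {linear deg1 I -> deg1 (ext del)},
      forall y, i1 y = f1 (0, y) by exists (f1 \o inr_lin (deg1 P) (deg1 I)).
  have [i0 i0E] : exists i0 : {linear deg0 I -> deg0 (ext del)},
      forall y, i0 y = f0 (0, y) by exists (f0 \o inr_lin (deg0 P) (deg0 I)).
  have f0E q y : f0 (q, y) = p q + i0 y.
    rewrite pE i0E -linD; congr (f0 _); congr pair; first by rewrite /= addr0.
    by rewrite /= add0r.
  pose F1 : {linear deg1 I -> deg1 (ext w)} :=
    [lin fun y : deg1 I => ((i1 y).1, ((i1 y).2, - eps y))].
  exists F1, i0.
  have extE x : pd (ext w) x = pd (ext del) (x.1, x.2.1) + p x.2.2.
    by apply: injective_projections => /=; label.
  have i0d y : i0 (pd I y) = pd (ext del) (i1 y) - p (eps y).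
    by rewrite i1E -fC /= f0E lin0 add0r; label.
  split.
  - by move=> y; rewrite i0d extE linN -surjective_pairing.
  - move=> y dy /= [y1 [y2 ey]].
    have iy : i1 y = 0 by rewrite [LHS]surjective_pairing y1 y2.
    have {}ey : eps y = 0 by rewrite -[LHS]opprK ey oppr0.
    apply: (congr1 snd (_ : (0, y) = 0)); apply: inj; last by rewrite -i1E.
    by apply: injective_projections => /=; rewrite ?dy ?ey; label.
  - move=> y [v [c q]]; rewrite extE /= => e.
    have [|[pi y1] [wE yE] vE] := mid (- q, y) (v, c).
      by rewrite f0E linN e /=; label.
    move: wE; rewrite (P0 pi) lin0 add0r in vE * => wE.
    exists y1; first exact: yE.
    by rewrite /= i1E -vE -wE opprK.
  - move=> z; have [[q y] [[v c] e]] := sur z.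
    by exists y, (v, (c, q)); rewrite extE e f0E; abel.
pose w : {linear deg1 C' -> deg0 P} := snd.
exists w; apply: qis_sym.
pose F1 : {linear deg1 C -> deg1 P ** (deg1 C ** deg0 P)} :=
  [lin fun c : deg1 C => (0 : deg1 P, (c, 0 : deg0 P))].
exists F1, (inr_lin (deg0 P) (deg0 C)); split.
- by move=> c; apply: injective_projections => /=; push_linear => /=; label.
- by move=> c _ /= [].
- move=> c [pi [c1 q]] /= [e1 e2]; rewrite (P0 pi) in e1 *.
  have {}e1 : q = 0 by apply: (eq_of_eq (esym e1)); label.
  by exists c1; rewrite ?e2 e1 ?lin0 /= ?addr0.
- move=> [q c]; exists (c - (p q).2), (0, (0, q)).
  by apply: injective_projections => /=; push_linear => /=; label.
Qed.

End Octahedra.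

(** * Dimensions of subspaces *)

Lemma bounded_max (P : nat -> Prop) (b : nat) :
  (exists n, P n) -> (forall n, P n -> (n <= b)%N) ->
  exists n, P n /\ forall m, P m -> (m <= n)%N.
Proof.
move=> [n0 P0] Pb.
have exP : exists n, `[< P n >] by exists n0; apply/asboolP.
have ubP n : `[< P n >] -> (n <= b)%N by move=> /asboolP; apply: Pb.
case: (ex_maxnP exP ubP) => n /asboolP Pn maxn; exists n; split=> // m Pm.
by apply: maxn; apply/asboolP.
Qed.

Lemma exists_min (P : nat -> Prop) :
  (exists n, P n) -> exists n, P n /\ forall m, P m -> (n <= m)%N.
Proof.
move=> [n0 P0].
have exP : exists n, `[< P n >] by exists n0; apply/asboolP.
case: (ex_minnP exP) => n /asboolP Pn minn; exists n; split=> // m Pm.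
by apply: minn; apply/asboolP.
Qed.

Section Dimension.
Variable k : fieldType.
Implicit Types H : lmodType k.

Definition subspace H (S : H -> Prop) : Prop :=
  S 0 /\ forall a x y, S x -> S y -> S (a *: x + y).

Definition is_dim H (S : H -> Prop) (n : nat) : Prop :=
  exists f : {linear 'rV[k]_n -> H},
    injective f /\ forall x, S x <-> exists v, f v = x.

Definition fin_dim H (S : H -> Prop) : Prop := exists n, is_dim S n.

(** A family of vectors of a coordinate space has a finite subfamily with the
same span: take one of maximal rank. *)
Lemma spanning_subfamily (F : fieldType) (T : Type) (I : T -> Prop) r
    (g : T -> 'rV[F]_r) :
  exists (m : nat) (G : 'I_m -> T), (forall i, I (G i)) /\
    forall t, I t -> (g t <= \matrix_i g (G i))%MS.
Proof.
pose P n := exists (m : nat) (G : 'I_m -> T), (forall i, I (G i)) /\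
    \rank (\matrix_i g (G i)) = n.
have [||n [[m [G [IG rG]]] maxn]] := @bounded_max P r.
- exists 0%N, 0%N, (fun i : 'I_0 => False_rect T (notF (ltn_ord i))).
  by split=> [[] //|]; apply/eqP; rewrite -leqn0 rank_leq_row.
- by move=> n [m [G [_ <-]]]; apply: rank_leq_col.
exists m, G; split=> // t It.
pose G' (i : 'I_(1 + m)) := if split i is inr j then G j else t.
have IG' i : I (G' i) by rewrite /G'; case: splitP.
have sub : (col_mx (g t) (\matrix_i g (G i)) == \matrix_i g (G' i))%MS.
  have -> : col_mx (g t) (\matrix_i g (G i)) = \matrix_i g (G' i).
    apply/row_matrixP => i; rewrite rowK; apply/rowP => j; rewrite !mxE /G'.
    by case: splitP => i' _; rewrite ?mxE ?ord1.
  by rewrite submx_refl.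
have /maxn : P (\rank (\matrix_i g (G' i))) by exists (1 + m)%N, G'.
rewrite -rG => le_rank.
have sG : (\matrix_i g (G i) <= \matrix_i g (G' i))%MS.
  by rewrite -(eqmxP sub) -addsmxE addsmxSr.
have /eqmxP eG : (\matrix_i g (G i) == \matrix_i g (G' i))%MS.
  by rewrite -mxrank_leqif_eq // eqn_leq mxrankS.
by rewrite eG -(eqmxP sub) -addsmxE addsmxSl.
Qed.

Lemma rV_subspace_dim n (S : 'rV[k]_n -> Prop) : subspace S ->
  exists (m : nat) (B : 'M[k]_(m, n)),
    row_free B /\ forall x, S x <-> (x <= B)%MS.
Proof.
case=> S0 SD; have [m [G [SG spanG]]] := @spanning_subfamily k _ S n id.
pose A := \matrix_i G i; exists (\rank A), (row_base A).
split; first exact: row_base_free.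
move=> x; rewrite eq_row_base; split=> [/spanG //|/submxP[c ->]].
have -> : c *m A = \sum_i c 0 i *: G i.
  by rewrite mulmx_sum_row; apply: eq_bigr => i _; rewrite rowK.
elim/big_ind: _ => // [u v Su Sv|i _]; first by rewrite -[u]scale1r; apply: SD.
by rewrite -[_ *: _]addr0; apply: SD.
Qed.

Lemma inj_rV_leq m n (f : {linear 'rV[k]_m -> 'rV[k]_n}) :
  injective f -> (m <= n)%N.
Proof.
move=> injf; suff /eqP <- : row_free (lin1_mx f) by apply: rank_leq_col.
apply/row_freeP; apply: contrapT => noinv.
have : kermx (lin1_mx f) != 0.
  by apply: contra_notN noinv => /eqP ker0; apply/row_freeP; rewrite -kermx_eq0 ker0.
case/rowV0Pn => v /sub_kermxP; rewrite mul_rV_lin1 => fv.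
by rewrite -(inj_eq injf) fv linear0 eqxx.
Qed.

Lemma is_dim_leq H (S S' : H -> Prop) m n :
  is_dim S m -> is_dim S' n -> (forall x, S x -> S' x) -> (m <= n)%N.
Proof.
case=> f [injf fS] [f' [injf' fS']] SS'.
have [||a v v' w w' e e'|g gP] := @linear_choice _ _ _ (fun v w => f v = f' w).
- move=> v; have /fS'[w e] : S' (f v) by apply: SS'; apply/fS; exists v.
  by exists w.
- by move=> v w w' -> /injf'.
- by rewrite !linearP e e'.
by apply: (inj_rV_leq (f := g)) => v w e; apply: injf; rewrite !gP e.
Qed.

Lemma is_dim_uniq H (S : H -> Prop) m n : is_dim S m -> is_dim S n -> m = n.
Proof. by move=> Sm Sn; apply/eqP; rewrite eqn_leq !(is_dim_leq Sm Sn, is_dim_leq Sn Sm). Qed.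

Lemma fin_dim_sub H (S S' : H -> Prop) :
  fin_dim S' -> subspace S -> (forall x, S x -> S' x) -> fin_dim S.
Proof.
case=> n [f [injf fS']] [S0 SD] SS'.
have [|m [B [freeB BS]]] := @rV_subspace_dim n (fun v => S (f v)).
  by split=> [|a x y]; rewrite ?linear0 // linearP; apply: SD.
exists m, (f \o mulmxr B); split.
  move=> u v /injf /= /(congr1 (mulmxr (pinvmx B))) /=.
  by rewrite -!mulmxA mulmxVp // !mulmx1.
move=> x; split=> [Sx|[v <-]].
  have [v vx] := (fS' x).1 (SS' _ Sx); rewrite -vx in Sx *.
  by have /submxP[c ->] := (BS _).1 Sx; exists c.
by apply/BS; apply: submxMl.
Qed.

Lemma is_dim_eq H (S S' : H -> Prop) n : subspace S ->
  is_dim S n -> is_dim S' n -> (forall x, S x -> S' x) -> forall x, S' x -> S x.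
Proof.
move=> [S0 SD] Sn [f [injf fS']] SS'.
have [|m [B [freeB BS]]] := @rV_subspace_dim n (fun v => S (f v)).
  by split=> [|a x y]; rewrite ?linear0 // linearP; apply: SD.
have Sm : is_dim S m.
  exists (f \o mulmxr B); split.
    move=> u v /injf /= /(congr1 (mulmxr (pinvmx B))) /=.
    by rewrite -!mulmxA mulmxVp // !mulmx1.
  move=> x; split=> [Sx|[v <-]]; last by apply/BS; apply: submxMl.
  have [v vx] := (fS' x).1 (SS' _ Sx); rewrite -vx in Sx *.
  by have /submxP[c ->] := (BS _).1 Sx; exists c.
have e := is_dim_uniq Sm Sn; subst m.
move=> x /fS'[v <-]; apply/BS; apply: submx_full.
by rewrite row_full_unit -row_free_unit.
Qed.

(** The image of a coordinate space is finite-dimensional: restrict to a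
complement of the kernel. *)
Lemma fin_dim_image H (S : H -> Prop) n (f : {linear 'rV[k]_n -> H}) :
  (forall x, S x <-> exists v, f v = x) -> fin_dim S.
Proof.
move=> fS; have [|m [B [freeB BK]]] := @rV_subspace_dim n (fun v => f v = 0).
  by split=> [|a x y fx fy]; rewrite ?linear0 // linearP fx fy scaler0 addr0.
pose C := row_base (B^C)%MS; exists (\rank (B^C)%MS), (f \o mulmxr C); split.
  move=> u v /= fuv.
  have uvB : ((u - v) *m C <= B)%MS by apply/BK; rewrite mulmxBl linearB fuv subrr.
  have uvC : ((u - v) *m C <= B^C)%MS by rewrite -(eq_row_base B^C%MS) submxMl.
  have : ((u - v) *m C <= B :&: B^C)%MS by rewrite sub_capmx uvB uvC.
  rewrite capmx_compl submx0 => /eqP /(congr1 (mulmxr (pinvmx C))) /=.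
  rewrite -mulmxA mulmxVp ?row_base_free // mulmx1 mul0mx => /eqP.
  by rewrite subr_eq0 => /eqP.
move=> x; rewrite fS; split=> [[v <-]|[v <-]]; last by exists (v *m C).
have /sub_addsmxP[[b c] /= ->] : (v <= B + C)%MS.
  apply: submx_trans (_ : (B + B^C <= B + C)%MS).
    by apply: submx_full; apply: addsmx_compl_full.
  by rewrite addsmxS // eq_row_base.
exists c; rewrite linearD /= (_ : f (b *m B) = 0) ?add0r //.
by apply/BK; apply: submxMl.
Qed.

Definition kdim H (S : H -> Prop) : nat :=
  if pselect (fin_dim S) is left fS then sval (cid fS) else 0%N.

Lemma dimP H (S : H -> Prop) : fin_dim S -> is_dim S (kdim S).
Proof. by move=> fS; rewrite /kdim; case: pselect => // ?; case: cid. Qed.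

Lemma dim_uniq H (S : H -> Prop) n : is_dim S n -> kdim S = n.
Proof.
move=> Sn; have fS : fin_dim S by exists n.
exact: is_dim_uniq (dimP fS) Sn.
Qed.

Lemma eq_dim H (S S' : H -> Prop) : (forall x, S x <-> S' x) -> kdim S = kdim S'.
Proof.
by move=> SS'; have -> : S = S' by apply: funext => x; apply: propext.
Qed.

Lemma dim_leq H (S S' : H -> Prop) : fin_dim S' -> subspace S ->
  (forall x, S x -> S' x) -> (kdim S <= kdim S')%N.
Proof.
by move=> fS' sS SS'; apply: is_dim_leq (dimP (fin_dim_sub fS' sS SS')) (dimP fS') SS'.
Qed.

Lemma dim_eq_sub H (S S' : H -> Prop) : fin_dim S' -> subspace S ->
  (forall x, S x -> S' x) -> kdim S = kdim S' -> forall x, S' x -> S x.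
Proof.
move=> fS' sS SS' eS; have Sn : is_dim S (kdim S').
  by rewrite -eS; apply: dimP; apply: fin_dim_sub SS'.
exact: is_dim_eq sS Sn (dimP fS') SS'.
Qed.

(** Rank and nullity, for a linear map of one subspace onto another. *)
Lemma is_dim_exact H H' (g : {linear H -> H'}) (S K : H -> Prop) (S' : H' -> Prop)
    l m : subspace S ->
  (forall x, K x <-> S x /\ g x = 0) -> (forall y, S' y <-> exists2 x, S x & g x = y) ->
  is_dim K l -> is_dim S' m -> is_dim S (l + m).
Proof.
move=> [S0 SD] KE S'E [f [injf fK]] [f' [injf' fS']].
have lift (i : 'I_m) : exists x, S x /\ g x = f' (delta_mx 0 i).
  have /S'E[x Sx gx] : S' (f' (delta_mx 0 i)) by apply/fS'; exists (delta_mx 0 i).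
  by exists x.
pose b i := sval (cid (lift i)).
have Sb i : S (b i) by rewrite /b; case: cid => x [].
have gb i : g (b i) = f' (delta_mx 0 i) by rewrite /b; case: cid => x [].
have lin_s : linear (fun v : 'rV[k]_m => \sum_i v 0 i *: b i).
  move=> a u v; rewrite scaler_sumr -big_split; apply: eq_bigr => i _ /=.
  by rewrite !mxE scalerDl scalerA.
pose s := lin_of lin_s.
have gs v : g (s v) = f' v.
  rewrite {2}[v]row_sum_delta linear_sum linear_sum; apply: eq_bigr => i _ /=.
  by rewrite !linearZ gb.
have Ss v : S (s v).
  rewrite /s /=; elim/big_ind: _ => // [x y Sx Sy|i _].
    by rewrite -[x]scale1r; apply: SD.
  by rewrite -[_ *: _]addr0; apply: SD.
have lin_F : linear (fun v : 'rV[k]_(l + m) => f (lsubmx v) + s (rsubmx v)).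
  by move=> a u v; rewrite !linearP scalerDr addrACA.
exists (lin_of lin_F); split.
  move=> u v /= e.
  have gf w : g (f w) = 0.
    have Kw : K (f w) by apply/fK; exists w.
    by have [] := (KE _).1 Kw.
  have er : rsubmx u = rsubmx v.
    by apply: injf'; rewrite -!gs; have := congr1 g e; rewrite !linearD !gf !add0r.
  have el : lsubmx u = lsubmx v by apply: injf; move: e; rewrite er => /addIr.
  by rewrite -[u]hsubmxK -[v]hsubmxK el er.
move=> x; split=> [Sx|[v <-]] /=.
  have /fS'[w fw] : S' (g x) by apply/S'E; exists x.
  have /fK[v fv] : K (x - s w).
    apply/KE; split; last by rewrite linearB gs fw subrr.
    by rewrite addrC -scaleN1r; apply: SD.
  by exists (row_mx v w); rewrite row_mxKl row_mxKr fv subrK.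
have Kv : K (f (lsubmx v)) by apply/fK; exists (lsubmx v).
rewrite -[f _]scale1r; apply: SD; last exact: Ss.
by have [] := (KE _).1 Kv.
Qed.

Lemma dim_exact H H' (g : {linear H -> H'}) (S K : H -> Prop) (S' : H' -> Prop) :
  subspace S -> fin_dim S ->
  (forall x, K x <-> S x /\ g x = 0) -> (forall y, S' y <-> exists2 x, S x & g x = y) ->
  kdim S = (kdim K + kdim S')%N.
Proof.
move=> sS fS KE S'E.
have fK : fin_dim K.
  apply: (fin_dim_sub fS) => [|x /KE[]] //; have [S0 SD] := sS; split.
    by apply/KE; rewrite linear0.
  move=> a x y /KE[Sx gx] /KE[Sy gy]; apply/KE; split; first exact: SD.
  by rewrite linearP gx gy scaler0 addr0.
have fS' : fin_dim S'.
  have [n [f [_ fE]]] := fS; apply: (fin_dim_image (f := g \o f)) => y.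
  rewrite S'E; split=> [[x /fE[v <-] <-]|[v <-]]; first by exists v.
  by exists (f v) => //; apply/fE; exists v.
by apply: dim_uniq; apply: is_dim_exact KE S'E (dimP fK) (dimP fS').
Qed.

Lemma dim0 H (S : H -> Prop) : fin_dim S -> kdim S = 0%N ->
  forall x, S x -> x = 0.
Proof.
move=> fS d0 x; have [f [_ fE]] := dimP fS; rewrite d0 in f fE *.
by move=> /fE[v <-]; rewrite thinmx0 linear0.
Qed.

Lemma dim_zero H (S : H -> Prop) : (forall x, S x <-> x = 0) -> kdim S = 0%N.
Proof.
move=> S0; apply: dim_uniq; exists \0; split=> [u v _|x].
  by rewrite thinmx0 [v]thinmx0.
by rewrite S0; split=> [->|[v <-]] //; exists 0.
Qed.

End Dimension.

Section DimensionFormulas.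
Variables (k : fieldType).
Implicit Types H : lmodType k.

Lemma dim_inj H H' (g : {linear H -> H'}) (S : H -> Prop) (S' : H' -> Prop) :
  subspace S -> fin_dim S -> (forall x, S x -> g x = 0 -> x = 0) ->
  (forall y, S' y <-> exists2 x, S x & g x = y) -> kdim S = kdim S'.
Proof.
move=> sS fS injg S'E; rewrite (dim_exact (K := fun x => x = 0) sS fS _ S'E).
  by rewrite dim_zero.
by move=> x; split=> [->|[]]; [split; [case: sS|rewrite linear0]|exact: injg].
Qed.

Lemma is_dim_prod H H' (S1 : H -> Prop) (S2 : H' -> Prop) n1 n2 :
  is_dim S1 n1 -> is_dim S2 n2 ->
  is_dim (fun x : H * H' => S1 x.1 /\ S2 x.2) (n1 + n2).
Proof.
case=> f1 [i1 f1E] [f2 [i2 f2E]].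
have lin_F : linear (fun v : 'rV[k]_(n1 + n2) => (f1 (lsubmx v), f2 (rsubmx v))).
  by move=> a u v; apply: injective_projections => /=; rewrite !linearP.
exists (lin_of lin_F); split.
  move=> u v /= [/i1 e1 /i2 e2].
  by rewrite -[u]hsubmxK -[v]hsubmxK e1 e2.
move=> [x y]; split=> /= [[/f1E[v <-] /f2E[w <-]]|[v [<- <-]]].
  by exists (row_mx v w); rewrite row_mxKl row_mxKr.
by split; [apply/f1E; exists (lsubmx v)|apply/f2E; exists (rsubmx v)].
Qed.

(** [S1 / K1] and [S3 / S2] are isomorphic when [S3 = g(S1) + S2] and [K1] is the
part of [S1] that [g] sends into [S2]. *)
Lemma dim_quotient H H' (g : {linear H -> H'}) (S1 K1 : H -> Prop)
    (S2 S3 : H' -> Prop) :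
  subspace S1 -> fin_dim S1 -> subspace S2 -> fin_dim S2 ->
  (forall x, K1 x <-> S1 x /\ S2 (g x)) ->
  (forall z, S3 z <-> exists x y, [/\ S1 x, S2 y & g x + y = z]) ->
  (kdim S1 + kdim S2 = kdim K1 + kdim S3)%N.
Proof.
move=> [S10 S1D] fS1 [S20 S2D] fS2 K1E S3E.
pose S (x : H * H') := S1 x.1 /\ S2 x.2.
have sS : subspace S.
  by split=> [//|a x y [x1 x2] [y1 y2]]; split; [apply: S1D|apply: S2D].
have dS := is_dim_prod (dimP fS1) (dimP fS2).
have S2N y : S2 y -> S2 (- y) by move=> Sy; rewrite -[- y]addr0 -scaleN1r; apply: S2D.
pose G : {linear (H * H')%type -> H'} := (g \o fst) \+ snd.
pose K x := S x /\ G x = 0.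
have fS : fin_dim S by exists (kdim S1 + kdim S2)%N.
rewrite -(dim_uniq dS) (@dim_exact _ _ _ G S K S3 sS fS) //; last first.
  move=> z; rewrite S3E; split=> [[x [y [Sx Sy e]]]|[[x y] [/= Sx Sy] e]].
    by exists (x, y).
  by exists x, y.
congr (_ + _)%N.
apply: (@dim_inj _ _ (fst : {linear (H * H')%type -> H})).
- split=> [|a x y [Sx x0] [Sy y0]]; first by split; [case: sS|rewrite linear0].
  by split; [case: sS => _; apply|rewrite linearP x0 y0 scaler0 addr0].
- apply: (fin_dim_sub fS) => [|x []] //.
  split=> [|a x y [Sx x0] [Sy y0]]; first by split; [case: sS|rewrite linear0].
  by split; [case: sS => _; apply|rewrite linearP x0 y0 scaler0 addr0].
- move=> [x y] [_ /= e] /= x0; rewrite x0 lin0 add0r in e *.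
  by rewrite e.
- move=> x; rewrite K1E; split=> [[Sx Sgx]|[[x' y] [[/= Sx Sy] e] <-]].
    exists (x, - g x) => //; split; first by split=> //=; apply: S2N.
    by rewrite /= subrr.
  split=> //; have -> : g x' = - y by apply/eqP; rewrite -addr_eq0; apply/eqP.
  exact: S2N.
Qed.

Lemma fin_dim_ffun H n :
  fin_dim (fun _ : H => True) -> fin_dim (fun _ : {ffun 'I_n -> H} => True).
Proof.
case=> d [f [_ fE]].
have lin_F : linear (fun v : 'rV[k]_(n * d) => [ffun i => f (row i (vec_mx v))]).
  by move=> a u v; apply/ffunP => i; rewrite !ffunE !linearP.
apply: (fin_dim_image (f := lin_of lin_F)) => x; split=> // _.
have pre i : exists v, f v = x i by apply/fE.
exists (mxvec (\matrix_i sval (cid (pre i)))); apply/ffunP => i.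
by rewrite ffunE mxvecK rowK; case: cid.
Qed.

End DimensionFormulas.

(** * Modules over a finite-dimensional algebra *)

Section RestrictScalars.
Variables (k : fieldType) (Lambda : falgType k) (M : lmodType Lambda).

Definition kscale (a : k) (x : M) : M := a%:A *: x.

Lemma kscaleA a b x : kscale a (kscale b x) = kscale (a * b) x.
Proof. by rewrite /kscale scalerA -scalerAl mul1r scalerA. Qed.
Lemma kscale1 : left_id 1 kscale.
Proof. by move=> x; rewrite /kscale scale1r scale1r. Qed.
Lemma kscaleDr : right_distributive kscale +%R.
Proof. by move=> a x y; rewrite /kscale scalerDr. Qed.
Lemma kscaleDl x : {morph kscale^~ x : a b / a + b}.
Proof. by move=> a b; rewrite /kscale !scalerDl. Qed.

Definition kmod : Type := M.
HB.instance Definition _ := GRing.Zmodule.copy kmod M.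
HB.instance Definition _ := GRing.Zmodule_isLmodule.Build k kmod
  kscaleA kscale1 kscaleDr kscaleDl.

Lemma kscaleE (a : k) (x : kmod) : a *: x = a%:A *: (x : M).
Proof. by []. Qed.

Lemma kscaleC (a : k) (b : Lambda) (x : M) :
  a *: ((b *: x : M) : kmod) = b *: ((a *: (x : kmod) : kmod) : M).
Proof. by rewrite !kscaleE !scalerA mulr_algl mulr_algr. Qed.

Definition submod (U : M -> Prop) : Prop :=
  U 0 /\ forall a x y, U x -> U y -> U (a *: x + y).

Lemma submod_subspace (U : M -> Prop) : submod U -> @subspace _ kmod U.
Proof. by case=> U0 UD; split=> // a x y Ux Uy; apply: (UD a%:A). Qed.

Lemma submodT : submod (fun=> True). Proof. by []. Qed.

Lemma submodD (U : M -> Prop) x y : submod U -> U x -> U y -> U (x + y).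
Proof. by move=> [U0 UD] Ux Uy; rewrite -[x]scale1r; apply: UD. Qed.

Lemma fg_fin_dim : finitely_generated M -> fin_dim (fun _ : kmod => True).
Proof.
case=> n [e eM]; pose d := \dim (fullv : {vspace Lambda}).
pose b := vbasis (fullv : {vspace Lambda}).
have lin_f : linear (fun v : 'rV[k]_(n * d) =>
    \sum_i (\sum_j (vec_mx v) i j *: b`_j : Lambda) *: e i : kmod).
  move=> a u v; rewrite scaler_sumr -big_split; apply: eq_bigr => i _.
  have key (l m : Lambda) (x : M) :
      (a *: l + m) *: x = a *: (l *: x : kmod) + m *: x :> M.
    by rewrite scalerDl; congr (_ + _); rewrite kscaleE scalerA mulr_algl.
  apply: etrans _ (key _ _ _); congr (_ *: _).
  rewrite scaler_sumr -big_split; apply: eq_bigr => j _ /=.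
  by rewrite linearP !mxE scalerDl scalerA.
apply: (fin_dim_image (f := lin_of lin_f)) => x; split=> // _.
have [c ->] := eM x; exists (mxvec (\matrix_(i, j) coord b j (c i))) => /=.
apply: eq_bigr => i _.
suff cE : \sum_j (vec_mx (mxvec (\matrix_(i, j) coord b j (c i)))) i j *: b`_j = c i.
  by rewrite cE.
rewrite [RHS](coord_vbasis (memvf (c i))); apply: eq_bigr => j _.
by rewrite mxvecK mxE.
Qed.

End RestrictScalars.

Section Klinear.
Variables (k : fieldType) (Lambda : falgType k) (M N : lmodType Lambda).

Lemma klin_linear (f : {linear M -> N}) :
  linear ((f : M -> N) : kmod M -> kmod N).
Proof. by move=> a x y; rewrite [LHS]linearP. Qed.

Definition klin (f : {linear M -> N}) : {linear kmod M -> kmod N} :=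
  lin_of (klin_linear f).

Lemma kcomb_linear (a : k) (f g : {linear M -> N}) :
  linear (fun x => (a *: (f x : kmod N) : kmod N) + g x : N).
Proof.
move=> b x y; rewrite !linearP scalerDr scalerDr -addrACA; congr (_ + _).
by congr (_ + _); rewrite -kscaleC.
Qed.

End Klinear.

(** * Spaces of homomorphisms *)

Section Homs.
Variables (k : fieldType) (Lambda : falgType k).
Variables (P : lmodType Lambda) (fgP : finitely_generated P).
Implicit Types A : lmodType Lambda.

Definition gen_num : nat := sval (cid fgP).
Definition gen : 'I_gen_num -> P := sval (cid (svalP (cid fgP))).

Lemma gen_span x : exists c : 'I_gen_num -> Lambda, x = \sum_i c i *: gen i.
Proof. by rewrite /gen; case: (cid (svalP (cid fgP))) => e /=; apply. Qed.

Lemma gen_ext A (f g : {linear P -> A}) :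
  (forall i, f (gen i) = g (gen i)) -> forall x, f x = g x.
Proof.
move=> fg x; have [c ->] := gen_span x; rewrite !linear_sum.
by apply: eq_bigr => i _; rewrite !linZ fg.
Qed.

(** Homomorphisms with values in [U], recorded by their values on the chosen
generators so that they form a subspace of a vector space. *)
Definition homs A (U : A -> Prop) (a : {ffun 'I_gen_num -> kmod A}) : Prop :=
  exists f : {linear P -> A}, (forall i, a i = f (gen i)) /\ forall x, U (f x).

Definition hdim A (U : A -> Prop) : nat := kdim (homs U).

Lemma homs_subspace A (U : A -> Prop) : submod U -> subspace (homs U).
Proof.
move=> sU; have [U0 UD] := sU; split.
  by exists \0; split=> [i|x]; rewrite ?ffunE.
move=> a u v [f [fE fU]] [g [gE gU]].
exists (lin_of (kcomb_linear a f g)); split=> [i|x]; last exact: UD.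
by rewrite !ffunE fE gE.
Qed.

Lemma homs_fin_dim A (U : A -> Prop) :
  finitely_generated A -> submod U -> fin_dim (homs U).
Proof.
move=> fgA sU; have fT := fin_dim_ffun gen_num (fg_fin_dim fgA).
by apply: (fin_dim_sub fT) => //; apply: homs_subspace.
Qed.

(** Homomorphisms out of a finitely generated module are combinations of
finitely many. *)
Lemma hom_span A : finitely_generated A ->
  exists (m : nat) (F : 'I_m -> {linear P -> A}),
    forall f : {linear P -> A}, exists c : 'I_m -> k,
      forall x, f x = \sum_i (c i)%:A *: F i x.
Proof.
move=> fgA; have [m [phi [_ phiE]]] := homs_fin_dim fgA (submodT A).
have ex (i : 'I_m) : homs (fun=> True) (phi (delta_mx 0 i)).
  by apply/phiE; exists (delta_mx 0 i).
exists m, (fun i => sval (cid (ex i))) => f.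
have [v vE] : exists v, phi v = [ffun i => f (gen i) : kmod A].
  by apply/phiE; exists f; split=> // i; rewrite ffunE.
exists (fun i => v 0 i).
have lin_g : linear (fun x => \sum_i (v 0 i)%:A *: sval (cid (ex i)) x).
  move=> a x y; rewrite scaler_sumr -big_split; apply: eq_bigr => i _ /=.
  by rewrite linearP scalerDr !scalerA mulr_algl mulr_algr.
apply: (gen_ext (g := lin_of lin_g)) => j /=.
have := congr1 (fun u : {ffun 'I_gen_num -> kmod A} => u j) vE.
rewrite ffunE => <-; rewrite {1}[v]row_sum_delta linear_sum sum_ffunE.
apply: eq_bigr => i _; rewrite linearZ ffunE kscaleE; congr (_ *: _).
by case: cid => g [/= gE _]; rewrite gE.
Qed.

End Homs.

Section HomExact.
Variables (k : fieldType) (Lambda : falgType k).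

Lemma post_linear (A A' : lmodType Lambda) n (g : {linear A -> A'}) :
  linear (fun a : {ffun 'I_n -> kmod A} => [ffun i => g (a i) : kmod A']).
Proof.
move=> c u v; apply/ffunP => i; rewrite !ffunE; exact: (linearP (klin g)).
Qed.

(** The dimension of [Hom(P, U / V)] depends only on the subquotient [U / V] up
to isomorphism, as [P] is projective; quotients are not formed, the dimension
is read off as a difference. *)
Lemma hdim_subquotient (P : lmodType Lambda) (fgP : finitely_generated P)
    (A A' : lmodType Lambda) (g : {linear A -> A'})
    (U V : A -> Prop) (U' V' : A' -> Prop) :
  projective P -> finitely_generated A -> finitely_generated A' ->
  submod U -> submod V' -> submod U' ->
  (forall x, U x -> U' (g x)) -> (forall x, V' x -> U' x) ->
  (forall x, V x <-> U x /\ V' (g x)) ->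
  (forall y, U' y -> exists2 x, U x & V' (y - g x)) ->
  (hdim fgP U + hdim fgP V' = hdim fgP V + hdim fgP U')%N.
Proof.
move=> prP fgA fgA' sU sV' sU' gU VU' VE sur.
rewrite /hdim.
apply: (@dim_quotient _ _ _ (lin_of (post_linear (n:=gen_num fgP) g))
  (homs (fgP:=fgP) U) (homs (fgP:=fgP) V) (homs (fgP:=fgP) V') (homs (fgP:=fgP) U')).
- exact: homs_subspace.
- exact: homs_fin_dim.
- exact: homs_subspace.
- exact: homs_fin_dim.
- move=> a; split=> [[f [aE fV]]|[[f [aE fU]] [f' [gaE fV']]]].
    split; first by exists f; split=> // x; have [] := (VE (f x)).1 (fV x).
    exists (g \o f); split=> [i|x /=]; first by rewrite /= ffunE aE.
    by have [] := (VE (f x)).1 (fV x).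
  exists f; split=> // x; apply/VE; split=> //.
  suff -> : g (f x) = f' x by [].
  apply: (gen_ext (fgP := fgP) (f := g \o f)) => i.
  by rewrite /= -gaE /= ffunE aE.
- move=> z; split=> [[f [zE fU]]|[a [b [[f [aE fU]] [f' [bE fV]] <-]]]].
    have [|a x y m n [m1 m2] [n1 n2]|x|h hP] := @projective_select _ _ _
      (fun x m => U m /\ V' (f x - g m)) fgP prP.
    - split; first by case: sU.
      have -> : f 0 - g 0 = 0 by label.
      by case: sV'.
    - split; first by case: sU => _; apply.
      have -> : f (a *: x + y) - g (a *: m + n)
              = a *: (f x - g m) + (f y - g n) by label.
      by case: sV' => _; apply.
    - by have [m Um Vm] := sur (f x) (fU x); exists m.
    exists [ffun i => h (gen (fgP:=fgP) i)], [ffun i => f (gen (fgP:=fgP) i) - g (h (gen (fgP:=fgP) i))].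
    split.
    + by exists h; split=> [i|x]; [rewrite ffunE|case: (hP x)].
    + exists (f \- (g \o h)); split=> [i|x]; first by rewrite ffunE.
      by case: (hP x).
    + by apply/ffunP => i; rewrite !ffunE zE addrC subrK.
  exists ((g \o f) \+ f'); split=> [i|x] /=.
    by rewrite !ffunE aE bE.
  by apply: submodD => //; [apply: gU|apply: VU'].
Qed.

(** Precomposition with [d] embeds [Hom(P0, A / K)] into [Hom(P1, A / K)] when it
is injective; comparing dimensions then decides surjectivity. *)
Lemma hdim_precompose (P0 P1 : lmodType Lambda) (fg0 : finitely_generated P0)
    (fg1 : finitely_generated P1) (d : {linear P1 -> P0})
    (A : lmodType Lambda) (K : A -> Prop) :
  finitely_generated A -> submod K ->
  (forall g : {linear P0 -> A}, (forall x, K (g (d x))) -> forall y, K (g y)) ->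
  (hdim fg0 (fun _ : A => True) + hdim fg1 K
     = hdim fg0 K + hdim fg1 (fun _ : A => True))%N <->
  forall u : {linear P1 -> A}, exists t : {linear P0 -> A},
    forall x, K (u x - t (d x)).
Proof.
move=> fgA sK inj.
have ex (j : 'I_(gen_num fg1)) := gen_span fg0 (d (gen j)).
pose c j := sval (cid (ex j)).
have cE j : d (gen j) = \sum_i c j i *: gen (fgP:=fg0) i by rewrite /c; case: cid.
have lin_G : linear (fun a : {ffun 'I_(gen_num fg0) -> kmod A} =>
    [ffun j => (\sum_i c j i *: (a i : A)) : kmod A]).
  move=> b u v; apply/ffunP => j; rewrite !ffunE scaler_sumr -big_split.
  apply: eq_bigr => i _ /=; rewrite !ffunE kscaleC.
  exact: (@scalerDr Lambda A (c j i) (b *: u i) (v i)).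
have GE (a : {ffun 'I_(gen_num fg0) -> kmod A}) (f : {linear P0 -> A}) :
    (forall i, a i = f (gen i)) -> forall j, lin_of lin_G a j = f (d (gen j)).
  move=> aE j; rewrite /= ffunE cE linear_sum; apply: eq_bigr => i _.
  by rewrite aE linZ.
pose S (z : {ffun 'I_(gen_num fg1) -> kmod A}) :=
  exists (u : {linear P1 -> A}) (t : {linear P0 -> A}),
    (forall j, z j = u (gen j)) /\ forall x, K (u x - t (d x)).
have SE : (hdim fg0 (fun _ : A => True) + hdim fg1 K = hdim fg0 K + kdim S)%N.
  rewrite /hdim.
  apply: (@dim_quotient _ _ _ (lin_of lin_G) (homs (fgP:=fg0) (fun=> True))
    (homs (fgP:=fg0) K) (homs (fgP:=fg1) K) S).
  - exact: homs_subspace.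
  - exact: homs_fin_dim.
  - exact: homs_subspace.
  - exact: homs_fin_dim.
  - move=> a; split=> [[f [aE fK]]|[[f [aE _]] [f' [gaE fV']]]].
      split; first by exists f.
      by exists (f \o d); split=> [i|x]; [rewrite (GE _ f)|apply: fK].
    exists f; split=> //; apply: inj => x.
    suff -> : f (d x) = f' x by [].
    by apply: (gen_ext (fgP := fg1) (f := f \o d)) => i; rewrite -gaE (GE _ f).
  - move=> z; split=> [[u [t [zE utK]]]|[a [b [[f [aE _]] [f' [bE fK]] <-]]]].
      exists [ffun i => t (gen i)], [ffun i => u (gen i) - t (d (gen i))].
      split.
      + by exists t; split=> // i; rewrite ffunE.
      + by exists (u \- (t \o d)); split=> [i|x]; [rewrite ffunE|apply: utK].
      + apply/ffunP => j; rewrite ffunE (GE _ t) => [|i]; rewrite ffunE //.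
        by rewrite zE addrC subrK.
    exists ((f \o d) \+ f'), f; split=> [j|x] /=.
      by rewrite ffunE (GE _ f) // bE.
    by rewrite addrC addKr.
have sS : subspace S.
  split.
    exists \0, \0; split=> [j|x]; first by rewrite ffunE.
    by rewrite /= subrr; case: sK.
  move=> a z z' [u [t [zE utK]]] [u' [t' [zE' utK']]].
  exists (lin_of (kcomb_linear a u u')), (lin_of (kcomb_linear a t t')).
  split=> [j|x] /=; first by rewrite !ffunE zE zE'.
  have -> : (a *: (u x : kmod A) : A) + u' x - ((a *: (t (d x) : kmod A) : A) + t' (d x))
    = a%:A *: (u x - t (d x)) + (u' x - t' (d x)) by rewrite !kscaleE; label.
  by case: sK => _; apply.
have Ssub z : S z -> homs (fgP:=fg1) (fun _ : A => True) z.
  by case=> u [t [zE _]]; exists u.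
have fH := homs_fin_dim fg1 fgA (submodT A).
rewrite SE; split=> [/addnI eS u|sur].
  have [|u' [t [uE utK]]] := dim_eq_sub fH sS Ssub eS (x := [ffun j => u (gen j) : kmod A]).
    by exists u; split=> // j; rewrite ffunE.
  exists t => x; rewrite (_ : u x = u' x) //.
  by apply: (gen_ext (fgP := fg1)) => j; rewrite -uE ffunE.
congr (_ + _)%N; apply: eq_dim => z; split; first exact: Ssub.
by case=> u [zE _]; have [t utK] := sur u; exists u, t.
Qed.

End HomExact.

(** * Simple subquotients *)

Section SimpleSubquotients.
Variables (k : fieldType) (Lambda : falgType k).
Implicit Types A : lmodType Lambda.

Definition incl A (V U : A -> Prop) : Prop := forall x, V x -> U x.

Definition simple_pair A (V U : A -> Prop) : Prop :=
  [/\ submod V, submod U, incl V U, ~ incl U V &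
      forall W, submod W -> incl V W -> incl W U -> incl W V \/ incl U W].

(** A property of pairs of submodules that holds for simple subquotients and is
compatible with refinement holds for all pairs, by induction on the dimension
of the subquotient. *)
Lemma devissage A (Q : (A -> Prop) -> (A -> Prop) -> Prop) :
  finitely_generated A ->
  (forall V U, submod V -> submod U -> incl V U -> incl U V -> Q V U) ->
  (forall V U, simple_pair V U -> Q V U) ->
  (forall V W U, submod V -> submod W -> submod U -> incl V W -> incl W U ->
     Q V W -> Q W U -> Q V U) ->
  forall V U, submod V -> submod U -> incl V U -> Q V U.
Proof.
move=> fgA Q0 Qs QD.
have fT := fg_fin_dim fgA.
have fin (U : A -> Prop) : submod U -> @fin_dim _ (kmod A) U.
  by move=> sU; apply: (fin_dim_sub fT) => //; apply: submod_subspace.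
have lt_dim (V U : A -> Prop) : submod V -> submod U -> incl V U -> ~ incl U V ->
    (@kdim _ (kmod A) V < @kdim _ (kmod A) U)%N.
  move=> sV sU VU nUV; rewrite ltn_neqAle; apply/andP; split; last first.
    by apply: dim_leq (fin _ sU) (submod_subspace sV) VU.
  apply/eqP => e; apply: nUV.
  exact: dim_eq_sub (fin _ sU) (submod_subspace sV) VU e.
suff main n V U : submod V -> submod U -> incl V U ->
    (@kdim _ (kmod A) U <= @kdim _ (kmod A) V + n)%N -> Q V U.
  by move=> V U sV sU VU; apply: (main (@kdim _ (kmod A) U)) => //; rewrite leq_addl.
elim: n V U => [|n IH] V U sV sU VU le_n.
  apply: Q0 => //; apply: contrapT => nUV.
  by have := lt_dim _ _ sV sU VU nUV; rewrite ltnNge; rewrite addn0 in le_n; rewrite le_n.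
have [UV|nUV] := pselect (incl U V); first exact: Q0.
have [simpleVU|] := pselect (forall W, submod W -> incl V W -> incl W U ->
  incl W V \/ incl U W); first exact: Qs.
move=> /existsNP[W /not_implyP[sW /not_implyP[VW /not_implyP[WU /not_orP[nWV nUW]]]]].
have ltVW := lt_dim _ _ sV sW VW nWV; have ltWU := lt_dim _ _ sW sU WU nUW.
apply: (QD V W U) => //; apply: IH => //.
  by rewrite -ltnS (leq_trans ltWU) // -addnS.
rewrite (leq_trans le_n) // -addSnnS leq_add2r; exact: ltVW.
Qed.

Section Regular.
Local Notation Reg := (Lambda^o : lmodType Lambda).
Local Notation everything := (fun _ : Reg => True).

Lemma regular_fg : finitely_generated Reg.
Proof.
exists 1%N, (fun=> 1) => x; exists (fun=> x).
by rewrite big_ord_recl big_ord0 addr0 -[LHS]mulr1.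
Qed.

Definition hdiff (P : lmodType Lambda) (fgP : finitely_generated P) A
  (V U : A -> Prop) : rat := (hdim fgP U)%:R - (hdim fgP V)%:R.

Lemma hdiff_eq (P : lmodType Lambda) (fgP : finitely_generated P) A A'
    (V U : A -> Prop) (V' U' : A' -> Prop) :
  (hdim fgP U + hdim fgP V' = hdim fgP V + hdim fgP U')%N ->
  hdiff fgP V U = hdiff fgP V' U'.
Proof.
move=> /(congr1 (fun n : nat => n%:R : rat)); rewrite !natrD => e.
by apply: (eq_of_eq e); rewrite /hdiff; abel.
Qed.

Definition same_hdiff A A' (V U : A -> Prop) (V' U' : A' -> Prop) : Prop :=
  forall (P : lmodType Lambda) (fgP : finitely_generated P), projective P ->
  hdiff fgP V U = hdiff fgP V' U'.

(** A simple module is a quotient of the algebra by a maximal left ideal. *)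
Lemma simple_pair_maximal A (V U : A -> Prop) :
  finitely_generated A -> simple_pair V U ->
  exists m : Reg -> Prop, simple_pair m everything /\ same_hdiff V U m everything.
Proof.
move=> fgA [sV sU VU nUV simple].
have [v /not_implyP[Uv nVv]] := (existsNP _).2 nUV.
have lin_g : linear (fun l : Reg => l *: v : A).
  by move=> a x y; rewrite scalerDl scalerA.
pose m (l : Reg) := V ((l : Lambda) *: v).
have sm : submod m.
  split; first by rewrite /m scale0r; case: sV.
  by move=> a x y mx my; rewrite /m [_ *: v]lin_g; case: sV => _; apply.
have sUv l : U (l *: v) by rewrite -[_ *: v]addr0; case: sU => ? ; apply.
have split_ideal W : submod W -> incl m W -> incl W m \/ W 1.
  move=> sW mW; pose W' y := U y /\ exists l : Reg, W l /\ V (y - (l : Lambda) *: v).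
  have sW' : submod W'.
    split.
      split; first by case: sU.
      exists 0; rewrite scale0r subr0.
      by split; [case: sW|case: sV].
    move=> a x y [Ux [l [Wl Vl]]] [Uy [l' [Wl' Vl']]]; split.
      by case: sU => _; apply.
    exists (a *: l + l'); split; first by case: sW => _; apply.
    rewrite [(_ : Lambda) *: v]lin_g.
    have -> : a *: x + y - (a *: ((l : Lambda) *: v) + (l' : Lambda) *: v)
       = a *: (x - (l : Lambda) *: v) + (y - (l' : Lambda) *: v) by label.
    by case: sV => _; apply.
  have [|y [] //|W'V|UW'] := simple W' sW'.
  - move=> y Vy; split; first exact: VU.
    by exists 0; rewrite scale0r subr0; split=> //; case: sW.
  - left=> l Wl; apply: W'V; split; first exact: sUv.
    exists l; split=> //; rewrite subrr; by case: sV.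
  - right; have [_ [l [Wl Vl]]] := UW' v Uv.
    rewrite -(subrK l 1); apply: submodD => //; apply: mW.
    by rewrite /m scalerBl scale1r.
exists m; split.
  split=> //.
    by move=> /(_ 1 I); rewrite /m scale1r.
  move=> W sW mW _; have [] := split_ideal W sW mW; first by left.
  by right=> x _; rewrite -[x]mulr1 -[_ * 1]addr0; case: sW => ?; apply.
move=> P fgP prP; apply: esym; apply: hdiff_eq.
apply: (hdim_subquotient fgP (g := lin_of lin_g)) => //; first exact: regular_fg.
- by move=> x _; apply: sUv.
- by move=> x; split=> [mx|[_ Vx]]; [split|exact: Vx].
- move=> y Uy; pose W y := U y /\ exists l : Reg, V (y - (l : Lambda) *: v).
  have sW : submod W.
    split; first by split; [case: sU|exists 0; rewrite scale0r subr0; case: sV].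
    move=> a x z [Ux [l Vl]] [Uz [l' Vl']]; split; first by case: sU => _; apply.
    exists (a *: l + l'); rewrite [(_ : Lambda) *: v]lin_g.
    have -> : a *: x + z - (a *: ((l : Lambda) *: v) + (l' : Lambda) *: v)
       = a *: (x - (l : Lambda) *: v) + (z - (l' : Lambda) *: v) by label.
    by case: sV => _; apply.
  have [|x [] //|WV|UW] := simple W sW.
  - by move=> x Vx; split; [apply: VU|exists 0; rewrite scale0r subr0].
  - case: nVv; apply: WV; split=> //; exists 1; rewrite scale1r subrr.
    by case: sV.
  - by have [_ [l Vl]] := UW y Uy; exists l.
Qed.

(** Every simple module occurs in a composition series of the algebra, so up to
isomorphism there are finitely many. *)
Lemma finitely_many_simples :
  exists L : seq ((Reg -> Prop) * (Reg -> Prop)),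
  forall m, simple_pair m everything ->
    exists2 i, (i < size L)%N &
    forall d, same_hdiff m everything (nth d L i).1 (nth d L i).2.
Proof.
pose Q (V U : Reg -> Prop) := exists L : seq ((Reg -> Prop) * (Reg -> Prop)),
  forall m, simple_pair m everything -> incl V m -> ~ incl U m ->
    exists2 i, (i < size L)%N &
    forall d, same_hdiff m everything (nth d L i).1 (nth d L i).2.
have [||||||L LP] := @devissage Reg Q regular_fg _ _ _ (fun x => x = 0) everything.
- move=> V U sV sU VU UV; exists [::] => m _ Vm nUm; case: nUm => x /UV; exact: Vm.
- move=> V U [sV sU VU nUV simple]; exists [:: (V, U)] => m [sm _ _ nm maxm] Vm nUm.
  exists 0%N => // d P fgP prP; apply: esym; apply: hdiff_eq.
  apply: (hdim_subquotient fgP (g := idfun)) => //; try exact: regular_fg.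
    move=> x; split=> [Vx|[Ux mx]]; first by split; [apply: VU|apply: Vm].
    have [||y [] //|WV|UW] := simple (fun x => U x /\ m x).
    + split; first by split; [case: sU|case: sm].
      by move=> a y z [Uy my] [Uz mz]; split; [case: sU|case: sm] => _; apply.
    + by move=> y Vy; split; [apply: VU|apply: Vm].
    + by apply: WV.
    + by case: nUm => y /UW[].
  move=> y _.
  have [|||WV|UW] := maxm (fun x => exists2 z, U z & m (x - z)).
  + split; first by exists 0; rewrite ?subr0; [case: sU|case: sm].
    move=> a x z [x' Ux' mx] [z' Uz' mz]; exists (a *: x' + z').
      by case: sU => _; apply.
    have -> : a *: x + z - (a *: x' + z') = a *: (x - x') + (z - z') by label.
    by case: sm => _; apply.
  + by move=> x mx; exists 0; rewrite ?subr0 //; case: sU.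
  + by [].
  + by case: nUm => x Ux; apply: WV; exists x; rewrite ?subrr //; case: sm.
  + exact: UW.
- move=> V W U _ _ _ VW WU [L1 LP1] [L2 LP2]; exists (L1 ++ L2) => m sm Vm nUm.
  have [Wm|nWm] := pselect (incl W m).
    have [i lt_i iP] := LP2 m sm Wm nUm.
    exists (size L1 + i)%N; first by rewrite size_cat ltn_add2l.
    by move=> d; rewrite nth_cat ltnNge leq_addr /= addKn; apply: iP.
  have [i lt_i iP] := LP1 m sm Vm nWm.
  exists i; first by rewrite size_cat ltn_addr.
  by move=> d; rewrite nth_cat lt_i; apply: iP.
- by split=> // a x y -> ->; rewrite scaler0 addr0.
- by [].
- by [].
exists L => m sm; apply: LP => //; case: sm => [sm _ _ nm _].
  by move=> x ->; case: sm.
by move=> Tm; apply: nm.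
Qed.

(** The dimension of [Hom(P, U / V)] is the sum, over the simple modules, of their
multiplicities in [U / V] times a number that depends on [P] only: these
numbers are the coordinates of the class of [P] in the Grothendieck group. *)
Lemma hdiff_class :
  exists (r : nat) (cl : forall P : lmodType Lambda, finitely_generated P -> 'rV[rat]_r),
  forall A (V U : A -> Prop), finitely_generated A ->
    submod V -> submod U -> incl V U ->
    exists x : 'cV[rat]_r, forall P (fgP : finitely_generated P), projective P ->
      hdiff fgP V U = (cl P fgP *m x) 0 0.
Proof.
have [L LP] := finitely_many_simples.
pose d : (Reg -> Prop) * (Reg -> Prop) := (fun=> False, fun=> False).
exists (size L), (fun P fgP => \row_i hdiff fgP (nth d L i).1 (nth d L i).2).
move=> A V U fgA; move: V U; apply: devissage => //.
- move=> V U sV sU VU UV; exists 0 => P fgP prP; rewrite mulmx0 mxE.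
  apply/eqP; rewrite subr_eq0; apply/eqP; congr (_%:R).
  apply: eq_dim => a; split=> -[f [aE fU]]; exists f; split=> // x.
    exact: UV.
  exact: VU.
- move=> V U sVU; have [m [sm mVU]] := simple_pair_maximal fgA sVU.
  have [i lt_i iP] := LP m sm; exists (delta_mx (Ordinal lt_i) 0) => P fgP prP.
  by rewrite -colE !mxE mVU // (iP d).
- move=> V W U sV sW sU VW WU [x xP] [y yP]; exists (x + y) => P fgP prP.
  by rewrite mulmxDr mxE -xP // -yP // /hdiff; abel.
Qed.

End Regular.
End SimpleSubquotients.

(** * Images of idempotents *)

Section Retract.
Variables (R : pzRingType) (M : lmodType R) (e : {linear M -> M}).

Definition fixed_pred : {pred M} := fun x => e x == x.

Fact fixed_closed : submod_closed fixed_pred.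
Proof.
split=> [|a x y]; rewrite !unfold_in ?linear0 // => /eqP ex /eqP ey.
by rewrite linearP ex ey.
Qed.

HB.instance Definition _ := GRing.isSubmodClosed.Build R M fixed_pred fixed_closed.

Record fixed : Type := Fixed { fixed_val :> M; _ : fixed_val \in fixed_pred }.
HB.instance Definition _ := [isSub for fixed_val].
HB.instance Definition _ := [Choice of fixed by <:].
HB.instance Definition _ := [SubChoice_isSubLmodule of fixed by <:].

Hypothesis eK : forall x, e (e x) = e x.

Lemma retract_module : exists (N : lmodType R) (i : {linear N -> M})
    (p : {linear M -> N}), (forall x, p (i x) = x) /\ (forall x, i (p x) = e x).
Proof.
have eP x : e x \in fixed_pred by apply/eqP; rewrite eK.
have lin_i : linear (fixed_val : fixed -> M) by [].
have lin_p : linear (fun x => Fixed (eP x)).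
  by move=> a x y; apply: val_inj; rewrite /= linearP.
exists fixed, (lin_of lin_i), (lin_of lin_p); split=> [x|x] //=.
by apply: val_inj => /=; apply/eqP; case: x.
Qed.

End Retract.

Lemma retract_fg (R : pzRingType) (M N : lmodType R) (i : {linear N -> M})
    (p : {linear M -> N}) : (forall x, p (i x) = x) ->
  finitely_generated M -> finitely_generated N.
Proof.
move=> pi [n [e eM]]; exists n, (fun j => p (e j)) => x.
have [c ix] := eM (i x); exists c; rewrite -[LHS]pi ix linear_sum.
by apply: eq_bigr => j _; rewrite linZ.
Qed.

Lemma retract_projective (R : pzRingType) (M N : lmodType R) (i : {linear N -> M})
    (p : {linear M -> N}) : (forall x, p (i x) = x) ->
  projective M -> projective N.
Proof.
move=> pi prM A B q f qsur; have [g gE] := prM A B q (f \o p) qsur.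
by exists (g \o i) => x; rewrite /= gE /= pi.
Qed.

(** * Fitting decompositions *)

Section Fitting.
Variables (k : fieldType) (Lambda : falgType k).
Implicit Types M N : lmodType Lambda.

Definition mdim M : nat := kdim (fun _ : kmod M => True).
Definition kimage M N (f : {linear M -> N}) : kmod N -> Prop :=
  fun y => exists x, f x = y.
Definition krank M N (f : {linear M -> N}) : nat := kdim (kimage f).

Lemma kimage_subspace M N (f : {linear M -> N}) : subspace (kimage f).
Proof.
apply: submod_subspace; split; first by exists 0; rewrite lin0.
by move=> a _ _ [x <-] [y <-]; exists (a *: x + y); rewrite linearP.
Qed.

Lemma kimage_fin_dim M N (f : {linear M -> N}) :
  finitely_generated N -> fin_dim (kimage f).
Proof.
by move=> fgN; apply: (fin_dim_sub (fg_fin_dim fgN)) => //; apply: kimage_subspace.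
Qed.

Lemma rank_leq M N (f : {linear M -> N}) :
  finitely_generated N -> (krank f <= mdim N)%N.
Proof. by move=> fgN; apply: dim_leq (fg_fin_dim fgN) (kimage_subspace f) _. Qed.

Lemma rank_inj M N (f : {linear M -> N}) : finitely_generated M ->
  injective f -> krank f = mdim M.
Proof.
move=> fgM injf; apply: esym; apply: (dim_inj (g := klin f)) => //.
- exact: fg_fin_dim.
- by move=> x _ fx; apply: injf; rewrite lin0.
- by move=> y; split=> [[x fx]|[x _ fx]]; exists x.
Qed.

Lemma rank_surj M N (f : {linear M -> N}) : finitely_generated N ->
  krank f = mdim N -> forall y, exists x, f x = y.
Proof.
move=> fgN rf y.
exact: dim_eq_sub (fg_fin_dim fgN) (kimage_subspace f) _ rf _ I.
Qed.

Lemma rank_full_inj M N (f : {linear M -> N}) : finitely_generated M ->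
  krank f = mdim M -> injective f.
Proof.
move=> fgM rf; pose K (x : kmod M) := f x = 0.
have e : mdim M = (kdim K + krank f)%N.
  apply: (dim_exact (g := klin f)) => //.
  - exact: fg_fin_dim.
  - by move=> x; split=> [|[]].
  - by move=> y; split=> [[x fx]|[x _ fx]]; exists x.
have sK : subspace K.
  apply: (@submod_subspace _ _ M); split; first exact: lin0.
  by move=> a x y fx fy; rewrite /K linearP fx fy scaler0 addr0.
have K0 x : K x -> x = 0.
  apply: dim0; first exact: (fin_dim_sub (fg_fin_dim fgM) sK).
  by apply/eqP; rewrite -(eqn_add2r (krank f)) -e rf.
move=> x y fxy; apply/eqP; rewrite -subr_eq0; apply/eqP; apply: K0.
by rewrite /K linB fxy subrr.
Qed.

(** When [f] and its square have the same rank, the module is the direct sum of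
the image and the kernel of [f]; this is the projection onto the image. *)
Lemma fitting_projection M (f : {linear M -> M}) : finitely_generated M ->
  krank (f \o f) = krank f -> exists e : {linear M -> M},
  (forall x, kimage f (e x)) /\
  (forall x y, kimage f y -> f y = f x -> y = e x) /\
  (forall x, f (e x) = f x).
Proof.
move=> fgM rf.
have im2 y : kimage f y -> kimage (f \o f) y.
  apply: dim_eq_sub (kimage_fin_dim f fgM) (kimage_subspace _) _ rf y.
  by move=> _ [x <-]; exists (f x).
pose K (x : kmod M) := kimage f x /\ f x = 0.
have e : krank f = (kdim K + krank (f \o f))%N.
  apply: (dim_exact (g := klin f)) => //.
  - exact: kimage_subspace.
  - exact: kimage_fin_dim.
  - move=> y; split=> [[x <-]|[_ [x <-] <-]]; last by exists x.
    by exists (f x) => //; exists x.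
have sK : subspace K.
  apply: (@submod_subspace _ _ M); split.
    by split; [exists 0|]; rewrite lin0.
  move=> a _ _ [[x <-] fx] [[y <-] fy]; split; last by rewrite linearP fx fy scaler0 addr0.
  by exists (a *: x + y); rewrite linearP.
have K0 x : K x -> x = 0.
  apply: dim0; first exact: (fin_dim_sub (fg_fin_dim fgM) sK).
  by apply/eqP; rewrite -(eqn_add2r (krank (f \o f))) -e rf.
have uniq y y' : kimage f y -> kimage f y' -> f y = f y' -> y = y'.
  move=> [x <-] [x' <-] ff; apply/eqP; rewrite -subr_eq0; apply/eqP; apply: K0.
  by split; [exists (x - x'); rewrite linB|rewrite linB ff subrr].
have [x|x y y' [iy fy] [iy' fy']|a x x' y y' [[z <-] fy] [[z' <-] fy']|g gE] :=
  @linear_choice _ M M (fun x y => kimage f y /\ f y = f x).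
- have [z /= zE] := im2 (f x) (ex_intro _ x erefl).
  by exists (f z); split=> //; exists z.
- by apply: uniq => //; rewrite fy.
- split; last by rewrite !linearP fy fy'.
  by exists (a *: z + z'); rewrite linearP.
exists g; split=> [x|]; first by case: (gE x).
split=> [x y iy fy|x]; last by case: (gE x).
by have [ig fg] := gE x; apply: uniq => //; rewrite fg.
Qed.

End Fitting.

(** * Minimal classes *)

Section Minimal.
Variables (k : fieldType) (Lambda : falgType k).
Implicit Types (X Y Z J K : pres Lambda).
Local Notation "M ** N" := (M * N)%type (at level 40, left associativity).

Definition pdim X : nat := (mdim (deg1 X) + mdim (deg0 X))%N.

Lemma idempotent_splits X (e1 : {linear deg1 X -> deg1 X})
    (e0 : {linear deg0 X -> deg0 X}) :
  (forall x, e1 (e1 x) = e1 x) -> (forall x, e0 (e0 x) = e0 x) ->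
  (forall x, e0 (pd X x) = pd X (e1 x)) ->
  exists J (i1 : {linear deg1 J -> deg1 X}) (p1 : {linear deg1 X -> deg1 J})
    (i0 : {linear deg0 J -> deg0 X}) (p0 : {linear deg0 X -> deg0 J}),
  [/\ (forall x, i0 (pd J x) = pd X (i1 x)) /\ (forall x, p0 (pd X x) = pd J (p1 x)),
      cancel i1 p1 /\ cancel i0 p0, forall x, i1 (p1 x) = e1 x
    & forall x, i0 (p0 x) = e0 x].
Proof.
move=> e1K e0K eC.
have [N1 [i1 [p1 [i1K p1E]]]] := retract_module e1K.
have [N0 [i0 [p0 [i0K p0E]]]] := retract_module e0K.
pose dJ : {linear N1 -> N0} := p0 \o pd X \o i1.
pose J := Pres dJ (retract_fg i1K (@deg1_fg _ X)) (retract_fg i0K (@deg0_fg _ X))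
  (retract_projective i1K (@deg1_proj _ X)) (retract_projective i0K (@deg0_proj _ X)).
exists J, i1, p1, i0, p0; split=> //; split=> x /=.
  by rewrite p0E eC -p1E i1K.
by rewrite p1E -eC -p0E i0K.
Qed.

Lemma leq_add_eq (a b c d : nat) :
  (a <= c)%N -> (b <= d)%N -> (c + d <= a + b)%N -> a = c /\ b = d.
Proof.
move=> ac bd cdab; split; apply/eqP; rewrite eqn_leq ?ac ?bd /=.
  by rewrite -(leq_add2r d) (leq_trans cdab) // leq_add2l.
by rewrite -(leq_add2l c) (leq_trans cdab) // leq_add2r.
Qed.

Lemma pdim_retract X J (i1 : {linear deg1 J -> deg1 X}) (p1 : {linear deg1 X -> deg1 J})
    (i0 : {linear deg0 J -> deg0 X}) (p0 : {linear deg0 X -> deg0 J}) :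
  cancel i1 p1 -> cancel i0 p0 ->
  (pdim J < pdim X)%N \/ (forall x, i1 (p1 x) = x) /\ (forall x, i0 (p0 x) = x).
Proof.
move=> i1K i0K; have fg1 := @deg1_fg _ X; have fg0 := @deg0_fg _ X.
have r1 := rank_inj (@deg1_fg _ J) (can_inj i1K).
have r0 := rank_inj (@deg0_fg _ J) (can_inj i0K).
have le1 := rank_leq i1 fg1; have le0 := rank_leq i0 fg0.
have [|ge] := ltnP (pdim J) (pdim X); [by left|right].
have [e1 e0] : krank i1 = mdim (deg1 X) /\ krank i0 = mdim (deg0 X).
  by rewrite /pdim -r1 -r0 in ge; apply: leq_add_eq.
split=> x; first by have [y <-] := rank_surj fg1 e1 x; rewrite i1K.
by have [y <-] := rank_surj fg0 e0 x; rewrite i0K.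
Qed.

(** If [u] is fixed up to homotopy by an endomorphism, then it vanishes up to
homotopy on the Fitting kernel of that endomorphism, which therefore splits off
both the third and the middle term of the extension. *)
Lemma ext_drop_summand Z X (u : {linear deg1 X -> deg0 Z})
    (f1 : {linear deg1 X -> deg1 X}) (f0 : {linear deg0 X -> deg0 X})
    (s : {linear deg1 X -> deg1 Z}) (t : {linear deg0 X -> deg0 Z}) :
  (forall x, f0 (pd X x) = pd X (f1 x)) ->
  (forall x, u x = u (f1 x) + pd Z (s x) + t (pd X x)) ->
  krank (f1 \o f1) = krank f1 -> krank (f0 \o f0) = krank f0 ->
  (injective f1 /\ injective f0) \/
  exists J K (v : {linear deg1 J -> deg0 Z}),
    [/\ (pdim J < pdim X)%N, qis (psum J K) X & qis (psum (ext v) K) (ext u)].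
Proof.
move=> fC uE r1 r0.
have [e1 [e1i [e1u e1f]]] := fitting_projection (@deg1_fg _ X) r1.
have [e0 [e0i [e0u e0f]]] := fitting_projection (@deg0_fg _ X) r0.
have eK1 x : e1 (e1 x) = e1 x by apply: esym; apply: e1u => //; rewrite e1f.
have eK0 x : e0 (e0 x) = e0 x by apply: esym; apply: e0u => //; rewrite e0f.
have eC x : e0 (pd X x) = pd X (e1 x).
  apply: esym; apply: e0u; last by rewrite !fC e1f.
  by have [y <-] := e1i x; exists (pd X y); rewrite fC.
have [J [i1 [p1 [i0 [p0 [[iC pC] [iK1 iK0] ip1 ip0]]]]]] := idempotent_splits eK1 eK0 eC.
have [|||K [j1 [q1 [j0 [q0 [[jC qC] [jK1 jK0] jq1 jq0]]]]]] :=
    @idempotent_splits X [lin fun x : deg1 X => x - e1 x] [lin fun x : deg0 X => x - e0 x].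
- by move=> x /=; push_linear; rewrite eK1; abel.
- by move=> x /=; push_linear; rewrite eK0; abel.
- by move=> x /=; push_linear; rewrite eC; abel.
have [ltJ|[J1 J0]] := pdim_retract iK1 iK0; last first.
  left; split=> x y fxy.
    by rewrite -[LHS]J1 -[RHS]J1 !ip1; apply: e1u => //; rewrite e1f.
  by rewrite -[LHS]J0 -[RHS]J0 !ip0; apply: e0u => //; rewrite e0f.
right; exists J, K, (u \o i1).
have ij1 x : i1 (p1 x) + j1 (q1 x) = x by rewrite ip1 jq1 /=; label.
have ij0 x : i0 (p0 x) + j0 (q0 x) = x by rewrite ip0 jq0 /=; label.
have e1i1 y : e1 (i1 y) = i1 y by rewrite -ip1 iK1.
have e0i0 y : e0 (i0 y) = i0 y by rewrite -ip0 iK0.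
have ej1 y : e1 (j1 y) = 0.
  by rewrite -(jK1 y) jq1 /= linB eK1 subrr.
have ej0 y : e0 (j0 y) = 0.
  by rewrite -(jK0 y) jq0 /= linB eK0 subrr.
have pj1 y : p1 (j1 y) = 0 by apply: (can_inj iK1); rewrite ip1 ej1 lin0.
have pj0 y : p0 (j0 y) = 0 by apply: (can_inj iK0); rewrite ip0 ej0 lin0.
have qi1 y : q1 (i1 y) = 0 by apply: (can_inj jK1); rewrite jq1 /= e1i1 subrr lin0.
have qi0 y : q0 (i0 y) = 0 by apply: (can_inj jK0); rewrite jq0 /= e0i0 subrr lin0.
have pij1 x y : p1 (i1 x + j1 y) = x by rewrite linD pj1 iK1 addr0.
have pij0 x y : p0 (i0 x + j0 y) = x by rewrite linD pj0 iK0 addr0.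
have qij1 x y : q1 (i1 x + j1 y) = y by rewrite linD qi1 jK1 add0r.
have qij0 x y : q0 (i0 x + j0 y) = y by rewrite linD qi0 jK0 add0r.
have uj y : u (j1 y) = pd Z (s (j1 y)) + t (j0 (pd K y)).
  have fj : f1 (j1 y) = 0 by rewrite -e1f ej1 lin0.
  by rewrite uE fj lin0 jC; label.
split=> //.
  pose F1 : {linear deg1 J ** deg1 K -> deg1 X} :=
    [lin fun x : deg1 J ** deg1 K => i1 x.1 + j1 x.2].
  pose F0 : {linear deg0 J ** deg0 K -> deg0 X} :=
    [lin fun x : deg0 J ** deg0 K => i0 x.1 + j0 x.2].
  apply: (@qis_strict _ (psum J K) X F1 F0 (fun x => (p1 x, q1 x)) (fun x => (p0 x, q0 x))) => //.
  - by move=> [x y] /=; rewrite !linD iC jC !lin0 addr0.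
  - by move=> [x y] /=; rewrite pij1 qij1.
  - by move=> [x y] /=; rewrite pij0 qij0.
pose F1 : {linear deg1 Z ** deg1 J ** deg1 K -> deg1 Z ** deg1 X} :=
  [lin fun x : deg1 Z ** deg1 J ** deg1 K => (x.1.1 - s (j1 x.2), i1 x.1.2 + j1 x.2)].
pose F0 : {linear deg0 Z ** deg0 J ** deg0 K -> deg0 Z ** deg0 X} :=
  [lin fun x : deg0 Z ** deg0 J ** deg0 K => (x.1.1 + t (j0 x.2), i0 x.1.2 + j0 x.2)].
apply: (@qis_strict _ (psum (ext (u \o i1)) K) (ext u) F1 F0
  (fun x => ((x.1 + s (j1 (q1 x.2)), p1 x.2), q1 x.2))
  (fun x => ((x.1 - t (j0 (q0 x.2)), p0 x.2), q0 x.2))).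
- move=> [[z x] y] /=; congr pair.
    by rewrite !linD !linN uj; label.
  by rewrite !linD iC jC !lin0 addr0.
- move=> [[z x] y] /=; rewrite pij1 qij1.
  by congr pair; congr pair; label.
- by move=> [z x] /=; rewrite ij1; congr pair; label.
- move=> [[z x] y] /=; rewrite pij0 qij0.
  by congr pair; congr pair; label.
- by move=> [z x] /=; rewrite ij0; congr pair; label.
Qed.

(** Among the extensions of [X] by [Z] with middle term in [calY] and [X] in
[calX], one with [X] of least dimension has a rigidity property: every
inflation [X -> X''] splits once [X''] has no extensions by the middle term.
Indeed the class then extends to [X''] and factors back through [X], and the
resulting endomorphism of [X] fixes the class, hence is invertible: otherwise a
summand could be dropped. *)
Lemma minimal_class (calX calY : pres Lambda -> Prop) Z :
  (forall X Y, qis X Y -> calX X -> calX Y) ->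
  (forall X Y, calX (psum X Y) -> calX X) ->
  (forall X Y, qis X Y -> calY X -> calY Y) ->
  (forall X Y, calY (psum X Y) -> calY X) ->
  (exists Y X, [/\ conf Z Y X, calY Y & calX X]) ->
  exists Y X, [/\ conf Z Y X, calY Y, calX X &
    forall X' Z', conf X X' Z' -> ext_zero X' Y -> qis (psum X Z') X'].
Proof.
move=> isoX sumX isoY sumY [Y0 [X0 [[u0 u0Y] Y0Y X0X]]].
pose P n := exists X (u : {linear deg1 X -> deg0 Z}),
  [/\ calX X, calY (ext u) & pdim X = n].
have [|_ [[X [u [XX YY <-]]] minX]] := @exists_min P.
  exists (pdim X0), X0, u0; split=> //.
  by apply: isoY Y0Y; apply: qis_sym.
exists (ext u), X; split=> //; first exact: conf_ext.
move=> X' Z' [w wX'] /ext_zero_qis /(_ (qis_sym wX') (qis_refl _)) E0.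
apply: qis_trans wX'; apply: qis_sym; apply: qis_ext_null.
pose u' : {linear deg1 (ext w) -> deg0 (ext u)} :=
  [lin fun x : deg1 X ** deg1 Z' => (u x.1, 0 : deg0 X)].
have [s [t st]] := E0 u'.
have stE x z : u x = pd Z (s (x, z)).1 + u (s (x, z)).2
                     + (t (pd X x + w z, pd Z' z)).1.
  by have /= := congr1 fst (st (x, z)).
have rE x z : pd X (s (x, z)).2 = - (t (pd X x + w z, pd Z' z)).2.
  by have /= e := congr1 snd (st (x, z)); apply: (eq_of_eq (esym e)); label.
(* On [X] the maps [s] and [t] are an endomorphism [f] and a homotopy showing
   that [f] fixes the class [u]; on [Z'] they are the homotopy that makes the
   image of [w] under [f] null. *)
have [s1 s1E] : exists s1 : {linear deg1 X -> deg1 Z}, forall x, s1 x = (s (x, 0)).1.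
  by exists (fst \o s \o inl_lin (deg1 X) (deg1 Z')).
have [f1 f1E] : exists f1 : {linear deg1 X -> deg1 X}, forall x, f1 x = (s (x, 0)).2.
  by exists (snd \o s \o inl_lin (deg1 X) (deg1 Z')).
have [r1 r1E] : exists r1 : {linear deg1 Z' -> deg1 X}, forall z, r1 z = (s (0, z)).2.
  by exists (snd \o s \o inr_lin (deg1 X) (deg1 Z')).
have [t0 t0E] : exists t0 : {linear deg0 X -> deg0 Z}, forall x, t0 x = (t (x, 0)).1.
  by exists (fst \o t \o inl_lin (deg0 X) (deg0 Z')).
have [f0 f0E] : exists f0 : {linear deg0 X -> deg0 X}, forall x, f0 x = - (t (x, 0)).2.
  by exists (\- (snd \o t \o inl_lin (deg0 X) (deg0 Z'))).
have [r0 r0E] : exists r0 : {linear deg0 Z' -> deg0 X}, forall z, r0 z = (t (0, z)).2.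
  by exists (snd \o t \o inr_lin (deg0 X) (deg0 Z')).
have fC x : f0 (pd X x) = pd X (f1 x).
  by have := rE x 0; rewrite !lin0 addr0 f0E f1E => ->.
have uf x : u x = u (f1 x) + pd Z (s1 x) + t0 (pd X x).
  by have := stE x 0; rewrite !lin0 addr0 f1E s1E t0E => ->; label.
have rw z : f0 (w z) = pd X (r1 z) + r0 (pd Z' z).
  have := rE 0 z; rewrite lin0 add0r r1E r0E f0E => ->.
  have -> : t (w z, pd Z' z) = t (w z, 0) + t (0, pd Z' z).
    by rewrite -linD; congr (t _); congr pair; rewrite /= ?addr0 ?add0r.
  by rewrite /=; label.
(* Endomorphisms fixing the class: one of least rank is injective, so all are. *)
pose F n := exists (g1 : {linear deg1 X -> deg1 X}) (g0 : {linear deg0 X -> deg0 X})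
    (a : {linear deg1 X -> deg1 Z}) (b : {linear deg0 X -> deg0 Z}),
  [/\ forall x, g0 (pd X x) = pd X (g1 x),
      forall x, u x = u (g1 x) + pd Z (a x) + b (pd X x)
    & (krank g1 + krank g0 = n)%N].
have [|n [[g1 [g0 [a [b [gC ug gn]]]]] minF]] := @exists_min F.
  by exists (krank f1 + krank f0)%N, f1, f0, s1, t0.
have fg1 := @deg1_fg _ X; have fg0 := @deg0_fg _ X.
have rank_comp (M : lmodType Lambda) (g : {linear M -> M}) : finitely_generated M ->
    (krank (g \o g) <= krank g)%N.
  move=> fgM; apply: dim_leq (kimage_fin_dim g fgM) (kimage_subspace _) _.
  by move=> _ [x <-]; exists (g x).
have [e1 e0] : krank (g1 \o g1) = krank g1 /\ krank (g0 \o g0) = krank g0.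
  apply: leq_add_eq; try exact: rank_comp.
  rewrite gn; apply: minF.
  exists (g1 \o g1), (g0 \o g0), (a \+ (a \o g1)), (b \+ (b \o g0)).
  split=> //= x; first by rewrite gC gC.
  by rewrite {1}ug {1}ug gC; label.
have [[inj1 inj0]|[J [K [v [ltJ JX vu]]]]] := ext_drop_summand gC ug e1 e0; last first.
  have : (pdim X <= pdim J)%N.
    apply: minX; exists J, v; split=> //.
      by apply: sumX; apply: isoX XX; apply: qis_sym JX.
    by apply: sumY; apply: isoY YY; apply: qis_sym vu.
  by rewrite leqNgt ltJ.
have [h1 h0] : krank f1 = mdim (deg1 X) /\ krank f0 = mdim (deg0 X).
  apply: leq_add_eq; try exact: rank_leq.
  rewrite -(rank_inj fg1 inj1) -(rank_inj fg0 inj0) gn.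
  by apply: minF; exists f1, f0, s1, t0.
have i1 := rank_full_inj fg1 h1; have i0 := rank_full_inj fg0 h0.
have [x|x y y' <- /i1|c x x' y y' <- <-|q1 q1E] :=
  @linear_choice _ (deg1 X) (deg1 X) (fun x y => f1 y = x) => //.
- exact: rank_surj.
- by rewrite linearP.
have [x|x y y' <- /i0|c x x' y y' <- <-|q0 q0E] :=
  @linear_choice _ (deg0 X) (deg0 X) (fun x y => f0 y = x) => //.
- exact: rank_surj.
- by rewrite linearP.
exists (q1 \o r1), (q0 \o r0) => z; apply: i0.
by rewrite rw linD /= fC q1E q0E.
Qed.

End Minimal.

(** * Approximations by a rigid class *)

Section Approximation.
Variables (k : fieldType) (Lambda : falgType k).
Implicit Types (X Y Z L M N W B : pres Lambda).
Local Notation "M ** N" := (M * N)%type (at level 40, left associativity).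

Variable I : pres Lambda -> Prop.
Hypothesis I_zero : I (pzero Lambda).
Hypothesis I_sum : forall X Y, I X -> I Y -> I (psum X Y).
Hypothesis I_rigid : forall X Y, I X -> I Y -> ext_zero X Y.

(** All maps from degree -1 of [M] to a finitely generated module factor through
one such map, from a power of [M], along morphisms of presentations: the maps
are combinations of finitely many. *)
Lemma universal_map M (C : lmodType Lambda) : I M -> finitely_generated C ->
  exists L (u : {linear deg1 L -> C}), I L /\
  forall f : {linear deg1 M -> C},
    exists (j1 : {linear deg1 M -> deg1 L}) (j0 : {linear deg0 M -> deg0 L}),
      (forall x, j0 (pd M x) = pd L (j1 x)) /\ forall x, u (j1 x) = f x.
Proof.
move=> IM fgC; have [m [F FP]] := hom_span (@deg1_fg _ M) fgC.
suff [L [u [IL uP]]] : exists L (u : {linear deg1 L -> C}), I L /\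
  forall c : 'I_m -> k,
    exists (j1 : {linear deg1 M -> deg1 L}) (j0 : {linear deg0 M -> deg0 L}),
      (forall x, j0 (pd M x) = pd L (j1 x)) /\
      forall x, u (j1 x) = \sum_i (c i)%:A *: F i x.
  exists L, u; split=> // f; have [c cE] := FP f.
  have [j1 [j0 [jC jE]]] := uP c.
  by exists j1, j0; split=> // x; rewrite jE cE.
elim: m F {FP} => [|m IH] F.
  exists (pzero Lambda), \0; split=> // c; exists \0, \0.
  by split=> [x|x] //; rewrite big_ord0.
have [L [u [IL uP]]] := IH (fun i => F (lift ord0 i)).
pose v : {linear deg1 M ** deg1 L -> C} := (F ord0 \o fst) \+ (u \o snd).
exists (psum M L), v; split; first exact: I_sum.
move=> c; have [j1 [j0 [jC jE]]] := uP (fun i => c (lift ord0 i)).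
have lin_a (N : lmodType Lambda) : linear (fun x : N => (c ord0)%:A *: x).
  by move=> b x y; rewrite scalerDr !scalerA mulr_algl mulr_algr.
pose a1 := lin_of (lin_a (deg1 M)); pose a0 := lin_of (lin_a (deg0 M)).
have [i1 i1E] : exists i1 : {linear deg1 M -> deg1 M ** deg1 L},
    forall x, i1 x = (a1 x, j1 x).
  exists ((inl_lin _ _ \o a1) \+ (inr_lin _ _ \o j1)) => x /=.
  by congr pair; rewrite /= ?addr0 ?add0r.
have [i0 i0E] : exists i0 : {linear deg0 M -> deg0 M ** deg0 L},
    forall x, i0 x = (a0 x, j0 x).
  exists ((inl_lin _ _ \o a0) \+ (inr_lin _ _ \o j0)) => x /=.
  by congr pair; rewrite /= ?addr0 ?add0r.
exists i1, i0; split=> x; rewrite !(i1E, i0E) /=.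
  by rewrite jC addr0 linZ.
by rewrite jE big_ord_recl linZ.
Qed.

(** The universal extension (Bongartz completion). *)
Lemma universal_extension M Z : I M ->
  exists L B, [/\ I L, conf Z B L & ext_zero M B].
Proof.
move=> IM; have [L [u [IL uP]]] := universal_map IM (@deg0_fg _ Z).
exists L, (ext u); split=> //; first exact: conf_ext.
move=> v; have [s2 [t2 e2]] := I_rigid IM IL (snd \o v).
have [j1 [j0 [jC jE]]] := uP ((fst \o v) \- (u \o s2)).
pose s : {linear deg1 M -> deg1 Z ** deg1 L} := inr_lin _ _ \o (s2 \+ j1).
pose t : {linear deg0 M -> deg0 Z ** deg0 L} := inr_lin _ _ \o (t2 \- j0).
exists s, t => x; apply: injective_projections => /=.
  by apply: (eq_of_eq (esym (jE x))) => /=; label.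
by apply: (eq_of_eq (e2 x)) => /=; push_linear; rewrite jC; label.
Qed.

(** The images in degree 0 of the maps from objects of [I] to [B], together with
the boundaries, form the kernel of a quotient [B0 / K] of the degree 0 part of
[B]. Over this quotient the differential of every [W] in [I] induces an
injection from [Hom(W0, B0 / K)] to [Hom(W1, B0 / K)], by rigidity, and the
cokernel is the extension group of [W] by [B]. Its vanishing is therefore seen
on dimensions. *)
Lemma ext_zero_numerical B : exists K : deg0 B -> Prop, submod K /\
  forall W, I W -> ext_zero W B <->
    hdiff (@deg0_fg _ W) K (fun=> True) = hdiff (@deg1_fg _ W) K (fun=> True).
Proof.
pose hit L (f0 : {linear deg0 L -> deg0 B}) (y : kmod (deg0 B)) :=
  exists (b : deg1 B) (l : deg0 L), (y : deg0 B) = pd B b + f0 l.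
have sub_hit L f0 : submod (M := deg0 B) (@hit L f0).
  split; first by exists 0, 0; label.
  move=> a x y [b [l ->]] [b' [l' ->]]; exists (a *: b + b'), (a *: l + l').
  by label.
have fB := fg_fin_dim (@deg0_fg _ B).
pose D n := exists L (f1 : {linear deg1 L -> deg1 B}) (f0 : {linear deg0 L -> deg0 B}),
  [/\ I L, forall x, f0 (pd L x) = pd B (f1 x) & kdim (hit L f0) = n].
have [||_ [[L [f1 [f0 [IL fC <-]]]] maxL]] :=
    @bounded_max D (kdim (fun _ : kmod (deg0 B) => True)).
- exists (kdim (hit (pzero Lambda) \0)), (pzero Lambda), \0, \0.
  by split=> [|x|] //=; rewrite lin0.
- move=> _ [L [f1 [f0 [_ _ <-]]]].
  by apply: dim_leq fB (submod_subspace (sub_hit L f0)) _.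
pose K : deg0 B -> Prop := hit L f0.
have sK : submod K := sub_hit L f0.
have Kd b : K (pd B b) by exists b, 0; rewrite lin0 addr0.
have Kf l : K (f0 l) by exists 0, l; rewrite lin0 add0r.
(* By maximality [K] absorbs every map from an object of [I]. *)
have absorb W (g1 : {linear deg1 W -> deg1 B}) (g0 : {linear deg0 W -> deg0 B}) :
    I W -> (forall x, g0 (pd W x) = pd B (g1 x)) -> forall y, K (g0 y).
  move=> IW gC y.
  pose h1 : {linear deg1 L ** deg1 W -> deg1 B} := (f1 \o fst) \+ (g1 \o snd).
  pose h0 : {linear deg0 L ** deg0 W -> deg0 B} := (f0 \o fst) \+ (g0 \o snd).
  have sub z : hit L f0 z -> hit (psum L W) h0 z.
    by move=> [b [l ->]]; exists b, (l, 0) => /=; rewrite lin0 addr0.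
  have fin : fin_dim (hit (psum L W) h0).
    by apply: (fin_dim_sub fB) => //; apply: submod_subspace (sub_hit (psum L W) h0).
  apply: (dim_eq_sub fin (submod_subspace sK) sub).
    apply/eqP; rewrite eqn_leq dim_leq //=; last exact: submod_subspace.
    apply: maxL; exists (psum L W), h1, h0; split=> //; first exact: I_sum.
    by move=> [a b] /=; rewrite addr0 fC gC linD.
  by exists 0, (0, y) => /=; rewrite !lin0 !add0r.
exists K; split=> // W IW.
have inj (g : {linear deg0 W -> deg0 B}) :
    (forall x, K (g (pd W x))) -> forall y, K (g y).
  move=> gK.
  have [|a x y [m1 m2] [n1 n2] /= em en|x|h hE] := @projective_select _ _ _
    (fun x (m : deg1 B * deg0 L) => g (pd W x) = pd B m.1 + f0 m.2)
    (@deg1_fg _ W) (@deg1_proj _ W).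
  - by rewrite /=; label.
  - by push_linear; rewrite em en /=; label.
  - by have [b [l e]] := gK x; exists (b, l).
  have [a [c acE]] := I_rigid IW IL (snd \o h).
  have chain x : (g \- (f0 \o c)) (pd W x) = pd B (((fst \o h) \+ (f1 \o a)) x).
    apply: (eq_of_eq (hE x)); apply: (eq_of_eq (congr1 f0 (acE x))) => /=.
    by push_linear; rewrite fC; label.
  move=> y; rewrite -[g y](subrK (f0 (c y))); apply: submodD => //.
  exact: (absorb W _ (g \- (f0 \o c)) IW chain).
have fgB := @deg0_fg _ B.
have -> : hdiff (@deg0_fg _ W) K (fun=> True) = hdiff (@deg1_fg _ W) K (fun=> True) <->
    (hdim (@deg0_fg _ W) (fun _ : deg0 B => True) + hdim (@deg1_fg _ W) K
     = hdim (@deg0_fg _ W) K + hdim (@deg1_fg _ W) (fun _ : deg0 B => True))%N.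
  split=> [e|/(congr1 (fun n : nat => n%:R : rat))]; last first.
    by rewrite !natrD => e; apply: (eq_of_eq e); rewrite /hdiff; abel.
  apply/eqP; rewrite -(Num.Theory.eqr_nat rat) !natrD; apply/eqP.
  by apply: (eq_of_eq e); rewrite /hdiff; abel.
rewrite (hdim_precompose (@deg0_fg _ W) (@deg1_fg _ W) (d := pd W) fgB sK inj).
split=> [E0 u|sur u].
  have [s [t st]] := E0 u; exists t => x.
  by rewrite st addrK; apply: Kd.
have [t tK] := sur u.
have [|a x y [m1 m2] [n1 n2] /= em en|x|h hE] := @projective_select _ _ _
    (fun x (m : deg1 B * deg0 L) => u x - t (pd W x) = pd B m.1 + f0 m.2)
    (@deg1_fg _ W) (@deg1_proj _ W).
- by rewrite /=; label.
- apply: (eq_of_eq en); apply: (eq_of_eq (congr1 (fun z => a *: z) em)).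
  by label.
- by have [b [l e]] := tK x; exists (b, l).
have [a [c acE]] := I_rigid IW IL (snd \o h).
exists ((fst \o h) \+ (f1 \o a)), (t \+ (f0 \o c)) => x /=.
apply: (eq_of_eq (hE x)); apply: (eq_of_eq (congr1 f0 (acE x))) => /=.
by push_linear; rewrite fC; label.
Qed.

(** A rigid class has only finitely many independent classes in the Grothendieck
group. Completing with respect to a sum of members that span the others is
enough, since the vanishing of extensions is linear in the class. *)
Lemma rigid_approximation Z :
  exists B L, [/\ I L, conf Z B L & forall W, I W -> ext_zero W B].
Proof.
have [r [cl clP]] := @hdiff_class k Lambda.
pose g W := cl _ (@deg0_fg _ W) - cl _ (@deg1_fg _ W).
have [m [G [IG spanG]]] := spanning_subfamily I g.
have [M [IM MG]] : exists M, I M /\ forall i, exists N, conf (G i) M N.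
  elim: m G IG {spanG} => [|m IH] G IG; first by exists (pzero Lambda); split=> // -[].
  have [M [IM MG]] := IH (fun i => G (lift ord0 i)) (fun i => IG _).
  exists (psum M (G ord0)); split=> [|i]; first exact: I_sum.
  case: (unliftP ord0 i) => [j ->|->].
    have [N GMN] := MG j; exists (psum N (G ord0)); exact: conf_psum_r.
  exists M; apply: conf_qis (conf_ext _) (qis_refl _) (psumC _ _) (qis_refl _).
have [L [B [IL ZBL MB]]] := universal_extension Z IM.
exists B, L; split=> // W IW.
have [K [sK KP]] := ext_zero_numerical B.
have [|x xE] := clP (deg0 B) K (fun=> True) (@deg0_fg _ B) sK (submodT _) => //.
have num W' : I W' -> ext_zero W' B <-> (g W' *m x) 0 0 = 0.
  move=> IW'; rewrite KP // !xE; try exact: deg0_proj; try exact: deg1_proj.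
  rewrite /g mulmxBl !mxE; split=> [->|/eqP]; first by rewrite subrr.
  by rewrite subr_eq0 => /eqP.
apply/num => //; have /submxP[c ->] := spanG W IW.
rewrite -mulmxA (_ : _ *m x = 0) ?mulmx0 ?mxE //.
apply/row_matrixP => i; rewrite row_mul rowK row0; apply/rowP => j.
rewrite !ord1 [RHS]mxE; apply/num => //; have [N GMN] := MG i.
exact: ext_zero_sub GMN MB.
Qed.

End Approximation.

(** * The calculus of conflations of two-term complexes *)

Section Calculus.
Variable R : pzRingType.
Implicit Types X Y Z P I A B C E : K2 R.

Lemma conflation_pres X Y Z (x y z : pres R) : conf x y z ->
  qis x (ofK X) -> qis y (ofK Y) -> qis z (ofK Z) -> has_conflation X Y Z.
Proof. by move=> xyz xX yY zZ; apply/conflationP; apply: conf_qis xyz xX yY zZ. Qed.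

Lemma toK_qis (x : pres R) : qis x (ofK (toK x)).
Proof. exact: qis_sym (ofK_toK x). Qed.

Lemma K2_iso_toK X : K2_iso (toK (ofK X)) X.
Proof. by apply/K2_isoP; apply: ofK_toK. Qed.

Lemma K2_iso_sym X Y : K2_iso X Y -> K2_iso Y X.
Proof. by move=> /K2_isoP XY; apply/K2_isoP; apply: qis_sym. Qed.

Lemma K2_iso_refl X : K2_iso X X.
Proof. by apply/K2_isoP; apply: qis_refl. Qed.

Lemma K2_iso_trans X Y Z : K2_iso X Y -> K2_iso Y Z -> K2_iso X Z.
Proof. by move=> /K2_isoP XY /K2_isoP YZ; apply/K2_isoP; apply: qis_trans XY YZ. Qed.

Lemma K2_sumC X Y : K2_iso (K2_sum X Y) (K2_sum Y X).
Proof.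
apply/K2_isoP; apply: qis_trans (ofK_sum X Y) _.
exact: qis_trans (psumC _ _) (qis_sym (ofK_sum Y X)).
Qed.

Lemma toK_sum (x y : pres R) : K2_iso (toK (psum x y)) (K2_sum (toK x) (toK y)).
Proof.
apply/K2_isoP; apply: qis_trans (ofK_toK _) _; apply: qis_sym.
apply: qis_trans (ofK_sum _ _) _.
apply: qis_trans (psum_qis _ (ofK_toK x)) _.
apply: qis_trans (psumC _ _) _; apply: qis_trans (psum_qis _ (ofK_toK y)) _.
exact: psumC.
Qed.

Lemma has_conflation_iso X X' Y Y' Z Z' : has_conflation X Y Z ->
  K2_iso X X' -> K2_iso Y Y' -> K2_iso Z Z' -> has_conflation X' Y' Z'.
Proof.
move=> /conflationP XYZ /K2_isoP XX /K2_isoP YY /K2_isoP ZZ.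
exact: conflation_pres XYZ XX YY ZZ.
Qed.

Lemma conflation_sum X Y : has_conflation X (K2_sum X Y) Y.
Proof.
apply: (conflation_pres (conf_ext _) (qis_refl _) _ (qis_refl _)).
exact: qis_sym (ofK_sum X Y).
Qed.

Lemma conflation_zero Y Z : has_conflation (K2_zero R) Y Z -> K2_iso Y Z.
Proof.
move=> /conflationP YZ; apply/K2_isoP; apply: conf_zero_left.
exact: conf_qis YZ (ofK_zero R) (qis_refl _) (qis_refl _).
Qed.

Lemma conflation_split X Y Z :
  has_conflation X Y Z -> E_zero Z X -> K2_iso (K2_sum X Z) Y.
Proof.
move=> /conflationP XYZ /E_zeroP ZX; apply/K2_isoP.
exact: qis_trans (ofK_sum X Z) (conf_split XYZ ZX).
Qed.

Lemma conflation_compose X1 X X2 X' Z :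
  has_conflation X1 X X2 -> has_conflation X X' Z ->
  exists Z1, has_conflation X1 X' Z1 /\ has_conflation X2 Z1 Z.
Proof.
move=> /conflationP XX /conflationP XZ.
have [z [c1 c2]] := conf_compose XX XZ; exists (toK z).
by split; [apply: conflation_pres c1 _ _ _|apply: conflation_pres c2 _ _ _];
  try exact: qis_refl; apply: toK_qis.
Qed.

Lemma conflation_extend A B C X' Z :
  has_conflation A B C -> has_conflation C X' Z ->
  exists B', has_conflation A B' X' /\ has_conflation B B' Z.
Proof.
move=> /conflationP XX /conflationP XZ.
have [z [c1 c2]] := conf_extend XX XZ; exists (toK z).
by split; [apply: conflation_pres c1 _ _ _|apply: conflation_pres c2 _ _ _];
  try exact: qis_refl; apply: toK_qis.
Qed.

Lemma conflation_pushout A B C X' Z :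
  has_conflation A B C -> has_conflation A X' Z ->
  exists E, has_conflation X' E C /\ has_conflation B E Z.
Proof.
move=> /conflationP XX /conflationP XZ.
have [z [c1 c2]] := conf_pushout XX XZ; exists (toK z).
by split; [apply: conflation_pres c1 _ _ _|apply: conflation_pres c2 _ _ _];
  try exact: qis_refl; apply: toK_qis.
Qed.

Lemma conflation_sum_l X X' Y Z :
  has_conflation X X' Z -> has_conflation (K2_sum X Y) (K2_sum X' Y) Z.
Proof.
move=> /conflationP XZ; apply: (conflation_pres (conf_psum_l (ofK Y) XZ)).
- exact: qis_sym (ofK_sum X Y).
- exact: qis_sym (ofK_sum X' Y).
- exact: qis_refl.
Qed.

Lemma conflation_sum_r X X' Y Z :
  has_conflation X X' Z -> has_conflation X (K2_sum X' Y) (K2_sum Z Y).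
Proof.
move=> /conflationP XZ; apply: (conflation_pres (conf_psum_r (ofK Y) XZ)).
- exact: qis_refl.
- exact: qis_sym (ofK_sum X' Y).
- exact: qis_sym (ofK_sum Z Y).
Qed.

Lemma conflation_stalks Z : exists P1 P0,
  [/\ is_stalk (ofK P1), is_stalk (ofK P0) & has_conflation P1 P0 Z].
Proof.
have [p1 [p0 [s1 s0 c]]] := conf_stalks (ofK Z); exists (toK p1), (toK p0).
by split=> //; apply: conflation_pres c _ _ _; try exact: qis_refl; apply: toK_qis.
Qed.

Lemma conflation_cross P E I X C : is_stalk (ofK P) ->
  has_conflation P E I -> has_conflation X E C ->
  exists C', has_conflation X I C' /\ has_conflation P C C'.
Proof.
move=> P0 /conflationP XX /conflationP XZ.
have [z [c1 c2]] := conf_cross P0 XX XZ; exists (toK z).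
by split; [apply: conflation_pres c1 _ _ _|apply: conflation_pres c2 _ _ _];
  try exact: qis_refl; apply: toK_qis.
Qed.

Lemma E_zero_iso X X' Y Y' :
  E_zero X Y -> K2_iso X X' -> K2_iso Y Y' -> E_zero X' Y'.
Proof.
move=> /E_zeroP XY /K2_isoP XX /K2_isoP YY; apply/E_zeroP.
exact: ext_zero_qis XY XX YY.
Qed.

Lemma E_zero_mid A X Y Z :
  has_conflation X Y Z -> E_zero A X -> E_zero A Z -> E_zero A Y.
Proof.
move=> /conflationP c /E_zeroP AX /E_zeroP AZ; apply/E_zeroP.
exact: ext_zero_mid c AX AZ.
Qed.

Lemma E_zero_quot A X Y Z : has_conflation X Y Z -> E_zero A Y -> E_zero A Z.
Proof.
by move=> /conflationP c /E_zeroP AY; apply/E_zeroP; apply: ext_zero_quot c AY.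
Qed.

Lemma E_zero_mid_l A X Y Z :
  has_conflation X Y Z -> E_zero X A -> E_zero Z A -> E_zero Y A.
Proof.
move=> /conflationP c /E_zeroP XA /E_zeroP ZA; apply/E_zeroP.
exact: ext_zero_mid_l c XA ZA.
Qed.

Lemma E_zero_sub A X Y Z : has_conflation X Y Z -> E_zero Y A -> E_zero X A.
Proof.
by move=> /conflationP c /E_zeroP YA; apply/E_zeroP; apply: ext_zero_sub c YA.
Qed.

Lemma E_zero_stalk P Y : is_stalk (ofK P) -> E_zero P Y.
Proof. by move=> sP; apply/E_zeroP; apply: stalk_ext_zero. Qed.

Lemma E_zero_0 X : E_zero X (K2_zero R).
Proof.
apply/E_zeroP => u; exists \0, \0 => z.
by rewrite (zero_module_rV0 (u z)) (zero_module_rV0 (_ + _)).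
Qed.

End Calculus.

(** * Orthogonal classes *)

Section Orthogonal.
Variable R : pzRingType.
Implicit Types (T : K2 R -> Prop) (X Y Z P I C : K2 R).

Definition perp_r T Y : Prop := forall X, T X -> E_zero X Y.
Definition perp_l T X : Prop := forall Y, T Y -> E_zero X Y.

Lemma perp_r_additive T : additive_subcat (perp_r T).
Proof.
split=> [X _|X Y TX TY W TW|X Y XY TX W TW]; first exact: E_zero_0.
  exact: E_zero_mid (conflation_sum X Y) (TX W TW) (TY W TW).
exact: E_zero_iso (TX W TW) (K2_iso_refl W) XY.
Qed.

Lemma perp_l_ext T X Y Z :
  has_conflation X Y Z -> perp_l T X -> perp_l T Z -> perp_l T Y.
Proof. by move=> c TX TZ W TW; apply: E_zero_mid_l c (TX W TW) (TZ W TW). Qed.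

Lemma perp_l_sub T X Y Z : has_conflation X Y Z -> perp_l T Y -> perp_l T X.
Proof. by move=> c TY W TW; apply: E_zero_sub c (TY W TW). Qed.

Lemma perp_l_iso T X Y : K2_iso X Y -> perp_l T X -> perp_l T Y.
Proof. by move=> XY TX W TW; apply: E_zero_iso (TX W TW) XY (K2_iso_refl W). Qed.

Lemma perp_l_stalk T P : is_stalk (ofK P) -> perp_l T P.
Proof. by move=> sP W _; apply: E_zero_stalk. Qed.

Lemma perp_l_additive T : additive_subcat (perp_l T).
Proof.
split=> [|X Y|X Y].
- apply: perp_l_stalk; exact: zero_module_rV0.
- exact: perp_l_ext (conflation_sum X Y).
- exact: perp_l_iso.
Qed.

Lemma perp_l_summand T X Y : perp_l T (K2_sum X Y) -> perp_l T X.
Proof. exact: perp_l_sub (conflation_sum X Y). Qed.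

Lemma perp_l_summand_r T X Y : perp_l T (K2_sum X Y) -> perp_l T Y.
Proof. by move/(perp_l_iso (K2_sumC X Y)); apply: perp_l_summand. Qed.

Lemma perp_r_quot T X Y Z : has_conflation X Y Z -> perp_r T Y -> perp_r T Z.
Proof. by move=> c TY W TW; apply: E_zero_quot c (TY W TW). Qed.

Lemma perp_r_summand T X Y : perp_r T (K2_sum X Y) -> perp_r T X.
Proof.
have [_ _ iso] := perp_r_additive T.
move/(iso _ _ (K2_sumC X Y)); exact: perp_r_quot (conflation_sum Y X).
Qed.

Definition cotorsion_of T : (K2 R -> Prop) * (K2 R -> Prop) :=
  (perp_l (perp_r T), perp_r T).

Lemma cotorsion_ofP T : is_cotorsion_pair (cotorsion_of T).
Proof.
split=> /=; [exact: perp_l_additive|exact: perp_r_additive| |by []].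
move=> Y; split=> [TY X|TY X TX]; first by apply.
by apply: TY => W TW; apply: TW.
Qed.

(** The analogue, for conflations, of the wide subcategory attached to a
torsion-free class. *)
Definition core (calX : K2 R -> Prop) X : Prop :=
  calX X /\ forall X' Z, calX X' -> has_conflation X X' Z -> calX Z.

(** The core of a left orthogonal class [calX] is thick: for closure under
cokernels the inflation into a member of [calX] is extended along the given
conflation, for kernels it is pushed out. *)
Lemma core_thick T : is_thick (core (perp_l T)).
Proof.
have iso X Y : K2_iso X Y -> core (perp_l T) X -> core (perp_l T) Y.
  move=> XY [TX coreX]; split; first exact: perp_l_iso XY TX.
  move=> X' Z TX' c; apply: coreX TX' _.
  exact: has_conflation_iso c (K2_iso_sym XY) (K2_iso_refl _) (K2_iso_refl _).
have ext X Y Z : has_conflation X Y Z ->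
    core (perp_l T) X -> core (perp_l T) Z -> core (perp_l T) Y.
  move=> c [TX coreX] [TZ coreZ]; split; first exact: perp_l_ext c TX TZ.
  move=> X' W TX' c'; have [W1 [c1 c2]] := conflation_compose c c'.
  exact: coreZ (coreX _ _ TX' c1) c2.
split; first split.
- split=> [|X' Z TX' /conflation_zero]; first by case: (perp_l_additive T).
  by move/perp_l_iso; apply.
- by move=> X Y; apply: ext (conflation_sum X Y).
- exact: iso.
- move=> X Y [S XSY] coreY; have [TXS coreXS] := iso _ _ (K2_iso_sym XSY) coreY.
  split; first exact: perp_l_summand TXS.
  move=> X' Z TX' c; apply: coreXS (conflation_sum_l S c).
  have [_ sum _] := perp_l_additive T; apply: sum => //.
  exact: perp_l_summand_r TXS.
- move=> X Y Z c; split; [|exact: ext|].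
    move=> [TX coreX] [TY coreY]; split; first exact: coreX TY c.
    move=> X' W TX' c'; have [B [c1 c2]] := conflation_extend c c'.
    exact: coreY (perp_l_ext c1 TX TX') c2.
  move=> [TY coreY] [TZ coreZ]; split; first exact: perp_l_sub c TY.
  move=> X' W TX' c'; have [B [c1 c2]] := conflation_pushout c c'.
  exact: coreY (perp_l_ext c1 TX' TZ) c2.
Qed.

Lemma cotorsion_left (c : (K2 R -> Prop) * (K2 R -> Prop)) :
  is_cotorsion_pair c -> c.1 = perp_l c.2.
Proof. by case=> _ _ _ c1; apply: funext => X; apply: propext; apply: c1. Qed.

Lemma cotorsion_right (c : (K2 R -> Prop) * (K2 R -> Prop)) :
  is_cotorsion_pair c -> c.2 = perp_r c.1.
Proof. by case=> _ _ c2 _; apply: funext => X; apply: propext; apply: c2. Qed.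

Lemma cotorsion_core_thick c : is_cotorsion_pair c -> is_thick (core c.1).
Proof. by move/cotorsion_left->; apply: core_thick. Qed.

End Orthogonal.

(** * The correspondence *)

Section Bijections.
Variables (k : fieldType) (Lambda : falgType k).
Implicit Types (X Y Z P I C E L W : K2 Lambda) (T : K2 Lambda -> Prop).
Implicit Types c : (K2 Lambda -> Prop) * (K2 Lambda -> Prop).

(** Take a third term of least dimension. Every inflation from it into the left
class splits, so the cokernel is a summand of a member of that class. *)
Lemma complete_core c Z : is_cotorsion_pair c -> is_complete c ->
  exists Y X, [/\ has_conflation Z Y X, c.2 Y & core c.1 X].
Proof.
move=> cp compl; have e1 := cotorsion_left cp; have e2 := cotorsion_right cp.
have [_ [Y0 [X0 [Y0Y X0X c0]]]] := compl Z.
have isoX X X' : K2_iso X X' -> c.1 X -> c.1 X'.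
  by rewrite e1; apply: perp_l_iso.
have isoY Y Y' : K2_iso Y Y' -> c.2 Y -> c.2 Y'.
  by rewrite e2; case: (perp_r_additive c.1) => _ _; apply.
have toK_iso (x y : pres Lambda) : qis x y -> K2_iso (toK x) (toK y).
  move=> xy; apply/K2_isoP; apply: qis_trans (ofK_toK x) _.
  exact: qis_trans xy (toK_qis y).
have [|||||y [x [zyx yY xX minx]]] := @minimal_class _ _
    (fun x => c.1 (toK x)) (fun y => c.2 (toK y)) (ofK Z).
- by move=> x y /toK_iso; apply: isoX.
- move=> x y /(isoX _ _ (toK_sum x y)); rewrite e1; exact: perp_l_summand.
- by move=> x y /toK_iso; apply: isoY.
- move=> x y /(isoY _ _ (toK_sum x y)); rewrite e2; exact: perp_r_summand.
- exists (ofK Y0), (ofK X0); split; first exact/conflationP.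
    exact: isoY (K2_iso_sym (K2_iso_toK Y0)) Y0Y.
  exact: isoX (K2_iso_sym (K2_iso_toK X0)) X0X.
exists (toK y), (toK x); split=> //.
  by apply: conflation_pres zyx _ _ _; try exact: qis_refl; apply: toK_qis.
split=> // X' Z' X'X /conflationP xX'.
have split_x : qis (psum x (ofK Z')) (ofK X').
  apply: minx; first exact: conf_qis xX' (ofK_toK x) (qis_refl _) (qis_refl _).
  have /E_zeroP E0 : E_zero X' (toK y) by move: yY; rewrite e2; apply.
  exact: ext_zero_qis E0 (qis_refl _) (ofK_toK y).
have isoX' : K2_iso X' (K2_sum (toK x) Z').
  apply/K2_isoP; apply: qis_trans (qis_sym split_x) _.
  apply: qis_trans (psum_qis _ (toK_qis x)) _; exact: qis_sym (ofK_sum _ _).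
move: (isoX _ _ isoX' X'X); rewrite e1; exact: perp_l_summand_r.
Qed.

Lemma complete_enough_injectives c : is_cotorsion_pair c -> is_complete c ->
  has_enough_injectives (core c.1).
Proof.
move=> cp compl X coreX; have [_ _ thick3] := cotorsion_core_thick cp.
have [Y [X' [XYX' YY coreX']]] := complete_core X cp compl.
have [_ mid _] := thick3 _ _ _ XYX'.
exists Y, X'; split=> //; split; first exact: mid.
by move=> W [WX _]; move: YY; rewrite (cotorsion_right cp); apply.
Qed.

(** An object right orthogonal to the core splits off the middle term of its
coresolution by the core. *)
Lemma cotorsion_of_core c : is_cotorsion_pair c -> is_complete c ->
  cotorsion_of (core c.1) = c.
Proof.
move=> cp compl; have e1 := cotorsion_left cp; have e2 := cotorsion_right cp.
have eY : perp_r (core c.1) = c.2.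
  apply: funext => Y; apply: propext; split=> [pY|YY W [WX _]]; last first.
    by move: YY; rewrite e2; apply.
  have [Y' [X [YY'X Y'Y coreX]]] := complete_core Y cp compl.
  have iso := conflation_split YY'X (pY X coreX).
  have [_ _ isoY] := perp_r_additive c.1.
  move: Y'Y; rewrite e2 => /(isoY _ _ (K2_iso_sym iso)); exact: perp_r_summand.
by rewrite /cotorsion_of eY -e1; case: c {cp compl e1 e2 eY}.
Qed.

Section EnoughInjectives.
Variable T : K2 Lambda -> Prop.
Hypothesis thickT : is_thick T.
Hypothesis enoughT : has_enough_injectives T.
Local Notation calX := (perp_l (perp_r T)).

Lemma sub_calX X : T X -> calX X.
Proof. by move=> TX Y; apply. Qed.

(** The injectives of [T] form a rigid class. Since there are no second extensions
and every object of [T] embeds into an injective, this class has the same right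
orthogonal as [T]. *)
Lemma injective_approximation Z : exists B L,
  [/\ has_conflation Z B L, perp_r T B & injective_in T L].
Proof.
have [[T0 TD Tiso] Tsum T3] := thickT.
have [|x y [Tx Ix] [Ty Iy]|x y [Tx Ix] [Ty Iy]|b [l [Il zbl WB]]] :=
    @rigid_approximation _ _ (fun x => injective_in T (toK x)) _ _ _ (ofK Z).
- have iso : K2_iso (K2_zero Lambda) (toK (pzero Lambda)).
    by apply/K2_isoP; apply: qis_trans (ofK_zero _) (toK_qis _).
  split; first exact: Tiso iso T0.
  by move=> X _; apply: E_zero_iso (@E_zero_0 _ X) (K2_iso_refl X) iso.
- have iso := K2_iso_sym (toK_sum x y).
  split; first exact: Tiso iso (TD _ _ Tx Ty).
  move=> X TX; have E0 : E_zero X (K2_sum (toK x) (toK y)).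
    exact: E_zero_mid (conflation_sum _ _) (Ix X TX) (Iy X TX).
  exact: E_zero_iso E0 (K2_iso_refl X) iso.
- have /E_zeroP E0 := Iy _ Tx; exact: ext_zero_qis E0 (ofK_toK x) (ofK_toK y).
exists (toK b), (toK l); split=> //.
  by apply: conflation_pres zbl _ _ _; try exact: qis_refl; apply: toK_qis.
move=> X TX; have [I [X' [[TI II] TX' c]]] := enoughT TX.
have iso := K2_iso_sym (K2_iso_toK I).
apply: E_zero_sub c _; apply/E_zeroP.
apply: ext_zero_qis (WB (ofK I) _) (qis_refl _) (toK_qis b).
split; first exact: Tiso iso TI.
by move=> W TW; apply: E_zero_iso (II W TW) (K2_iso_refl W) iso.
Qed.

(** Salce's construction: push the presentation of [Z] by projectives out along
the approximation of the kernel. *)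
Lemma salce Z : exists Y E P L,
  [/\ has_conflation Y E Z, has_conflation P E L, is_stalk (ofK P), perp_r T Y
    & injective_in T L].
Proof.
have [P1 [P0 [s1 s0 c]]] := conflation_stalks Z.
have [B [L [c' pB IL]]] := injective_approximation P1.
have [E [c1 c2]] := conflation_pushout c c'.
by exists B, E, P0, L.
Qed.

Lemma cotorsion_of_complete : is_complete (cotorsion_of T).
Proof.
move=> Z; split.
  have [Y [E [P [L [c1 c2 sP pY [TL _]]]]]] := salce Z.
  exists Y, E; split=> //=; apply: perp_l_ext c2 _ (sub_calX TL).
  exact: perp_l_stalk.
have [B [L [c pB [TL _]]]] := injective_approximation Z.
by exists B, L; split=> //=; apply: sub_calX.
Qed.

(** Salce's construction makes [X'], up to a summand [Y], an extension of an
injective [L] of [T] by a projective [P]. The composite from [X] to [L] is again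
an inflation, with cokernel [C] in [T], and the sum of [Z] and [Y] is an
extension of [C] by [P]. *)
Lemma sub_core X : T X -> core calX X.
Proof.
move=> TX; split; first exact: sub_calX.
move=> X' Z X'X c; have [_ _ T3] := thickT.
have [Y [E [P [L [cE cP sP pY [TL _]]]]]] := salce X'.
have iso := conflation_split cE (X'X Y pY).
have cXE : has_conflation X E (K2_sum Z Y).
  apply: (has_conflation_iso (conflation_sum_r Y c)); try exact: K2_iso_refl.
  exact: K2_iso_trans (K2_sumC X' Y) iso.
have [C [cXL cPC]] := conflation_cross sP cP cXE.
have [TC _ _] := T3 _ _ _ cXL.
apply: (@perp_l_summand _ _ Z Y); apply: perp_l_ext cPC _ (sub_calX (TC TX TL)).
exact: perp_l_stalk.
Qed.

(** A member of the core has an injective coresolution in [T] whose cokernel is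
again in the core and moreover right orthogonal to [T]. *)
Lemma core_coresolution X : core calX X -> exists I C,
  [/\ T I, has_conflation X I C, core calX C & perp_r T C].
Proof.
move=> coreX; have [XX _] := coreX.
have [Y [E [P [L [cE cP sP pY [TL _]]]]]] := salce X.
have iso := conflation_split cE (XX Y pY).
have cXE : has_conflation X E Y.
  apply: (has_conflation_iso (conflation_sum X Y)); try exact: K2_iso_refl.
  exact: K2_iso_trans (K2_sumC X Y) iso.
have [C [cXL cPC]] := conflation_cross sP cP cXE.
have [_ _ core3] := core_thick (perp_r T); have [coreC _ _] := core3 _ _ _ cXL.
exists L, C; split=> //; first exact: coreC (sub_core TL).
exact: perp_r_quot cPC pY.
Qed.

(** The cokernel [C] of a first coresolution is right orthogonal to [T], so its own
coresolution splits and [C] is a summand of a member of [T]. *)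
Lemma core_sub X : core calX X -> T X.
Proof.
move=> coreX; have [_ Tsum T3] := thickT.
have [I [C [TI c coreC pC]]] := core_coresolution coreX.
have [I' [C' [TI' c' [C'X _] _]]] := core_coresolution coreC.
have [_ _] := T3 _ _ _ c; apply=> //; apply: Tsum TI'.
exists C'; apply: conflation_split c' _; exact: C'X.
Qed.

Lemma core_cotorsion_of : core (cotorsion_of T).1 = T.
Proof.
by apply: funext => X; apply: propext; split; [apply: core_sub|apply: sub_core].
Qed.

End EnoughInjectives.
End Bijections.

Theorem theorem3p1 (k : fieldType) (Lambda : falgType k) :
  exists (beta : cotor Lambda -> thick Lambda)
         (iota : thick Lambda -> cotor Lambda),
    (forall c : cotor Lambda, is_complete (sval c) ->
       has_enough_injectives (sval (beta c)) /\ iota (beta c) = c) /\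
    (forall T : thick Lambda, has_enough_injectives (sval T) ->
       is_complete (sval (iota T)) /\ beta (iota T) = T).
Proof.
exists (fun c => exist _ (core (sval c).1) (cotorsion_core_thick (svalP c))).
exists (fun T => exist _ (cotorsion_of (sval T)) (cotorsion_ofP (sval T))).
split=> [[c cp] /= compl|[T thickT] /= enoughT].
  split; first exact: complete_enough_injectives.
  by apply: eq_exist; apply: cotorsion_of_core.
split; first exact: cotorsion_of_complete.
by apply: eq_exist; apply: core_cotorsion_of.
Qed.
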